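(* For each $n\in\{14,16,18,20,22,23,24,25,26,27\}$ one has $h(n)=\widetilde h(n)$ and $\overline{\mathrm{cr}}(n)=\widetilde{\mathrm{cr}}(n)$, and the values are: $$\begin{array}{c|cccccccccc} n&14&16&18&20&22&23&24&25&26&27\\ \hline h(n)=\widetilde h(n)&22&27&33&38&44&75&51&85&57&96\\ \overline{\mathrm{cr}}(n)=\widetilde{\mathrm{cr}}(n)&324&603&1029&1657&2528&3077&3699&4430&5250&6180 \end{array}$$
   Context: Geometric quantities. All point sets are finite, in the plane, and in general position (no three collinear). For a set $P$ of $n$ points, $\mathrm{cr}(P)$ is the number of crossings (pairs of segments intersecting in their interiors) when all straight segments joining pairs of points of $P$ are drawn, and $\overline{\mathrm{cr}}(n)=\min\{\mathrm{cr}(P):|P|=n\}$. A halving line of $P$ is a line through two points of $P$ leaving exactly $\lfloor n/2\rfloor-1$ points of $P$ on one side (so $n/2-1$ points on each side if $n$ is even, and $(n-3)/2$ on one side and $(n-1)/2$ on the other if $n$ is odd); $h(P)$ is the number of halving lines of $P$ and $h(n)=\max\{h(P):|P|=n\}$. Pseudolinear quantities. A simple allowable sequence on $[n]=\{1,\dots,n\}$ is a doubly infinite sequence $\Pi=(\dots,\pi_{-1},\pi_0,\pi_1,\dots)$ of permutations of $[n]$ such that consecutive permutations differ by a transposition of two elements in adjacent positions, and $\pi_j$ is the reverse of $\pi_{j+\binom n2}$ for every $j$. A halfperiod is a block of $\binom n2+1$ consecutive permutations. A transposition of the elements in positions $j$ and $j+1$ is a $j$-transposition; for $1\le j\le n/2$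 it is $j$-critical if it is a $j$-transposition or an $(n-j)$-transposition. $E_k(\Pi)$ is the number of $(k+1)$-critical transpositions in any halfperiod of $\Pi$, $0\le k\le n/2-1$. Put $h(\Pi)=E_{\lfloor n/2\rfloor-1}(\Pi)$ and let $\widetilde h(n)$ be the maximum of $h(\Pi)$ over all simple allowable sequences $\Pi$ on $[n]$. A pseudoline is a simple curve in the plane extending infinitely in both directions (equivalently, a curve in the projective plane whose removal does not disconnect it). A simple generalized configuration of points consists of $n$ points and $\binom n2$ pseudolines such that each pseudoline passes through exactly two of the points and any two pseudolines intersect exactly once; a pseudosegment is the segment of a pseudoline joining its two points. By Goodman and Pollack, simple allowable sequences on $[n]$ correspond to simple generalized configurations of $n$ points. $\mathrm{cr}(\Pi)$ is the number of pseudosegment-crossings in the generalized configuration corresponding to $\Pi$; equivalently (a known identity), $$\mathrm{cr}(\Pi)=3\binom n4-\sum_{k=0}^{\lfloor n/2\rfloor-1}k(n-k-2)E_k(\Pi).$$ $\widetilde{\mathrm{cr}}(n)$ is the minimum of $\mathrm{cr}(\Pi)$ over all simple allowable sequences $\Pi$ on $[n]$. *)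

(* Defs.v *)
From HB Require Import structures.
From mathcomp Require Import all_boot all_order all_algebra all_fingroup.
From mathcomp Require Import boolp classical_sets reals.

Set Implicit Arguments.
Unset Strict Implicit.
Unset Printing Implicit Defensive.

Import Order.TTheory GRing.Theory Num.Theory.

Local Open Scope ring_scope.

(* Maximum and minimum of a set of naturals; both default to 0 when they do
   not exist. *)
Definition is_max (S : nat -> Prop) (m : nat) : Prop :=
  S m /\ forall k : nat, S k -> (k <= m)%N.
Definition is_min (S : nat -> Prop) (m : nat) : Prop :=
  S m /\ forall k : nat, S k -> (m <= k)%N.
Definition max_of (S : nat -> Prop) : nat := xget 0%N (is_max S).
Definition min_of (S : nat -> Prop) : nat := xget 0%N (is_min S).

(* Number of unordered pairs of segments {ij, kl} on the vertex set 'I_n that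
   satisfy X.  Each segment is written with its smaller endpoint first, and
   each pair with the segment of smaller first endpoint first.  Pairs with
   i = k are thereby left out: below, X never holds for segments sharing an
   endpoint (for points, by general position). *)
Definition nb_segment_pairs (n : nat) (X : 'I_n -> 'I_n -> 'I_n -> 'I_n -> bool)
    : nat :=
  #|[set q : ('I_n * 'I_n) * ('I_n * 'I_n) |
      [&& (q.1.1 < q.1.2)%N, (q.2.1 < q.2.2)%N, (q.1.1 < q.2.1)%N
        & X q.1.1 q.1.2 q.2.1 q.2.2]]|.

Section Geometric.
Variable R : realType.

(* Twice the signed area of the triangle abc: zero iff a, b, c are collinear,
   and otherwise its sign tells the side of the line ab on which c lies. *)
Definition orient (a b c : R * R) : R :=
  (b.1 - a.1) * (c.2 - a.2) - (b.2 - a.2) * (c.1 - a.1).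

Definition open_segment (a b x : R * R) : Prop :=
  exists t : R, [/\ 0 < t, t < 1
    & x = ((1 - t) * a.1 + t * b.1, (1 - t) * a.2 + t * b.2)].

Definition segments_cross (a b c d : R * R) : Prop :=
  exists x : R * R, open_segment a b x /\ open_segment c d x.

(* A set of n points is given by an injective enumeration p of its elements. *)
Definition general_position (n : nat) (p : 'I_n -> R * R) : Prop :=
  injective p /\
  forall i j k : 'I_n, i != j -> i != k -> j != k ->
    orient (p i) (p j) (p k) != 0.

Definition cr_points (n : nat) (p : 'I_n -> R * R) : nat :=
  nb_segment_pairs
    (fun i j k l => `[< segments_cross (p i) (p j) (p k) (p l) >]).

Definition halving (n : nat) (p : 'I_n -> R * R) (i j : 'I_n) : bool :=
  (#|[set k | (0 : R) < orient (p i) (p j) (p k)]| == n./2.-1) ||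
  (#|[set k | orient (p i) (p j) (p k) < (0 : R)]| == n./2.-1).

(* In general position, distinct pairs of points span distinct lines. *)
Definition h_points (n : nat) (p : 'I_n -> R * R) : nat :=
  #|[set e : 'I_n * 'I_n | (e.1 < e.2)%N && halving p e.1 e.2]|.

Definition rectilinear_cr (n : nat) : nat :=
  min_of (fun m => exists p : 'I_n -> R * R,
    general_position p /\ cr_points p = m).

Definition halving_max (n : nat) : nat :=
  max_of (fun m => exists p : 'I_n -> R * R,
    general_position p /\ h_points p = m).

End Geometric.

Section Pseudolinear.
Variable n : nat.
Implicit Types (Pi : int -> 'S_n) (j : int) (a b c d : 'I_n).

(* [Pi j] maps positions to elements.  Positions are numbered from 1 in the
   k-transposition terminology, so position k is the ordinal k - 1.  Products
   in 'S_n are read left to right. *)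
Definition transposition_at Pi j (k : nat) : bool :=
  [exists u : 'I_n, exists v : 'I_n,
    [&& u.+1 == k, v == k :> nat & Pi (j + 1) == (tperm u v * Pi j)%g]].

Definition allowable Pi : Prop :=
  (forall j, exists k : nat, transposition_at Pi j k) /\
  (forall j (i : 'I_n), Pi (j + ('C(n, 2))%:Z) i = Pi j (rev_ord i)).

Definition critical Pi j (k : nat) : bool :=
  transposition_at Pi j k || transposition_at Pi j (n - k)%N.

(* Counted in the halfperiod Pi 0, ..., Pi 'C(n, 2).  The reversal condition
   exchanges k- and (n - k)-transpositions, so every halfperiod gives the same
   count. *)
Definition E_ Pi (k : nat) : nat :=
  #|[set t : 'I_('C(n, 2)) | critical Pi (t : nat)%:Z k.+1]|.

Definition h_seq Pi : nat := E_ Pi n./2.-1.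

Definition swaps Pi j a b : bool :=
  (a != b) && (Pi (j + 1) == (Pi j * tperm a b)%g).

Definition before Pi j c a : bool := (((Pi j)^-1)%g c < ((Pi j)^-1)%g a)%N.

(* In the generalized configuration associated with Pi, the elements preceding
   (resp. following) the pair a, b at the moment when a and b are swapped are
   the points on one (resp. the other) side of the pseudoline through a and b.
   Hence this says that c and d lie on opposite sides of that pseudoline. *)
Definition separates Pi a b c d : bool :=
  [exists t : 'I_('C(n, 2)), let j := (t : nat)%:Z in
    swaps Pi j a b &&
    ([&& before Pi j c a, before Pi j c b, before Pi j a d & before Pi j b d] ||
     [&& before Pi j d a, before Pi j d b, before Pi j a c & before Pi j b c])].

(* Two pseudolines meet exactly once, and cross there; so the pseudosegments
   ab and cd intersect in their interiors iff each of the two pseudolines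
   separates the endpoints of the other pseudosegment. *)
Definition pseudosegments_cross Pi a b c d : bool :=
  separates Pi a b c d && separates Pi c d a b.

Definition cr_seq Pi : nat := nb_segment_pairs (pseudosegments_cross Pi).

Definition pseudolinear_cr : nat :=
  min_of (fun m => exists Pi, allowable Pi /\ cr_seq Pi = m).

Definition pseudo_halving_max : nat :=
  max_of (fun m => exists Pi, allowable Pi /\ h_seq Pi = m).

End Pseudolinear.

(* Main.v *)
Require Import Defs.
From mathcomp Require Import boolp classical_sets reals.
From mathcomp Require Import all_boot all_order all_algebra all_fingroup zify.
From Stdlib Require BinNat.

Set Implicit Arguments.
Unset Strict Implicit.
Unset Printing Implicit Defensive.

(** Point sets and allowable sequences are studied through one common object, a
    [sweep]: a sequence of linear orders on n elements in which every step
    exchanges two neighbours and N = 'C(n, 2) steps reverse the order.  The points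
    of a configuration yield a sweep when they are ordered along a rotating
    direction ([points_sweep]); sweeps and allowable sequences are interchangeable
    ([allowable_sweep], [sweep_allowable]).  Whether a pair is halving depends only
    on the number l of elements in front of the pair at its swap.  The same numbers
    give the crossings: among any four elements, the separations (a pair lies on a
    line separating the other two) and the crossings add up to 3 ([quad_uniq]), and
    summing over all quadruples makes the number of crossings plus the sum of
    l (n - 2 - l) over all swaps equal to 3 'C(n, 4) ([ncrossings_sum]).  It thus
    suffices to bound, for every sweep, how many swaps happen near the ends.

    Call a swap critical for k if fewer than k elements lie on one of its sides.
    There are at least 3 'C(k + 1, 2) + sum_(j <= k) max(0, 3 j - n) critical swaps
    ([critical_lower_bound]).  This is proved by induction for the swaps within
    any set A of elements, of size n say, by removing hull elements, those that
    come first at some moment.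
    If 3 k <= n, removing one hull element and lowering k by one loses at least 3 k
    critical swaps ([remove_one_hull]).  If 3 k > n, take a minimal set V of hull
    elements which meets the first k elements of A at all times.  It has at least
    three elements, never three of them together among the first k, and removing it
    while lowering k by two loses enough ([remove_hull]), provided that for #|V| = 3
    another 3 k - n swaps are found.  These take place while a single element of V
    is among the first k ([count_extra]).

    A second bound concerns the central swaps.  An element staying among the
    K = n - 2 k middle ones can swap there only with those it meets at its arrival
    and with those that arrive later, so the number of swaps inside the middle is
    at most (K - 1) times the number of swaps at its border, as soon as the latter
    is at least n - 1 ([central_bound]); otherwise the same holds up to an additive
    term ([central_bound_weak]).  With k the last index before the halving swaps
    this bounds their number ([nhalving_bound]), and with the first bound also the
    number of crossings ([ncrossings_bound]).

    For each of the ten values of n, an explicit point set attains both bounds at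
    once.  As its sweep is an allowable sequence with the same counts, the geometric
    and the pseudolinear extrema coincide ([extremal_values]). *)

(** * Counting events in time *)

Definition count_times (P : pred nat) (a b : nat) : nat := \sum_(a <= t < b) P t.

Lemma count_times_cat P a b c : a <= b <= c ->
  count_times P a c = count_times P a b + count_times P b c.
Proof. by case/andP=> ab bc; rewrite /count_times (big_cat_nat (n := b)). Qed.

Lemma count_times_geq P a b : b <= a -> count_times P a b = 0.
Proof. by move=> ba; rewrite /count_times big_geq. Qed.

Lemma count_times_recr P a b : a <= b ->
  count_times P a b.+1 = count_times P a b + P b.
Proof. by move=> ab; rewrite /count_times big_nat_recr. Qed.

Lemma count_times1 P a : count_times P a a.+1 = P a.
Proof. by rewrite /count_times big_nat1. Qed.

Lemma leq_count_times (P Q : pred nat) a b :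
  (forall t, a <= t < b -> P t -> Q t) -> count_times P a b <= count_times Q a b.
Proof.
move=> PQ; rewrite /count_times !big_nat; apply: leq_sum => t tab.
by case: (P t) (PQ t tab) => // ->.
Qed.

Lemma eq_count_times (P Q : pred nat) a b :
  (forall t, a <= t < b -> P t = Q t) -> count_times P a b = count_times Q a b.
Proof. by move=> PQ; apply: eq_big_nat => t /PQ ->. Qed.

Lemma count_times_shift P d a b :
  count_times P (a + d) (b + d) = count_times (fun t => P (t + d)) a b.
Proof. by rewrite /count_times big_addn addnK. Qed.

Lemma count_times_window P d s : (forall t, P (t + d) = P t) ->
  count_times P s (s + d) = count_times P 0 d.
Proof.
move=> Pd; elim: s => [|s IH]; first by rewrite add0n.
rewrite -IH addSn; case: (posnP d) => [->|d0].
  by rewrite addn0 !count_times_geq.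
rewrite count_times_recr; last by lia.
rewrite [RHS](@count_times_cat P s s.+1); last by lia.
by rewrite count_times1 Pd addnC.
Qed.

Lemma count_times_windows P d s m : (forall t, P (t + d) = P t) ->
  count_times P s (s + m * d) = m * count_times P 0 d.
Proof.
move=> Pd; elim: m => [|m IH]; first by rewrite mul0n addn0 count_times_geq.
rewrite (@count_times_cat P s (s + m * d)); last by lia.
by rewrite IH mulSnr addnA count_times_window // addnC mulSn addnC.
Qed.

Lemma sum_count_times (T : finType) (P : T -> pred nat) (V : {pred T}) a b :
  \sum_(x in V) count_times (P x) a b = \sum_(a <= t < b) #|[set x in V | P x t]|.
Proof.
rewrite /count_times exchange_big; apply: eq_bigr => t _.
rewrite -sum1dep_card big_mkcondr; apply: eq_bigr => x _; by case: (P x t).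
Qed.

Lemma count_times_true (P : pred nat) a b :
  (forall t, a <= t < b -> P t) -> count_times P a b = b - a.
Proof.
move=> Pt; rewrite /count_times (eq_big_nat _ _ (F2 := fun=> 1)) ?sum_nat_const_nat ?muln1 //.
by move=> t /Pt ->.
Qed.

Lemma count_times_false (P : pred nat) a b :
  (forall t, a <= t < b -> P t = false) -> count_times P a b = 0.
Proof. by move=> Pt; rewrite /count_times big_nat big1 // => t /Pt ->. Qed.

Lemma count_times_exists (P : pred nat) a b :
  0 < count_times P a b -> exists2 t, a <= t < b & P t.
Proof.
elim: b => [|b IH]; first by rewrite count_times_geq.
case: (leqP a b) => ab; last by rewrite count_times_geq.
rewrite count_times_recr //; case: (boolP (P b)) => Pb; first by exists b => //; lia.
by rewrite addn0 => /IH[t tab Pt]; exists t => //; lia.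
Qed.

(** A quantity that climbs by unit steps takes each value once just before a
    step, so the steps at which its value satisfies Q are counted by the values. *)
Lemma count_climb (g : nat -> nat) (c Q : pred nat) a b : a <= b ->
  (forall t, a <= t < b -> g t.+1 = g t + c t) ->
  g a <= g b /\ count_times (fun t => c t && Q (g t)) a b = count_times Q (g a) (g b).
Proof.
elim: b => [|b IH].
  by rewrite leqn0 => /eqP-> _; rewrite !count_times_geq.
rewrite leq_eqVlt => /predU1P[-> _|]; first by rewrite !count_times_geq.
rewrite ltnS => ab gS; have [||gab E] := IH => //; first by move=> t tab; apply: gS; lia.
rewrite count_times_recr // E gS; last by lia.
case: (c b) => /=; last by rewrite !addn0.
by rewrite addn1 count_times_recr //; split=> //; lia.
Qed.

Lemma rising_edge (P : pred nat) a b : a < b -> ~~ P a -> P b ->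
  exists2 t, a <= t < b & ~~ P t && P t.+1.
Proof.
elim: b => // b IH; rewrite ltnS leq_eqVlt => /predU1P[-> Pb Pb1|ab Pa Pb1].
  by exists b; rewrite ?leqnn ?ltnSn ?Pb.
case: (boolP (P b)) => Pb; last by exists b; rewrite ?Pb //; lia.
by have [t tab tP] := IH ab Pa Pb; exists t => //; lia.
Qed.

Lemma run_end (P : pred nat) t c : t <= c -> P t -> ~~ P c ->
  exists b, [/\ t <= b, b < c, ~~ P b.+1 & forall u, t <= u <= b -> P u].
Proof.
move=> tc Pt Pc; have ex : exists m, ~~ P (t + m) by exists (c - t); rewrite subnKC.
case: (ex_minnP ex) => -[|m]; first by rewrite addn0 Pt.
move=> Pm mmin; exists (t + m); split.
- exact: leq_addr.
- have := mmin (c - t); rewrite subnKC // => /(_ Pc); lia.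
- by rewrite -addnS.
move=> u /andP[tu um]; apply: contraT => Pu.
by have := mmin (u - t); rewrite subnKC // => /(_ Pu); lia.
Qed.

Lemma run_start (P : pred nat) a0 t : a0 <= t -> ~~ P a0 -> P t ->
  exists a, [/\ a0 <= a, a < t, ~~ P a & forall u, a < u <= t -> P u].
Proof.
move=> at_ Pa Pt.
have [|||b [tb bc Pb bP]] := @run_end (fun m => P (t - m)) 0 (t - a0).
- by [].
- by rewrite subn0.
- by rewrite subKn.
exists (t - b.+1); split=> //; try lia.
move=> u tu; have -> : u = t - (t - u) by lia.
by apply: bP; lia.
Qed.

(** * The bound on critical swaps as a function *)

(** The truncated subtraction supplies max(0, 3 j - n).  The sum is an explicit
    list so that the bound can be evaluated. *)
Definition critical_bound (n k : nat) : nat :=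
  3 * 'C(k.+1, 2) + sumn [seq 3 * j - n | j <- iota 1 k].

Lemma critical_boundE n k :
  critical_bound n k = 3 * 'C(k.+1, 2) + \sum_(1 <= j < k.+1) (3 * j - n).
Proof. by rewrite /critical_bound sumnE big_map /index_iota subn1. Qed.

Lemma critical_bound_small n k : 3 * k <= n -> critical_bound n k = 3 * 'C(k.+1, 2).
Proof.
move=> kn; rewrite critical_boundE big_nat big1 ?addn0 // => j /andP[_ jk].
by apply/eqP; rewrite subn_eq0; lia.
Qed.

(** The recursion matched by removing three elements and lowering k by two. *)
Lemma critical_bound_rec n k : 3 <= n ->
  critical_bound n k.+2 = critical_bound (n - 3) k + (6 * k + 9) + (3 * k.+2 - n).
Proof.
move=> n3; rewrite !critical_boundE [in LHS]big_nat_recr //= big_add1 /=.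
rewrite [\sum_(0 <= i < k.+1) _]big_nat_recl //= (_ : 3 * 1 - n = 0); last by lia.
rewrite add0n big_add1 /= .
rewrite (eq_big_nat _ _ (F2 := fun j => 3 * j.+1 - (n - 3))); last by move=> j _; lia.
have -> : 'C(k.+3, 2) = 'C(k.+1, 2) + (2 * k + 3).
  by rewrite !binS !bin1 !bin0; lia.
by move: (\sum_(_ <= _ < _) _) => X; lia.
Qed.

Lemma critical_bound_mono n m k : n <= m -> critical_bound m k <= critical_bound n k.
Proof. by move=> nm; rewrite !critical_boundE leq_add2l; apply: leq_sum => j _; apply: leq_sub2l. Qed.

(** * Sweeps *)

(** At time t the neighbours [lsw t] and [rsw t], in this order, are exchanged.  The
    order is reversed after N steps, so natural numbers suffice as times.  Since N
    is the number of pairs, no pair can be exchanged twice within N steps. *)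
Record sweep (T : finType) (N : nat) := Sweep {
  bef : nat -> rel T;
  lsw : nat -> T;
  rsw : nat -> T;
  bef_irr : forall t x, bef t x x = false;
  bef_trans : forall t, transitive (bef t);
  bef_total : forall t x y, x != y -> bef t x y || bef t y x;
  bef_half : forall t x y, bef (t + N) x y = bef t y x;
  bef_sw : forall t, bef t (lsw t) (rsw t);
  bef_step : forall t x y, bef t.+1 x y =
    bef t x y (+) (((x, y) == (lsw t, rsw t)) || ((x, y) == (rsw t, lsw t)));
  half_period : N = 'C(#|T|, 2) }.

Section Sweep.
Variables (T : finType) (N : nat) (F : sweep T N).
Implicit Types (A V : {set T}) (x y z : T) (s t k : nat).

Local Notation bef := (bef F).
Local Notation lsw := (lsw F).
Local Notation rsw := (rsw F).

Definition swaps_pair x y t : bool :=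
  ((x, y) == (lsw t, rsw t)) || ((x, y) == (rsw t, lsw t)).

Definition swaps_in A t : bool := (lsw t \in A) && (rsw t \in A).
Definition swaps_of x t : bool := (x == lsw t) || (x == rsw t).

Definition place A t x : nat := #|[set z in A | bef t z x]|.
Definition nleft A t : nat := place A t (lsw t).
Definition first_ A k t : {set T} := [set x in A | place A t x < k].

Lemma bef_asym t x y : bef t x y -> bef t y x = false.
Proof.
by move=> xy; apply/negbTE/negP => /(bef_trans xy); rewrite bef_irr.
Qed.

Lemma bef_neq t x y : bef t x y -> x != y.
Proof. by move=> xy; apply/eqP => E; rewrite E bef_irr in xy. Qed.

Lemma befN t x y : x != y -> bef t y x = ~~ bef t x y.
Proof.
move=> xy; case: (boolP (bef t x y)) => [/bef_asym //|nxy].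
by move: (bef_total F t xy); rewrite (negbTE nxy).
Qed.

Lemma lsw_neq t : lsw t != rsw t.
Proof. exact: bef_neq (bef_sw F t). Qed.

Lemma swaps_pairC x y t : swaps_pair x y t = swaps_pair y x t.
Proof. by rewrite /swaps_pair orbC !xpair_eqE andbC [X in _ || X]andbC. Qed.

Lemma befS t x y : bef t.+1 x y = bef t x y (+) swaps_pair x y t.
Proof. exact: bef_step. Qed.

Lemma swaps_pair_bef t x y : x != y -> swaps_pair x y t = (bef t.+1 x y != bef t x y).
Proof. by move=> xy; rewrite befS; case: (bef t x y); case: swaps_pair. Qed.

Lemma bef_parity x y a b : a <= b ->
  bef b x y = bef a x y (+) odd (count_times (swaps_pair x y) a b).
Proof.
elim: b => [|b IH].
  by rewrite leqn0 => /eqP->; rewrite count_times_geq //= addbF.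
rewrite leq_eqVlt => /predU1P[->|]; first by rewrite count_times_geq //= addbF.
by rewrite ltnS => ab; rewrite befS IH // count_times_recr // oddD addbA oddb.
Qed.

Lemma swaps_pair_half t x y : swaps_pair x y (t + N) = swaps_pair x y t.
Proof.
case: (eqVneq x y) => [->|xy].
  rewrite /swaps_pair !xpair_eqE; apply/idP/idP.
    by case/orP=> /andP[/eqP E /eqP E']; move: (lsw_neq (t + N)); rewrite -E -E' eqxx.
  by case/orP=> /andP[/eqP E /eqP E']; move: (lsw_neq t); rewrite -E -E' eqxx.
rewrite !swaps_pair_bef // -addSn !bef_half ![bef _ y x]befN //.
by case: bef; case: bef.
Qed.

Lemma sum_swaps_pair (A : {set T}) t :
  \sum_(x in A) \sum_(y in A | x != y) swaps_pair x y t = 2 * swaps_in A t.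
Proof.
rewrite pair_big_dep /=.
rewrite (_ : \sum_(_ | _) _ = #|[set e : T * T | [&& e.1 \in A, e.2 \in A, e.1 != e.2
    & swaps_pair e.1 e.2 t]]|); last first.
  rewrite -sum1dep_card [RHS](eq_bigl (fun e : T * T =>
    [&& e.1 \in A, e.2 \in A & e.1 != e.2] && swaps_pair e.1 e.2 t)); last first.
    by move=> e; rewrite -!andbA.
  by rewrite [RHS]big_mkcondr /=; apply: eq_bigr => e _; case: swaps_pair.
case inA: (swaps_in A t); last first.
  apply/eqP; rewrite cards_eq0; apply/eqP/setP=> -[x y]; rewrite !inE /=.
  apply/negP => /and4P[xA yA _ /orP[]] /eqP[E1 E2];
  by move: inA; rewrite /swaps_in -E1 -E2 xA yA.
rewrite (_ : [set _ | _] = [set (lsw t, rsw t); (rsw t, lsw t)]).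
  by rewrite cards2 xpair_eqE (negbTE (lsw_neq t)).
apply/setP=> -[x y]; rewrite !inE /= /swaps_pair; case/andP: inA => lA rA.
apply/idP/idP => [/and4P[]//|]; have lr := lsw_neq t.
by case/orP=> /eqP[-> ->]; rewrite lA rA ?lr ?(eq_sym (rsw t)) ?lr !eqxx ?orbT.
Qed.

Lemma swaps_in_half A t : swaps_in A (t + N) = swaps_in A t.
Proof.
have := sum_swaps_pair A (t + N); have := sum_swaps_pair A t.
under [in X in _ -> X -> _]eq_bigr do under eq_bigr do rewrite swaps_pair_half.
by move=> ->; case: swaps_in; case: swaps_in.
Qed.

(** Each pair is exchanged at least once within N steps because the order is
    reversed; the 'C(#|T|, 2) pairs then use up all N steps. *)
Lemma swaps_pair_once s x y : x != y ->
  count_times (swaps_pair x y) s (s + N) = 1.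
Proof.
move=> xy; rewrite count_times_window; last by move=> t; exact: swaps_pair_half.
have ge1 u v : u != v -> 0 < count_times (swaps_pair u v) 0 N.
  move=> uv; rewrite lt0n; apply/eqP=> C0.
  have := bef_parity u v (leq0n N); rewrite C0 /= addbF.
  by have := bef_half F 0 u v; rewrite add0n => ->; rewrite befN //; case: bef.
pose D := \sum_(u : T) \sum_(v | u != v) count_times (swaps_pair u v) 0 N.
have DE : D = #|T| * #|T|.-1.
  rewrite /D /count_times; under eq_bigr do rewrite exchange_big.
  rewrite exchange_big /= (eq_bigr (fun=> 2)) => [|t _].
    by rewrite sum_nat_const_nat subn0 (half_period F) bin2 muln2 -[RHS]odd_double_half; case: #|T| => //= m; rewrite oddM /=; case: (odd m).
  have := sum_swaps_pair setT t; rewrite /swaps_in !inE /= muln1 => <-.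
  rewrite [RHS](eq_bigl predT) => [|u]; last by rewrite inE.
  by apply: eq_bigr => u _; apply: eq_bigl => v; rewrite inE.
have DE' : \sum_(u : T) \sum_(v | u != v) 1 = D.
  rewrite DE (eq_bigr (fun=> #|T|.-1)) ?sum_nat_const ?muln1 // => u _.
  rewrite sum1dep_card -(cardC1 u); apply: eq_card => v; by rewrite !inE eq_sym.
apply/eqP; rewrite eqn_leq ge1 // andbT leqNgt; apply/negP => gt1.
suff : \sum_(u : T) \sum_(v | u != v) 1 < D by rewrite DE' ltnn.
rewrite /D (bigD1 x) //= [X in _ < X](bigD1 x) //= -addSn; apply: leq_add; last first.
  by apply: leq_sum => u _; apply: leq_sum => v; exact: ge1.
rewrite (bigD1 y) //= [X in _ < X](bigD1 y) //= -addSn; apply: leq_add => //.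
by apply: leq_sum => v /andP[xv _]; exact: ge1.
Qed.

(** Over a window of length N a pair changes its order at most once. *)
Lemma bef_convex s t t' x y : s <= t <= t' -> t' <= s + N ->
  bef s x y -> bef t' x y -> bef t x y.
Proof.
case/andP=> st tt' t'N sxy t'xy; have xy := bef_neq sxy.
have := swaps_pair_once s xy.
rewrite (@count_times_cat _ s t'); last by lia.
move: (bef_parity x y (leq_trans st tt')); rewrite sxy t'xy.
rewrite (@count_times_cat _ s t t'); last by rewrite st tt'.
rewrite (bef_parity x y st) sxy.
move: (count_times _ s t) (count_times _ t t') (count_times _ t' _) => c c' c''.
case: c => [|c] //; case: c => [|c]; last by lia.
by case: c' => [|c'] //; lia.
Qed.

Lemma count_swaps_in A s : 2 * count_times (swaps_in A) s (s + N) = #|A| * #|A|.-1.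
Proof.
rewrite /count_times big_distrr /=; under eq_bigr do rewrite -sum_swaps_pair.
rewrite exchange_big /=; under eq_bigr do rewrite exchange_big /=.
rewrite (eq_bigr (fun=> #|A|.-1)) ?sum_nat_const // => x xA.
rewrite (eq_bigr (fun=> 1)) => [|y /andP[_ xy]]; last exact: swaps_pair_once.
rewrite sum1dep_card (cardsD1 x A) xA /= .
by apply: eq_card => y; rewrite !inE eq_sym andbC.
Qed.

Lemma lsw_half t : lsw (t + N) = rsw t.
Proof.
have := bef_sw F (t + N); rewrite bef_half.
have : swaps_pair (lsw (t + N)) (rsw (t + N)) (t + N) by rewrite /swaps_pair eqxx.
by rewrite swaps_pair_half => /orP[] /eqP[-> ->] // /bef_asym; rewrite bef_sw.
Qed.

Lemma rsw_half t : rsw (t + N) = lsw t.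
Proof.
have := bef_sw F (t + N); rewrite bef_half.
have : swaps_pair (lsw (t + N)) (rsw (t + N)) (t + N) by rewrite /swaps_pair eqxx.
by rewrite swaps_pair_half => /orP[] /eqP[-> ->] // /bef_asym; rewrite bef_sw.
Qed.

(** If z lay strictly between the two exchanged elements, the next order would
    have a cycle. *)
Lemma bef_adj t z : z != lsw t -> z != rsw t -> bef t z (rsw t) = bef t z (lsw t).
Proof.
move=> zl zr; apply/idP/idP => [zr_|zl_]; last exact: bef_trans zl_ (bef_sw F t).
case: (boolP (bef t z (lsw t))) => // nzl.
have lz : bef t (lsw t) z by rewrite befN.
have lr : bef t.+1 (rsw t) (lsw t).
  by rewrite befS /swaps_pair eqxx orbT bef_asym ?bef_sw.
have : bef t.+1 (lsw t) z.
  by rewrite befS lz /swaps_pair !xpair_eqE eqxx (negbTE zr) (negbTE zl) /= ?andbF.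
move/(bef_trans lr); rewrite befS (bef_asym zr_) /swaps_pair !xpair_eqE.
by rewrite (negbTE zl) (negbTE zr) /= ?andbF.
Qed.

Lemma befS_neq t z x : x != lsw t -> x != rsw t -> bef t.+1 z x = bef t z x.
Proof.
by move=> xl xr; rewrite befS /swaps_pair !xpair_eqE (negbTE xl) (negbTE xr) !andbF addbF.
Qed.

Lemma placeS_neq A t x : x != lsw t -> x != rsw t -> place A t.+1 x = place A t x.
Proof.
by move=> xl xr; apply: eq_card => z; rewrite !inE befS_neq.
Qed.

Lemma place_rsw A t : place A t (rsw t) = nleft A t + (lsw t \in A).
Proof.
rewrite /nleft /place [in LHS](cardsD1 (lsw t)) !inE bef_sw andbT addnC; congr (_ + _).
apply: eq_card => z; rewrite !inE; case: (eqVneq z (lsw t)) => [->|zl] /=.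
  by rewrite bef_irr andbF.
case: (eqVneq z (rsw t)) => [->|zr]; last by rewrite bef_adj.
by rewrite bef_irr bef_asym ?bef_sw.
Qed.

Lemma placeS_rsw A t : place A t.+1 (rsw t) = nleft A t.
Proof.
apply: eq_card => z; rewrite !inE befS /swaps_pair !xpair_eqE eqxx andbT.
rewrite (eq_sym (rsw t)) (negbTE (lsw_neq t)) andbF orbF.
case: (eqVneq z (lsw t)) => [->|zl] /=; first by rewrite bef_irr bef_sw.
case: (eqVneq z (rsw t)) => [->|zr]; last by rewrite bef_adj // addbF.
by rewrite bef_irr [bef _ _ (lsw t)]bef_asym ?bef_sw.
Qed.

Lemma placeS_lsw A t : place A t.+1 (lsw t) = nleft A t + (rsw t \in A).
Proof.
rewrite {1}/place (cardsD1 (rsw t)) !inE befS /swaps_pair !eqxx orbT.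
rewrite bef_asym ?bef_sw // andbT addnC; congr (_ + _).
apply: eq_card => z; rewrite !inE; case: (eqVneq z (rsw t)) => [->|zr] /=.
  by rewrite bef_asym ?andbF ?bef_sw.
by rewrite befS /swaps_pair !xpair_eqE (negbTE zr) (negbTE (lsw_neq t)) !andbF addbF.
Qed.

Lemma place_lt A t x y : x \in A -> bef t x y -> place A t x < place A t y.
Proof.
move=> xA xy; apply: proper_card; apply/properP; split.
  by apply/subsetP=> z; rewrite !inE => /andP[-> /bef_trans]; exact.
by exists x; rewrite !inE xA ?xy ?bef_irr.
Qed.

Lemma bef_place A t x y : x \in A -> y \in A -> bef t x y = (place A t x < place A t y).
Proof.
move=> xA yA; apply/idP/idP => [|xy]; first exact: place_lt.
case: (eqVneq x y) xy => [->|xy]; first by rewrite ltnn.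
case: (boolP (bef t x y)) => // nxy; have : bef t y x by rewrite befN.
by move/(place_lt yA) => /ltnW; rewrite leqNgt => /negbTE ->.
Qed.

Lemma place_inj A t : {in A &, injective (place A t)}.
Proof.
move=> x y xA yA E; apply/eqP; case: eqVneq => // /(bef_total F t).
by rewrite !(@bef_place A) // E ltnn.
Qed.

Lemma place_max A t x : x \in A -> place A t x < #|A|.
Proof.
move=> xA; apply: proper_card; apply/properP; split.
  by apply/subsetP=> z; rewrite !inE => /andP[].
by exists x; rewrite ?inE ?bef_irr ?andbF.
Qed.

Lemma perm_place A t : perm_eq [seq place A t x | x <- enum A] (iota 0 #|A|).
Proof.
have u : uniq [seq place A t x | x <- enum A].
  by rewrite map_inj_in_uniq ?enum_uniq // => x y; rewrite !mem_enum; exact: place_inj.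
apply: uniq_perm; rewrite ?iota_uniq //.
have [||] := @uniq_min_size _ _ (iota 0 #|A|) u; rewrite ?size_map ?size_iota -?cardE //.
move=> _ /mapP[x xA ->]; rewrite mem_iota add0n /= place_max //.
by rewrite mem_enum in xA.
Qed.

Lemma card_place A t (P : pred nat) :
  #|[set x in A | P (place A t x)]| = count P (iota 0 #|A|).
Proof.
by rewrite -(seq.permP (perm_place A t)) -sum1_count big_map big_enum_cond sum1dep_card.
Qed.

Lemma card_first A k t : k <= #|A| -> #|first_ A k t| = k.
Proof.
move=> kA; rewrite (card_place A t (fun i => i < k)).
rewrite -(subnKC kA) iotaD count_cat add0n [X in _ + X](_ : _ = 0).
  by rewrite addn0 -[RHS](size_iota 0); apply/eqP; rewrite -all_count; apply/allP => i; rewrite mem_iota.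
by apply/eqP; rewrite -leqn0 leqNgt -has_count; apply/hasPn=> i; rewrite mem_iota -leqNgt => /andP[].
Qed.

Lemma exists_place A t i : i < #|A| -> exists2 x, x \in A & place A t x = i.
Proof.
move=> iA; have : i \in iota 0 #|A| by rewrite mem_iota.
by rewrite -(perm_mem (perm_place A t)) => /mapP[x]; rewrite mem_enum => xA ->; exists x.
Qed.

Lemma place_half A t x : x \in A -> place A (t + N) x = #|A|.-1 - place A t x.
Proof.
move=> xA; have -> : #|A|.-1 = place A t x + place A (t + N) x; last by rewrite addKn.
rewrite /place (cardsD1 x A) xA add1n /= -(cardsID [set z | bef t z x] (A :\ x)).
congr (_ + _).
  by apply: eq_card => z; rewrite !inE; case: eqP => [->|] //=; rewrite bef_irr andbF.
apply: eq_card => z; rewrite !inE bef_half; case: (eqVneq z x) => [->|zx] /=.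
  by rewrite !bef_irr !andbF.
by rewrite [bef t x z]befN // andbC.
Qed.

Lemma first_half A k t : k <= #|A| -> first_ A k (t + N) = A :\: first_ A (#|A| - k) t.
Proof.
move=> kA; apply/setP=> x; rewrite !inE; case xA: (x \in A) => //=.
rewrite place_half // andbT; have := place_max t xA; lia.
Qed.

Lemma nleft_half A t : swaps_in A t -> nleft A (t + N) = #|A| - 2 - nleft A t.
Proof.
case/andP=> lA rA; rewrite {1}/nleft lsw_half place_half // place_rsw lA; lia.
Qed.

Lemma nleft_max A t : swaps_in A t -> (nleft A t).+2 <= #|A|.
Proof.
by case/andP=> lA rA; have := place_max t rA; rewrite place_rsw lA addn1.
Qed.

Lemma first_period A k t : first_ A k (t + N + N) = first_ A k t.
Proof.
by apply/setP=> x; rewrite !inE; congr (_ && (_ < _)); apply: eq_card => z; rewrite !inE !bef_half.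
Qed.

(** The steps at which [first_ A k] changes: the two exchanged elements cross the
    gap behind the first k elements of A. *)
Definition exchange A k t : bool := swaps_in A t && ((nleft A t).+1 == k).

Lemma firstS A k t : exchange A k t ->
  first_ A k t.+1 = rsw t |: (first_ A k t :\ lsw t).
Proof.
case/andP=> /andP[lA rA] /eqP kE; apply/setP=> x; rewrite !inE.
case: (eqVneq x (rsw t)) => [->|xr] /=; first by rewrite rA placeS_rsw -kE ltnSn.
case: (eqVneq x (lsw t)) => [->|xl] /=; last by rewrite placeS_neq.
by rewrite placeS_lsw rA addn1 -kE ltnn andbF.
Qed.

Lemma firstS_id A k t : ~~ exchange A k t -> first_ A k t.+1 = first_ A k t.
Proof.
move=> nE; apply/setP=> x; rewrite !inE; case xA: (x \in A) => //=.
move: nE; rewrite /exchange /swaps_in.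
case: (eqVneq x (rsw t)) xA => [->|xr].
  by move=> rA; rewrite placeS_rsw place_rsw rA; case: (lsw t \in A) => /=; lia.
case: (eqVneq x (lsw t)) => [->|xl]; last by rewrite placeS_neq.
by move=> rA; rewrite placeS_lsw rA; rewrite -/(nleft A t); case: (rsw t \in A) => /=; lia.
Qed.

Lemma lsw_first A k t : exchange A k t -> lsw t \in first_ A k t.
Proof. by case/andP=> /andP[lA rA] /eqP kE; rewrite inE lA -kE ltnSn. Qed.

Lemma rsw_first A k t : exchange A k t -> rsw t \notin first_ A k t.
Proof.
by case/andP=> /andP[lA rA] /eqP kE; rewrite inE rA place_rsw lA addn1 -kE ltnn.
Qed.

(** Each exchange takes a single element out of the front. *)
Lemma card_first_diff A k a b : a <= b ->
  #|first_ A k a :\: first_ A k b| <= count_times (exchange A k) a b.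
Proof.
elim: b => [|b IH]; first by rewrite leqn0 => /eqP->; rewrite setDv cards0.
rewrite leq_eqVlt => /predU1P[->|]; first by rewrite setDv cards0.
rewrite ltnS => ab; rewrite count_times_recr //; have {}IH := IH ab.
case: (boolP (exchange A k b)) => Eb; last by rewrite firstS_id // addn0.
rewrite firstS //; apply: leq_trans (_ : #|lsw b |: (first_ A k a :\: first_ A k b)| <= _).
  apply/subset_leq_card/subsetP => z; rewrite !inE negb_or negb_and negbK.
  case: (eqVneq z (lsw b)) => //= _; case: (z == rsw b) => //=.
by rewrite cardsU1 addnC leq_add // leq_b1.
Qed.

(** * Hull elements, and removing one of them *)

(** The elements outside A are ignored, so that A may shrink by induction. *)
Definition critical_in A k t : bool :=
  swaps_in A t && ((nleft A t < k) || (#|A| - 2 - nleft A t < k)).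

Definition ncritical A k : nat := count_times (critical_in A k) 0 N.

Lemma critical_in_half A k t : critical_in A k (t + N) = critical_in A k t.
Proof.
rewrite /critical_in swaps_in_half; case inA: (swaps_in A t) => //=.
have := nleft_max inA; rewrite nleft_half //; lia.
Qed.

Lemma swaps_of_half x t : swaps_of x (t + N) = swaps_of x t.
Proof. by rewrite /swaps_of lsw_half rsw_half orbC. Qed.

Lemma count_critical_window A k s :
  count_times (critical_in A k) s (s + N) = ncritical A k.
Proof. by apply: count_times_window => t; exact: critical_in_half. Qed.

(** For a point set these are the vertices of the convex hull of A, each together
    with a direction in which it is extreme. *)
Definition hull_at A s x : bool := (x \in A) && (place A s x == 0).

Lemma hull_bef A s v w : hull_at A s v -> w \in A -> w != v -> bef s v w.
Proof.
case/andP=> vA /eqP v0 wA wv; rewrite (bef_place s vA wA) v0 lt0n -v0.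
by apply: contra wv => /eqP/(place_inj wA vA) ->.
Qed.

(** An element that comes first at time s only moves backwards in the next N steps. *)
Lemma hull_lsw A s v t : hull_at A s v -> s <= t < s + N -> swaps_in A t ->
  swaps_of v t = (v == lsw t).
Proof.
move=> hv /andP[st tN] /andP[lA rA]; rewrite /swaps_of.
case: (eqVneq v (rsw t)) => [vr|]; last by rewrite orbF.
rewrite orbT; apply/esym/eqP; case: (eqVneq v (lsw t)) => // vl.
have lv : lsw t != v by rewrite eq_sym.
have := bef_sw F t; rewrite -vr bef_asym //.
apply: (@bef_convex s t t.+1); rewrite ?st ?leqnSn //.
  exact: hull_bef hv lA lv.
have:= bef_sw F t; rewrite -vr => b; by rewrite befS /swaps_pair -vr eqxx orbT bef_asym.
Qed.

Lemma hull_climb A s v t : hull_at A s v -> s <= t < s + N ->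
  place A t.+1 v = place A t v + (swaps_in A t && swaps_of v t).
Proof.
move=> hv st; have vA : v \in A by case/andP: hv.
case: (eqVneq v (lsw t)) => [vl|vl].
  by rewrite {1 2}vl placeS_lsw /swaps_of /swaps_in -vl vA eqxx andbT /nleft -vl.
case: (eqVneq v (rsw t)) => [vr|vr]; last first.
  by rewrite placeS_neq // /swaps_of (negbTE vl) (negbTE vr) andbF addn0.
rewrite {1 2}vr placeS_rsw place_rsw.
case inA: (swaps_in A t).
  by move: (hull_lsw hv st inA); rewrite /swaps_of (negbTE vl) -vr eqxx.
by move: inA; rewrite /swaps_in -vr vA andbT => ->; rewrite !addn0.
Qed.

Lemma hull_end A s v : hull_at A s v -> place A (s + N) v = #|A|.-1.
Proof. by case/andP=> vA /eqP v0; rewrite place_half // v0 subn0. Qed.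

(** During N steps the hull element passes the #|A| - 1 others, at the places
    0, 1, ..., #|A| - 2 one after the other. *)
Lemma hull_count A s v (Q : pred nat) : hull_at A s v ->
  count_times (fun t => (swaps_in A t && swaps_of v t) && Q (nleft A t)) s (s + N)
  = count_times Q 0 #|A|.-1.
Proof.
move=> hv; have [_] := count_climb Q (leq_addr N s) (fun t => hull_climb hv (t := t)).
rewrite hull_end // {1}(eqP (proj2 (andP hv))) => <-.
apply: eq_count_times => t st; case: (boolP (swaps_in A t)) => //= inA.
rewrite (hull_lsw hv st inA); case: eqP => // ->.
by [].
Qed.

Lemma hull_critical A s v k : hull_at A s v -> 2 * k < #|A| ->
  count_times (fun t => critical_in A k t && swaps_of v t) 0 N = 2 * k.
Proof.
move=> hv kA; rewrite -(@count_times_window _ N s); last first.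
  by move=> t; rewrite critical_in_half swaps_of_half.
pose Q c := (c < k) || (#|A| - 2 - c < k).
rewrite (_ : count_times _ _ _ = count_times Q 0 #|A|.-1); last first.
  by rewrite -(hull_count Q hv); apply: eq_count_times => t _; rewrite /critical_in andbAC.
rewrite (@count_times_cat _ 0 k); last by lia.
rewrite (@count_times_cat _ k (#|A|.-1 - k)); last by lia.
rewrite (@count_times_true _ 0 k); last by rewrite /Q; lia.
rewrite (@count_times_false _ k); last by rewrite /Q; lia.
by rewrite count_times_true; last rewrite /Q; lia.
Qed.

Lemma place_setD A V t x : V \subset A ->
  place A t x = place V t x + place (A :\: V) t x.
Proof.
move=> VA; rewrite {1}/place -(cardsID V); congr (_ + _); apply: eq_card => z; rewrite !inE.
  by case zV: (z \in V); rewrite ?andbF // (subsetP VA) // andbT.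
by rewrite andbA.
Qed.

Lemma first_sub A k l t : k <= l -> first_ A k t \subset first_ A l t.
Proof.
by move=> kl; apply/subsetP=> x; rewrite !inE => /andP[-> /leq_trans]; exact.
Qed.

Lemma first_subA A k t : first_ A k t \subset A.
Proof. by apply/subsetP=> x; rewrite inE => /andP[]. Qed.

(** The hull element v takes part in 2 k critical swaps itself.  A critical swap of
    the smaller set for k - 1 remains critical for k, since v adds at most one
    element to either side.  Let t1 be the time at which v moves behind the
    first k elements.  Exchanges behind the first #|A| - k elements before t1, and
    behind the first k elements after t1, are critical for A but no longer for the
    smaller set, because v does not lie on the short side of the swap.  There are
    at least k of them: each of the k front elements after t1 either was among the last
    k at time s, or must leave the front before time s + N, when it consists
    of those last k. *)
Lemma remove_one_hull A s v k : hull_at A s v -> 2 * k < #|A| -> 0 < k ->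
  3 * k + ncritical (A :\ v) k.-1 <= ncritical A k.
Proof.
move=> hv kA k0; have vA : v \in A by case/andP: hv.
have n1 : #|A| = #|A :\ v|.+1 by rewrite (cardsD1 v A) vA.
have [t1 st1 /andP[/andP[inA1 v1] /eqP l1]] : exists2 t, s <= t < s + N &
    (swaps_in A t && swaps_of v t) && (nleft A t == k.-1).
  apply: count_times_exists; rewrite (hull_count (fun c => c == k.-1) hv).
  rewrite (@count_times_cat _ 0 k.-1); last by lia.
  rewrite (@count_times_cat _ k.-1 k.-1.+1); last by lia.
  by rewrite count_times1 eqxx; lia.
move: v1; rewrite (hull_lsw hv st1 inA1) => /eqP v1.
have mono a b : s <= a <= b -> b <= s + N -> place A a v <= place A b v.
  case/andP=> sa ab bN.
  have [|//] := @count_climb (fun t => place A t v)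
    (fun t => swaps_in A t && swaps_of v t) predT a b ab.
  by move=> t tab; apply: (hull_climb hv (t := t)); lia.
have p1 : place A t1 v = k.-1 by rewrite v1 -l1.
have p2 : place A t1.+1 v = k by rewrite (hull_climb hv st1) inA1 p1 /swaps_of -v1 eqxx; lia.
(* Swaps that stop being critical without v although v does not take part. *)
pose ext t := if t <= t1 then exchange A (#|A| - k) t else exchange A k t.
have extP : k <= count_times ext s (s + N).
  rewrite (@count_times_cat _ s t1.+1); last by lia.
  rewrite (@eq_count_times ext (exchange A (#|A| - k)) s t1.+1); last first.
    by move=> t tt; rewrite /ext (_ : t <= t1); last lia.
  rewrite (@eq_count_times ext (exchange A k) t1.+1 (s + N)); last first.
    by move=> t tt; rewrite /ext (_ : (t <= t1) = false); last lia.
  have ltA : #|A| - k <= #|A| by rewrite leq_subr.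
  apply: leq_trans (leq_add (card_first_diff _ _ _) (card_first_diff _ _ _)); try by lia.
  have eqc (B C : {set T}) : #|B| = #|C| -> #|B :\: C| = #|C :\: B|.
    by move=> E; rewrite !cardsD E setIC.
  rewrite eqc ?card_first // first_half; last by lia.
  rewrite -{1}(@card_first A k t1.+1); last by lia.
  rewrite -(cardsID (first_ A (#|A| - k) s) (first_ A k t1.+1)) addnC.
  apply: leq_add; apply: subset_leq_card.
    by apply: setSD; apply: first_sub; lia.
  apply/subsetP=> z; rewrite !inE; case zA: (z \in A) => //=.
  by case/andP=> -> ->.
(* The swaps of v, those of the smaller set and those in ext are disjoint kinds
   of critical swaps; this is checked step by step. *)
apply: (@leq_trans (2 * k + ncritical (A :\ v) k.-1 + count_times ext s (s + N))); first by lia.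
rewrite -(hull_critical hv kA) -!(count_critical_window _ _ s).
rewrite -(@count_times_window (fun t => critical_in A k t && swaps_of v t) N s); last first.
  by move=> t; rewrite critical_in_half swaps_of_half.
rewrite /count_times -!big_split /=; rewrite big_nat [X in _ <= X]big_nat; apply: leq_sum => t st.
have D := place_setD t (lsw t) (_ : [set v] \subset A).
have {D} D : nleft A t = bef t v (lsw t) + nleft (A :\ v) t.
  rewrite /nleft D ?sub1set //; congr (_ + _).
  case b: (bef t v (lsw t)).
    rewrite /place (_ : [set _ in _ | _] = [set v]) ?cards1 //.
    by apply/setP=> z; rewrite !inE; case: eqP => // ->; rewrite b.
  apply/eqP; rewrite cards_eq0; apply/eqP/setP=> z; rewrite !inE.
  by case: eqP => // ->; rewrite b.
have I : swaps_in (A :\ v) t = swaps_in A t && ~~ swaps_of v t.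
  rewrite /swaps_in /swaps_of !inE ![v == _]eq_sym.
  by case: (_ == v); case: (_ == v); rewrite ?andbF ?andbT.
have vt : swaps_in A t -> swaps_of v t -> nleft A t = place A t v.
  by move=> inA; rewrite (hull_lsw hv st inA) => /eqP E; rewrite /nleft -E.
have bvt : swaps_in A t -> bef t v (lsw t) = (place A t v < nleft A t).
  by case/andP=> lA _; apply: bef_place.
have part1 : t <= t1 -> place A t v <= k.-1 by move=> tt; rewrite -p1; apply: mono; lia.
have part2 : t1 < t -> k <= place A t v by move=> tt; rewrite -p2; apply: mono; lia.
rewrite /ext /critical_in /exchange I.
case inA: (swaps_in A t) vt bvt => /=; last by case: ifP.
have nmax := nleft_max inA.
move=> /(_ isT) vt /(_ isT) bvt; rewrite bvt in D.
by case: (swaps_of v t) vt => /= [/(_ isT)|_]; case: (leqP t t1) => tt;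
  [move/part1: tt|move/part2: tt|move/part1: tt|move/part2: tt]; lia.
Qed.

(** * Removing several hull elements *)

Definition meets V t : bool := (lsw t \in V) || (rsw t \in V).

Lemma swaps_in_setD A V t : swaps_in (A :\: V) t = swaps_in A t && ~~ meets V t.
Proof.
by rewrite /swaps_in /meets !inE; case: (lsw t \in V); case: (rsw t \in V);
  rewrite /= ?andbF ?andbT.
Qed.

Lemma meets_half V t : meets V (t + N) = meets V t.
Proof. by rewrite /meets lsw_half rsw_half orbC. Qed.

(** The elements of V take part in 2 k critical swaps each; only the swaps between
    two elements of V are counted twice. *)
Lemma count_meets A V k : (forall v, v \in V -> exists s, hull_at A s v) ->
  2 * k < #|A| ->
  2 * k * #|V| <= count_times (fun t => critical_in A k t && meets V t) 0 N +
                  count_times (swaps_in V) 0 N.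
Proof.
move=> hV kA; rewrite mulnC -sum_nat_const.
rewrite (eq_bigr (fun v =>
    count_times (fun t => critical_in A k t && swaps_of v t) 0 N)); last first.
  by move=> v /hV[s hv]; rewrite (hull_critical hv kA).
rewrite sum_count_times /count_times -big_split /=; apply: leq_sum => t _.
case: (critical_in A k t) => /=; last first.
  by rewrite (_ : [set _ in _ | _] = set0) ?cards0 //; apply/setP=> z; rewrite !inE andbF.
rewrite (_ : [set _ in _ | _] = V :&: [set lsw t; rsw t]); last first.
  by apply/setP=> z; rewrite !inE.
rewrite setIUr; apply: leq_trans (leq_card_setU _ _) _.
have I (u : T) : #|V :&: [set u]| = (u \in V).
  case uV: (u \in V); first by rewrite (setIidPr _) ?cards1 ?sub1set.
  apply/eqP; rewrite cards_eq0; apply/eqP/setP => z; rewrite !inE.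
  by case: eqP => [->|]; rewrite ?uV ?andbF.
by rewrite !I /swaps_in /meets; case: (lsw t \in V); case: (rsw t \in V).
Qed.

Lemma first_before A k t : lsw t \in A -> k <= nleft A t ->
  first_ A k t \subset [set z in A | bef t z (lsw t)].
Proof.
move=> lA kl; apply/subsetP=> z; rewrite !inE => /andP[zA zk].
by rewrite zA (bef_place t zA lA) (leq_trans zk).
Qed.

Lemma first_exchange A k t : exchange A k t ->
  first_ A k t = lsw t |: [set z in A | bef t z (lsw t)].
Proof.
case/andP=> /andP[lA rA] /eqP kE; apply/setP=> z; rewrite !inE -kE.
case: (eqVneq z (lsw t)) => [->|zl] /=; first by rewrite lA ltnSn.
case zA: (z \in A) => //=; rewrite (bef_place t zA lA) ltnS leq_eqVlt.
case: eqP => //= E; case/negP: zl; apply/eqP; exact: place_inj E.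
Qed.

Lemma nleft_setD A V t : V \subset A ->
  nleft A t = #|[set z in V | bef t z (lsw t)]| + nleft (A :\: V) t.
Proof. by move=> VA; rewrite {1}/nleft (place_setD t _ VA). Qed.

(** If at least k elements of A preceded the swap, then so would the first k of
    them, of which at most two lie in V. *)
Lemma critical_setD A V k : V \subset A -> 2 <= k -> k <= #|A| ->
  (forall t, #|first_ A k t :&: V| <= 2) ->
  forall t, critical_in (A :\: V) (k - 2) t -> critical_in A k t.
Proof.
move=> VA k2 kA V2.
have one t : swaps_in (A :\: V) t -> nleft (A :\: V) t < k - 2 -> nleft A t < k.
  rewrite swaps_in_setD => /andP[/andP[lA rA] _] lt2; rewrite ltnNge; apply/negP=> kl.
  have := first_before lA kl; move=> sub.
  have := card_first t kA; rewrite -(cardsID V) => cF.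
  suff: #|first_ A k t :\: V| <= nleft (A :\: V) t by have := V2 t; lia.
  apply/subset_leq_card/subsetP=> z; rewrite in_setD => /andP[zV /(subsetP sub)].
  by rewrite !inE zV.
move=> t /andP[inA' lt2]; have inA : swaps_in A t.
  by have := inA'; rewrite swaps_in_setD; case/andP.
rewrite /critical_in inA /=; case/orP: lt2 => lt2; first by rewrite one.
have := one (t + N); rewrite swaps_in_half inA' !nleft_half // => /(_ isT lt2) ->.
by rewrite orbT.
Qed.

(** Swaps which are critical in A but lose only one preceding element with V, so
    that lowering k by two makes them cease to be critical. *)
Definition extra A V k t : bool :=
  [&& exchange A k t, ~~ meets V t & #|first_ A k t :&: V| == 1].

Lemma extra_critical A V k t : V \subset A -> #|V| = 3 -> 2 * k < #|A| ->
  extra A V k t ->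
  [&& critical_in A k t, ~~ meets V t, ~~ critical_in (A :\: V) (k - 2) t
    & ~~ exchange A k (t + N)].
Proof.
move=> VA V3 kA /and3P[ex mV /eqP c1]; have /andP[inA /eqP kE] := ex.
have nA := nleft_setD t VA.
have c : #|[set z in V | bef t z (lsw t)]| = 1.
  rewrite -c1 (first_exchange ex) setIUl.
  rewrite (_ : [set lsw t] :&: V = set0).
    rewrite set0U; apply: eq_card => z; rewrite !inE.
    by case zV: (z \in V); rewrite ?andbF //= andbT (subsetP VA z zV).
  apply/setP=> z; rewrite !inE; case: eqP => // ->.
  by move: mV; rewrite /meets; case: (_ \in V).
rewrite c in nA.
have A' : #|A :\: V| = #|A| - 3 by rewrite cardsD (setIidPr VA) V3.
have nmax := nleft_max inA.
rewrite /exchange /critical_in inA mV /= nleft_half // A'; lia.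
Qed.

(** The critical swaps of A comprise those that meet V, those of the smaller set,
    and, for three elements, the extra ones.  An extra swap occurs at a time t or
    t + N of the window of length 2 N, and never at both. *)
Lemma remove_hull A V k : V \subset A ->
  (forall v, v \in V -> exists s, hull_at A s v) ->
  2 <= k -> 2 * k < #|A| -> (forall t, #|first_ A k t :&: V| <= 2) ->
  2 * k * #|V| + ncritical (A :\: V) (k - 2) +
    (#|V| == 3) * count_times (extra A V k) 0 (N + N)
  <= ncritical A k + 'C(#|V|, 2).
Proof.
move=> VA hV k2 kA V2; have := count_meets hV kA.
have -> : count_times (swaps_in V) 0 N = 'C(#|V|, 2).
  have := count_swaps_in V 0; rewrite add0n bin2.
  by move=> <-; rewrite mul2n doubleK.
suff : count_times (fun t => critical_in A k t && meets V t) 0 N +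
  ncritical (A :\: V) (k - 2) + (#|V| == 3) * count_times (extra A V k) 0 (N + N)
   <= ncritical A k by lia.
rewrite (@count_times_cat _ 0 N (N + N)); last by lia.
have -> : count_times (extra A V k) N (N + N) =
    count_times (fun t => extra A V k (t + N)) 0 N by rewrite -count_times_shift add0n.
rewrite /ncritical /count_times -!big_split big_distrr -big_split /=.
apply: leq_sum => t _.
have cD := @critical_setD A V k VA k2 _ V2 t.
have {}cD : critical_in (A :\: V) (k - 2) t -> critical_in A k t by apply: cD; lia.
have nm : critical_in (A :\: V) (k - 2) t -> ~~ meets V t.
  by rewrite /critical_in swaps_in_setD => /andP[/andP[]].
case: (eqVneq #|V| 3) => V3; last first.
  by rewrite mul0n addn0; case: critical_in cD nm => [/(_ isT)-> /(_ isT)/negbTE->|_ _] //; case: critical_in => //; case: meets.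
have e1 := @extra_critical A V k t VA V3 kA.
have e2 := @extra_critical A V k (t + N) VA V3 kA.
rewrite !critical_in_half meets_half in e2.
have ex : extra A V k (t + N) -> exchange A k (t + N) by case/and3P.
move: cD nm e1 e2 ex.
case: (critical_in A k t); case: (meets V t); case: (extra A V k t);
  case: (extra A V k (t + N)); case: (critical_in (A :\: V) (k - 2) t);
  case: (exchange A k (t + N)); rewrite //= ?andbF //= => c n a b d;
  by first [have := c isT | have := n isT | have := a isT | have := b isT | have := d isT].
Qed.

(** * The front, and the times at which a hull element belongs to it *)
Section Arcs.
Variables (A : {set T}) (k : nat).
Local Notation front := (first_ A k).

Hypotheses (k0 : 0 < k) (kA : 2 * k < #|A|).

Lemma half_gt0 : 0 < N.
Proof.
rewrite (half_period F) bin_gt0; apply: (@leq_trans #|A|); [lia | exact: max_card].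
Qed.

Lemma first_periods t m : front (t + m * (N + N)) = front t.
Proof.
elim: m => [|m IH]; first by rewrite mul0n addn0.
by rewrite mulSnr !addnA first_period.
Qed.

(** Allows any moment to be moved into a given window of length 2 N. *)
Lemma same_phase t0 t : exists t1,
  t <= t1 < t + (N + N) /\ forall u, front (t1 + u) = front (t0 + u).
Proof.
have N0 : 0 < N + N by have := half_gt0; lia.
pose M := t0 + t * (N + N) - t.
have Mge : t <= t0 + t * (N + N).
  by apply: leq_trans (leq_addl _ _); rewrite leq_pmulr.
exists (t + M %% (N + N)).
have E : t + M %% (N + N) + (M %/ (N + N)) * (N + N) = t0 + t * (N + N).
  rewrite -addnA [_ %% _ + _]addnC -divn_eq /M subnKC //.
split=> [|u]; first by rewrite leq_addr ltn_add2l ltn_mod.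
by rewrite -(first_periods _ (M %/ (N + N))) addnAC E addnAC first_periods.
Qed.

Lemma hull_mono s r a b : hull_at A s r -> s <= a -> a <= b -> b <= s + N ->
  [set z in A | bef a z r] \subset [set z in A | bef b z r].
Proof.
move=> hr sa ab bN; apply/subsetP=> z; rewrite !inE => /andP[zA azr]; rewrite zA /=.
have zr := bef_neq azr; apply: contraT => nb.
have bb : bef b r z by rewrite befN.
have := hull_bef hr zA zr => /(@bef_convex s a b _ _ _ bN) /(_ bb).
by rewrite sa ab => /(_ isT); rewrite (bef_asym azr).
Qed.

Lemma hull_mono_place s r a b : hull_at A s r -> s <= a -> a <= b -> b <= s + N ->
  place A a r <= place A b r.
Proof. by move=> hr sa ab bN; apply/subset_leq_card/(hull_mono hr). Qed.

Lemma hull_chain s r a b : hull_at A s r -> s <= a <= s + N -> s <= b <= s + N ->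
  place A a r <= place A b r ->
  [set z in A | bef a z r] \subset [set z in A | bef b z r].
Proof.
move=> hr /andP[sa aN] /andP[sb bN] pab; case: (leqP a b) => ab.
  exact: (hull_mono hr).
have sub := hull_mono hr sb (ltnW ab) aN.
have /eqP -> : [set z in A | bef b z r] == [set z in A | bef a z r] by rewrite eqEcard sub.
exact: subxx.
Qed.

Lemma first_place r t : r \in A -> place A t r = k -> front t = [set z in A | bef t z r].
Proof.
move=> rA pk; apply/setP=> z; rewrite !inE; case zA: (z \in A) => //=.
by rewrite (bef_place t zA rA) pk.
Qed.

Definition leaves r t : bool := (r \in front t) && (r \notin front t.+1).
Definition enters r t : bool := (r \notin front t) && (r \in front t.+1).

Lemma in_first r t : r \in A -> (r \in front t) = (place A t r < k).
Proof. by move=> rA; rewrite inE rA. Qed.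

(** In a halfperiod that starts with r in first place, r moves backwards through
    the place k; the front it leaves behind consists of the elements it has passed. *)
Lemma leaves_time s r t : hull_at A s r -> leaves r t ->
  exists t', [/\ s <= t' <= s + N, place A t' r = k & front t.+1 = [set z in A | bef t' z r]].
Proof.
move=> hr; have rA : r \in A by case/andP: hr.
have [t1 [/andP[st1 t1N] St]] := same_phase t s.
have := St 0; have := St 1; rewrite !addn0 !addn1 => S1' S1.
rewrite /leaves -S1 -S1' !in_first // -leqNgt => /andP[p1 p2].
case: (ltnP t1 (s + N)) => tN.
  exists t1.+1; have p3 := hull_climb hr (_ : s <= t1 < s + N).
  have {}p3 := p3 _; rewrite st1 tN in p3; have {}p3 := p3 isT.
  have pE : place A t1.+1 r = k by move: p2; rewrite p3; case: (_ && _); lia.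
  by split=> //; [lia | exact: first_place].
have [u t1E] : exists u, t1 = u + N by exists (t1 - N); lia.
move: p1 p2; rewrite t1E -addSn !place_half //.
have := hull_mono_place hr (_ : s <= u) (leqnSn u); have := place_max u.+1 rA.
by move=> h1 h2; have := h2 _ _; lia.
Qed.

(** The counterpart of [leaves_time] in the reversed half of the period, where r
    moves forwards: the front which r enters consists of those it has yet to pass. *)
Lemma enters_time s r t : hull_at A s r -> enters r t ->
  exists t', [/\ s <= t' <= s + N, place A t' r = #|A|.-1 - k & front t = [set z in A | bef t' r z]].
Proof.
move=> hr; have rA : r \in A by case/andP: hr.
have [t1 [/andP[st1 t1N] St]] := same_phase t s.
have := St 0; have := St 1; rewrite !addn0 !addn1 => S1' S1.
rewrite /enters -S1 -S1' !in_first // -leqNgt => /andP[p1 p2].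
case: (ltnP t1 (s + N)) => tN.
  by have := hull_mono_place hr st1 (leqnSn t1) tN; lia.
have [u t1E] : exists u, t1 = u + N by exists (t1 - N); lia.
have su : s <= u < s + N by lia.
exists u; move: p1 p2; rewrite t1E -addSn !place_half // => p1 p2.
have p3 := hull_climb hr su.
have := place_max u.+1 rA; have := place_max u rA => m1 m2.
have pE : place A u r = #|A|.-1 - k by move: p2; rewrite p3; case: (_ && _); lia.
split=> //; first by lia.
rewrite (@first_place r) //; last by rewrite place_half // pE; lia.
by apply/setP=> z; rewrite !inE bef_half.
Qed.

Lemma leaves_uniq s r t t' : hull_at A s r -> leaves r t -> leaves r t' -> front t.+1 = front t'.+1.
Proof.
move=> hr /(leaves_time hr)[u [su pu ->]] /(leaves_time hr)[u' [su' pu' ->]].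
by apply/eqP; rewrite eqEsubset !(hull_chain hr) ?pu ?pu'.
Qed.

(** The first front consists of elements that r has passed, the second one of
    elements that r has not passed, at moments where the place of r among the
    #|A| elements is k and #|A| - 1 - k. *)
Lemma leaves_enters s r t t' : hull_at A s r -> leaves r t -> enters r t' ->
  [disjoint front t.+1 & front t'].
Proof.
move=> hr /(leaves_time hr)[u [su pu ->]] /(enters_time hr)[u' [su' pu' ->]].
have := hull_chain hr su su'; rewrite pu pu' => /(_ _) sub.
have {}sub := sub (ltac:(lia)).
rewrite -setI_eq0; apply/eqP/setP=> z; rewrite !inE; apply/negP => /and3P[/andP[zA zr] _].
apply/negP; apply/negbT; apply: bef_asym.
by have := subsetP sub z; rewrite !inE zA zr => /(_ isT).
Qed.

(** In the cycle of length 2 N, a hull element belongs to the front during one arc: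
    either the part from t to t' or the rest of the cycle is covered. *)
Lemma hull_arc s r t t' : hull_at A s r -> r \in front t -> t <= t' <= t + (N + N) -> r \in front t' ->
  (forall u, t <= u <= t' -> r \in front u) \/ (forall u, t' <= u <= t + (N + N) -> r \in front u).
Proof.
move=> hr; have rA : r \in A by case/andP: hr.
have up u u' : s <= u -> u <= u' -> u' <= s + N -> r \in front u' -> r \in front u.
  move=> su uu uN; rewrite !in_first //; apply: leq_ltn_trans.
  exact: hull_mono_place hr su uu uN.
have down u u' : s + N <= u -> u <= u' -> u' <= s + (N + N) -> r \in front u -> r \in front u'.
  move=> su uu uN; rewrite !in_first //.
  have -> : u = u - N + N by lia.
  have -> : u' = u' - N + N by lia.
  rewrite !place_half //; apply: leq_ltn_trans; apply: leq_sub2l.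
  by apply: (hull_mono_place hr); lia.
have per u : front (u + (N + N)) = front u by rewrite -[N + N]mul1n first_periods.
have up2 u u' : s + (N + N) <= u -> u <= u' -> u' <= s + (N + N) + N -> r \in front u' -> r \in front u.
  move=> h1 h2 h3; have -> : u = u - (N + N) + (N + N) by lia.
  have -> : u' = u' - (N + N) + (N + N) by lia.
  by rewrite !per; apply: up; lia.
have down2 u u' : s + N + (N + N) <= u -> u <= u' -> u' <= s + (N + N) + (N + N) -> r \in front u -> r \in front u'.
  move=> h1 h2 h3; have -> : u = u - (N + N) + (N + N) by lia.
  have -> : u' = u' - (N + N) + (N + N) by lia.
  by rewrite !per; apply: down; lia.
suff arc t1 t2 : s <= t1 < s + (N + N) -> r \in front t1 -> t1 <= t2 <= t1 + (N + N) ->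
    r \in front t2 -> (forall u, t1 <= u <= t2 -> r \in front u) \/
    (forall u, t2 <= u <= t1 + (N + N) -> r \in front u).
  have [t1 [st1 St]] := same_phase t s.
  move=> rt tt' rt'; have [|||u1|u1] := arc t1 (t1 + (t' - t)) st1.
  - by rewrite -[t1]addn0 St addn0.
  - by lia.
  - by rewrite St subnKC //; case/andP: tt'.
  - left=> u tu; rewrite (_ : u = t + (u - t)); last by lia.
    by rewrite -St; apply: u1; lia.
  - right=> u tu; rewrite (_ : u = t + (u - t)); last by lia.
    by rewrite -St; apply: u1; lia.
move=> /andP[st1 t1N] rt1 /andP[t12 t2N] rt2.
have rt1' : r \in front (t1 + (N + N)) by rewrite per.
case: (leqP t1 (s + N)) => h1.
  case: (leqP t2 (s + N)) => h2; first by left=> u /andP[h3 h4]; apply: up rt2; lia.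
  right=> u /andP[h3 h4]; case: (leqP (s + (N + N)) u) => h5.
    by apply: up2 rt1'; lia.
  case: (leqP t2 (s + (N + N))) => h6; last by lia.
  by apply: down rt2; lia.
case: (leqP t2 (s + (N + N))) => h2.
  by left=> u /andP[h3 h4]; apply: down rt1; lia.
case: (leqP t2 (s + (N + N) + N)) => h3; last first.
  by right=> u /andP[h4 h5]; apply: down2 rt2; lia.
left=> u /andP[h4 h5]; case: (leqP u (s + (N + N))) => h6.
  by apply: down rt1; lia.
by apply: up2 rt2; lia.
Qed.

(** * Private runs *)
Section Private.
Variable V : {set T}.

Hypotheses (VA : V \subset A) (hullV : forall v, v \in V -> exists s, hull_at A s v).

(** Times at which v alone keeps V from missing the front. *)
Definition private v t : bool := front t :&: V == [set v].

Lemma private_in v t : private v t -> v \in front t.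
Proof. by move/eqP/setP/(_ v); rewrite in_set1 eqxx in_setI => /andP[]. Qed.

Lemma private_eq v w t : private v t -> w \in V -> w \in front t -> w = v.
Proof. by move/eqP/setP/(_ w) => E wV wS; move: E; rewrite in_setI wV wS in_set1 => /esym/eqP. Qed.

Hypothesis hit : forall t, front t :&: V != set0.

Lemma privateP v t : (forall w, w \in V -> w \in front t -> w = v) -> private v t.
Proof.
move=> h; have sub : front t :&: V \subset [set v].
  by apply/subsetP=> w; rewrite in_setI => /andP[wS wV]; rewrite in_set1 (h w).
rewrite /private eqEsubset sub /=; have /set0Pn[w wI] := hit t.
by have := subsetP sub w wI; rewrite in_set1 => /eqP <-; rewrite sub1set.
Qed.

Lemma private_start v t : private v t.+1 -> ~~ private v t ->
  exists r, [/\ r \in V, r != v & leaves r t].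
Proof.
move=> p1 p0; have vS := private_in p1.
case: (boolP (exchange A k t)) => ex; last first.
  by move: p0 p1; rewrite /private firstS_id // => /negbTE ->.
have SE := firstS ex.
have lS1 : lsw t \notin front t.+1 by rewrite SE !inE (negbTE (lsw_neq t)) eqxx.
case: (boolP (lsw t \in V)) => lV.
  exists (lsw t); split=> //; last by rewrite /leaves lsw_first.
  by apply: contraNneq lS1 => ->.
case/negP: p0; apply: privateP => w wV wS.
apply: (private_eq p1 wV); rewrite SE in_setU1 in_setD1 wS andbT.
by rewrite (contraNneq _ lV) ?orbT // => <-.
Qed.

Lemma private_end v t : private v t -> ~~ private v t.+1 ->
  exists r, [/\ r \in V, r != v & enters r t].
Proof.
move=> p0 p1; have vS := private_in p0.
case: (boolP (exchange A k t)) => ex; last first.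
  by move: p0 p1; rewrite /private firstS_id // => ->.
have SE := firstS ex; have rS := rsw_first ex.
case: (boolP (rsw t \in V)) => rV.
  exists (rsw t); split=> //; last by rewrite /enters rS SE setU11.
  by apply: contraNneq rS => ->.
case/negP: p1; apply: privateP => w wV; rewrite SE in_setU1 in_setD1.
case/predU1P=> [E|/andP[_ wS]]; last exact: private_eq wV wS.
by move: rV; rewrite -E wV.
Qed.

Lemma private_extra v t : exchange A k t -> private v t -> private v t.+1 -> extra A V k t.
Proof.
move=> ex p0 p1; rewrite /extra ex (eqP p0) cards1 /= andbT /meets negb_or.
have SE := firstS ex; apply/andP; split; apply/negP => xV.
  have E := private_eq p0 xV (lsw_first ex).
  have := private_in p1; rewrite SE -E !inE eqxx (negbTE (lsw_neq t)) //.
have E := private_eq p1 xV; have {}E := E _; move: (rsw_first ex).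
by rewrite E ?(private_in p0) // SE setU11.
Qed.

Lemma private_period v t : private v (t + (N + N)) = private v t.
Proof. by rewrite /private -[N + N]mul1n first_periods. Qed.

Hypothesis privV : forall v, v \in V -> exists t, private v t.
Hypothesis V3 : #|V| = 3.

(** A run starts when another element of V leaves the front and stops when another
    one enters.  All runs are placed within one window of length 2 N, which begins
    with a run of some p so that no run is cut in two. *)
Lemma private_runs : exists s, forall v, v \in V ->
  exists (ab : nat * nat) (rq : T * T), [/\ s <= ab.1, ab.1 <= ab.2 & ab.2 <= s + (N + N)] /\
    [/\ 0 < ab.1, forall u, ab.1 <= u <= ab.2 -> private v u,
       [/\ rq.1 \in V, rq.1 != v & leaves rq.1 ab.1.-1] &
       [/\ rq.2 \in V, rq.2 != v & enters rq.2 ab.2]].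
Proof.
have lt2N u : u.+1 < u + (N + N) by have := half_gt0; lia.
have [p [q [pV qV pq]]] : exists p q, [/\ p \in V, q \in V & p != q].
  have /card_gt1P[p [q [pV qV pq]]] : 1 < #|V| by rewrite V3.
  by exists p, q.
have [tq pq_] := privV qV; have [tp pp] := privV pV.
have [t [tqt St]] := same_phase tp tq.
have pt : private p t by rewrite /private -[t]addn0 St addn0.
(* Any private time t of p preceded by one of another element q: the private
   run of p around t then has a beginning s. *)
have npq u : private q u -> ~~ private p u.
  by move=> pu; apply/negP => /eqP E; move: pu; rewrite /private E => /eqP/set1_inj/eqP; apply/negP.
have ltt : tq < t.
  by case/andP: tqt; rewrite leq_eqVlt => /predU1P[E|//]; move: (npq _ pq_); rewrite E pt.
have [s [_ st np ps]] := run_start (ltnW ltt) (npq _ pq_) pt.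
have {st} {}ps : private p s.+1 by apply: ps; rewrite ltnSn.
exists s.+1 => v vV; have [tv0 pv0] := privV vV.
have [tv [stv Stv]] := same_phase tv0 s.+1.
have pv : private v tv by rewrite /private -[tv]addn0 Stv addn0.
(* A private time t' of v in the window, between two times that are not private
   for v.  The window starts at s + 1, in a run of p, hence p needs s itself. *)
have [a0 [t' [c [[h1 h2 h3] [na pt' nc]]]]] : exists a0 t' c,
    [/\ s <= a0, a0 < t' & t' < c] /\ [/\ ~~ private v a0, private v t' & ~~ private v c /\ c <= s.+1 + (N + N)].
  case: (eqVneq v p) => [->|vp].
    exists s, s.+1, (s + (N + N)); split; first by split.
    by rewrite private_period; split=> //; split=> //; rewrite addSn.
  have nv : ~~ private v s.+1.
    apply: contra vp => /eqP E; move: ps; rewrite /private E => /eqP/set1_inj ->.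
    by [].
  exists s.+1, tv, (s.+1 + (N + N)); rewrite private_period; split; last by split.
  split=> //; last by case/andP: stv.
  case/andP: stv; rewrite leq_eqVlt => /predU1P[E|//]; by move: nv; rewrite E pv.
case: nc => nc cN.
have [a [a0a at_ npa pa]] := run_start (ltnW h2) na pt'.
have [b [tb bc npb pb]] := run_end (ltnW h3) pt' nc.
have pab u : a.+1 <= u <= b -> private v u.
  case/andP=> au ub; case: (leqP u t') => ut; first by apply: pa; rewrite au.
  by apply: pb; rewrite ub ltnW.
have [r [rV rv lr]] : exists r, [/\ r \in V, r != v & leaves r a].
  by apply: private_start => //; apply: pab; rewrite leqnn (leq_trans at_ tb).
have [q' [qV' qv eq]] : exists r, [/\ r \in V, r != v & enters r b].
  by apply: private_end => //; apply: pab; rewrite leqnn (leq_trans at_ tb).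
exists (a.+1, b), (r, q'); split; last by split.
split=> /=; first exact: leq_trans h1 a0a; first exact: leq_trans at_ tb.
exact: leq_trans (ltnW bc) cN.
Qed.

(** On its run [a v, b v] the element v is the only member of V in front, so all
    exchanges in the interior of the run are extra, and at least
    k - 1 - #|Z v| of them are needed to turn the front at a v into the front at
    b v, where Z v is their common part without v.  The sets Z v lie outside V and
    are pairwise disjoint: each run begins with the departure of some r v and ends
    with the arrival of some q v, a departure of r leaves a front disjoint
    from the one at the arrival of r, and three elements of V leave no choice of
    r and q without such a coincidence.  Summing over V gives
    3 (k - 1) - (#|A| - 3). *)
Lemma count_extra : 3 * k - #|A| <= count_times (extra A V k) 0 (N + N).
Proof.
have [s runs] := private_runs.
have /fin_all_exists [ab /fin_all_exists [rq abP]] : forall v, exists (ab : nat * nat),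
    exists (rq : T * T), v \in V ->
    [/\ s <= ab.1, ab.1 <= ab.2 & ab.2 <= s + (N + N)] /\
    [/\ 0 < ab.1, forall u, ab.1 <= u <= ab.2 -> private v u,
       [/\ rq.1 \in V, rq.1 != v & leaves rq.1 ab.1.-1] &
       [/\ rq.2 \in V, rq.2 != v & enters rq.2 ab.2]].
  move=> v; case: (boolP (v \in V)) => vV; last by exists (0, 0), (v, v).
  by have [ab [rq abP]] := runs v vV; exists ab, rq.
clear runs.
pose a v := (ab v).1; pose b v := (ab v).2; pose r v := (rq v).1; pose q v := (rq v).2.
have {abP} abP v : v \in V -> [/\ s <= a v, a v <= b v & b v <= s + (N + N)] /\
    [/\ 0 < a v, forall u, a v <= u <= b v -> private v u,
       [/\ r v \in V, r v != v & leaves (r v) (a v).-1] &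
       [/\ q v \in V, q v != v & enters (q v) (b v)]] by exact: abP.
have pa v : v \in V -> private v (a v) by case/abP => [[_ ab_ _] [_ h _ _]]; apply: h; rewrite leqnn.
have pb v : v \in V -> private v (b v) by case/abP => [[_ ab_ _] [_ h _ _]]; apply: h; rewrite leqnn andbT.
(* The departure at the start of the run of v and the arrival at the end of the
   run of w concern the same element. *)
have rq_disj v w : v \in V -> w \in V -> r v = q w -> [disjoint front (a v) & front (b w)].
  move=> vV wV E; have [_ [a0 _ [rV _ lr] _]] := abP v vV; have [_ [_ _ _ [_ _ eq]]] := abP w wV.
  have [s' hr] := hullV rV; rewrite -E in eq.
  by have := leaves_enters hr lr eq; rewrite prednK.
(* A departing element determines the front, hence who is alone in it. *)
have r_inj v w : v \in V -> w \in V -> r v = r w -> v = w.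
  move=> vV wV E; have [_ [a0 _ [rV _ lr] _]] := abP v vV; have [_ [a0' _ [_ _ lr'] _]] := abP w wV.
  have [s' hr] := hullV rV; rewrite -E in lr'.
  have := leaves_uniq hr lr lr'; rewrite !prednK // => SE.
  have := pa w wV; have := pa v vV; rewrite /private SE => /eqP-> /eqP/set1_inj. by [].
have rq_neq v : v \in V -> r v != q v.
  move=> vV; apply/eqP=> E; have := rq_disj v v vV vV E.
  by move/disjointFr/(_ (private_in (pa v vV))); rewrite (private_in (pb v vV)).
pose Z v := (front (a v) :&: front (b v)) :\ v.
have Zdisj v w z : v \in V -> w \in V -> z \in Z v -> z \in Z w -> v = w.
  rewrite !in_setD1 !in_setI => vV wV /and3P[_ zav zbv] /and3P[_ zaw zbw].
  apply/eqP; apply: contraT => vw.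
  have nd x y : x \in V -> y \in V -> z \in front (a x) -> z \in front (b y) -> r x != q y.
    move=> xV yV zx zy; apply/eqP=> E; have := rq_disj x y xV yV E.
    by move/disjointFr/(_ zx); rewrite zy.
  have n1 := nd v w vV wV zav zbw; have n2 := nd w v wV vV zaw zbv.
  have [u uV3] : exists u, V = [set v; w; u].
    have : #|V :\ v :\ w| == 1.
      have := cardsD1 v V; have := cardsD1 w (V :\ v); rewrite V3 vV !inE eq_sym vw wV /=; clear; lia.
    case/cards1P=> u uE; exists u; rewrite -[LHS](setD1K vV) -(@setD1K _ w (V :\ v)) ?uE.
      by rewrite setUA.
    by rewrite !inE eq_sym vw.
  have uV : u \in V by rewrite uV3 !inE eqxx !orbT.
  have sel x : x \in V -> [|| x == v, x == w | x == u] by rewrite uV3 !inE -orbA.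
  have [_ [_ _ [rvV rv _] [qvV qv _]]] := abP v vV.
  have [_ [_ _ [rwV rw _] [qwV qw _]]] := abP w wV.
  have [_ [_ _ [ruV ru _] _]] := abP u uV.
  have nv := rq_neq v vV; have nw := rq_neq w wV.
  have i1 : r v != r w by apply: contraNneq vw => /(r_inj _ _ vV wV) ->.
  have uv : u != v by apply/eqP=> E; move: V3; rewrite uV3 E setUC setUA setUid cards2; case: (_ != _).
  have uw : u != w by apply/eqP=> E; move: V3; rewrite uV3 E -setUA setUid cards2; case: (_ != _).
  have i2 : r u != r w by apply: contraNneq uw => /(r_inj _ _ uV wV) ->.
  have i3 : r u != r v by apply: contraNneq uv => /(r_inj _ _ uV vV) ->.
  (* The constraints force r v = w and r w = v, which leaves no value for r u. *)
  move: rv qv rw qw ru nv nw n1 n2 i1 i2 i3.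
  move: (sel _ rvV) (sel _ qvV) (sel _ rwV) (sel _ qwV) (sel _ ruV).
  move=> /or3P[] /eqP-> /or3P[] /eqP-> /or3P[] /eqP-> /or3P[] /eqP-> /or3P[] /eqP->;
  by rewrite ?eqxx ?vw ?uv ?uw ?(eq_sym w v) ?(eq_sym v u) ?(eq_sym w u) ?vw ?uv ?uw.
have kA' : k <= #|A| by lia.
have ZA v : v \in V -> Z v \subset A :\: V.
  move=> vV; apply/subsetP=> z; rewrite in_setD1 in_setI => /and3P[zv za _].
  rewrite in_setD (subsetP (first_subA A k (a v)) z za) andbT.
  by apply: contra zv => zV; rewrite (private_eq (pa v vV) zV za).
have sumZ : \sum_(v in V) #|Z v| <= #|A :\: V|.
  rewrite (eq_bigr (fun v => \sum_(z in A :\: V) (z \in Z v))); last first.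
    move=> v vV; rewrite -sum1_card big_mkcond [RHS]big_mkcond; apply: eq_bigr => z _.
    by case zZ: (z \in Z v); rewrite ?(subsetP (ZA v vV) z zZ) //; case: (_ \in _).
  rewrite exchange_big /= -sum1_card; apply: leq_sum => z _.
  rewrite (_ : \sum_(v in V) _ = #|[set v in V | z \in Z v]|); last first.
    by rewrite -sum1dep_card big_mkcondr; apply: eq_bigr => v _; case: (_ \in _).
  apply/card_le1_eqP => v w; rewrite [v \in _]in_set [w \in _]in_set.
  by case/andP=> vV zv /andP[wV zw]; apply: (Zdisj w v z).
have cardD v : v \in V -> #|front (a v) :\: front (b v)| + #|Z v| + 1 = k.
  move=> vV; have := cardsID (front (b v)) (front (a v)); rewrite card_first // => kE; rewrite -[RHS]kE.
  rewrite (cardsD1 v (front (a v) :&: front (b v))) in_setI (private_in (pa v vV)) (private_in (pb v vV)) -/(Z v).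
  by rewrite add1n addSn addn1 addnC.
have cntV v : v \in V -> #|front (a v) :\: front (b v)| <=
    count_times (fun t => extra A V k t && private v t) s (s + (N + N)).
  move=> vV; have [[sa ab_ bs] [_ pv _ _]] := abP v vV.
  apply: leq_trans (card_first_diff A k ab_) _.
  rewrite (@count_times_cat _ s (a v)); last by rewrite sa (leq_trans ab_ bs).
  rewrite (@count_times_cat _ (a v) (b v) (s + (N + N))); last by rewrite ab_ bs.
  rewrite addnCA; apply: leq_trans (leq_addr _ _).
  apply: leq_count_times => t /andP[at_ tb] ex.
  have pt : private v t by apply: pv; rewrite at_ ltnW.
  by rewrite pt andbT; apply: private_extra pt _ => //; apply: pv; rewrite tb ltnW.
have per t : extra A V k (t + (N + N)) = extra A V k t.
  rewrite /extra !addnA !meets_half first_period; congr (_ && _).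
  rewrite /exchange !swaps_in_half; case inA: (swaps_in A t) => //=.
  have := nleft_max inA; rewrite !nleft_half ?swaps_in_half // => h; congr (_ == _); lia.
rewrite -(@count_times_window _ (N + N) s per).
apply: leq_trans (_ : \sum_(v in V) #|front (a v) :\: front (b v)| <= _).
  have : \sum_(v in V) (#|front (a v) :\: front (b v)| + #|Z v| + 1) = 3 * k.
    by rewrite (eq_bigr _ cardD) sum_nat_const V3.
  rewrite !big_split /= sum1_card V3; move: sumZ; rewrite cardsD (setIidPr VA) V3; lia.
apply: leq_trans (leq_sum _ cntV) _.
rewrite sum_count_times /count_times; apply: leq_sum => t _.
case: (extra A V k t) => /=; last first.
  by rewrite (_ : [set _ in _ | _] = set0) ?cards0 //; apply/setP=> z; rewrite !inE andbF.
apply/card_le1_eqP => v w; rewrite !inE => /andP[_ /eqP pv] /andP[_ /eqP pw].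
by apply: set1_inj; rewrite -pv -pw.
Qed.

End Private.

(** * Hitting sets and the lower bound on critical swaps *)

(** Sets of hull elements that meet the front at all times; the set of all hull
    elements is one, as the first element always belongs to the front. *)
Definition hitting V : bool :=
  [&& V \subset A, `[< forall v, v \in V -> exists s, hull_at A s v >] &
      `[< forall t, front t :&: V != set0 >]].

Lemma hitting_exists : exists V, hitting V.
Proof.
exists [set v in A | `[< exists s, hull_at A s v >]].
apply/and3P; split.
- by apply/subsetP=> v; rewrite inE => /andP[].
- by apply/asboolP=> v; rewrite inE => /andP[_ /asboolP].
apply/asboolP=> t; have [x xA x0] := exists_place t (ltac:(lia) : 0 < #|A|).
apply/set0Pn; exists x; rewrite !inE xA x0 k0 /=; apply/asboolP.
by exists t; rewrite /hull_at xA x0 eqxx.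
Qed.

(** At the swap of u and v, or N steps later, both lie behind the first k elements. *)
Lemma two_miss u v : u \in A -> v \in A -> u != v ->
  exists t, (u \notin front t) && (v \notin front t).
Proof.
move=> uA vA uv; have /count_times_exists[t _ sw] : 0 < count_times (swaps_pair u v) 0 (0 + N).
  by rewrite swaps_pair_once.
have [inA uvt] : swaps_in A t /\ forall x, (x == u) || (x == v) -> (x == lsw t) || (x == rsw t).
  rewrite /swaps_in; case/orP: sw => /eqP[-> ->] in uA vA *; rewrite uA vA; split=> // x.
  by rewrite orbC.
have miss t' : k <= nleft A t' -> swaps_in A t' ->
    (lsw t' \notin front t') && (rsw t' \notin front t').
  move=> kl /andP[lA rA]; rewrite !inE lA rA place_rsw lA -!leqNgt /=; move: kl; rewrite /nleft; lia.
have fin t' : (lsw t' \notin front t') && (rsw t' \notin front t') ->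
    (forall x, (x == u) || (x == v) -> (x == lsw t') || (x == rsw t')) ->
    (u \notin front t') && (v \notin front t').
  case/andP=> lS rS h; apply/andP; split; [have := h u|have := h v]; rewrite eqxx ?orbT => /(_ isT);
  by case/orP=> /eqP->.
case: (leqP k (nleft A t)) => kl; first by exists t; apply: fin uvt; apply: miss.
exists (t + N); apply: fin; last by move=> x /uvt; rewrite lsw_half rsw_half orbC.
apply: miss; rewrite ?swaps_in_half // nleft_half //; lia.
Qed.

(** A minimal hitting set.  Minimality gives every member a private time, and
    [two_miss] excludes sets of size at most 2. *)
Lemma hitting_set : exists V, [/\ V \subset A, forall v, v \in V -> exists s, hull_at A s v,
  forall t, front t :&: V != set0, forall v, v \in V -> exists t, private V v t & 2 < #|V|].
Proof.
have [V minV] := ex_minset hitting_exists.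
have /and3P[VA /asboolP hV /asboolP hit] := minsetp minV.
exists V; split=> //.
  move=> v vV; apply: contrapT => np.
  suff hVv : hitting (V :\ v).
    have := minsetinf minV hVv (subsetDl _ _); move/setP/(_ v).
    by rewrite in_setD1 eqxx vV.
  apply/and3P; split.
  - exact: subset_trans (subsetDl _ _) VA.
  - by apply/asboolP=> w; rewrite inE => /andP[_ /hV].
  apply/asboolP=> t; apply/negP => /eqP S0; apply: np; exists t.
  apply: (privateP hit) => w wV wS; apply/eqP; apply: contraT => wv.
  have : w \in front t :&: (V :\ v) by rewrite in_setI in_setD1 wS wV wv.
  by rewrite S0 inE.
rewrite ltnNge; apply/negP => V2.
have [u [v [uA vA uv Vuv]]] : exists u v, [/\ u \in A, v \in A, u != v & V \subset [set u; v]].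
  have [x [y [xA yA xy]]] : exists x y, [/\ x \in A, y \in A & x != y].
    have /card_gt1P[x [y [xA yA xy]]] : 1 < #|A| by lia.
    by exists x, y.
  have : [|| #|V| == 2, #|V| == 1 | #|V| == 0] by move: V2; clear; lia.
  rewrite cards_eq0; case/or3P=> [/cards2P[u [v] [uv E]]|/cards1P[u E]|/eqP->].
  - by exists u, v; rewrite E subxx uv !(subsetP VA) // E !inE eqxx ?orbT.
  - have uA : u \in A by rewrite (subsetP VA) // E inE.
    have [xu|xu] := eqVneq x u.
      by exists u, y; rewrite E uA yA -{1}xu xy sub1set !inE eqxx.
    by exists u, x; rewrite E uA xA eq_sym xu sub1set !inE eqxx.
  by exists x, y; rewrite xA yA xy sub0set.
have [t /andP[ut vt]] := two_miss uA vA uv.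
have /set0Pn[w] := hit t; rewrite in_setI => /andP[wS /(subsetP Vuv)].
by rewrite !inE => /orP[] /eqP E; move: ut vt; rewrite -E wS.
Qed.

(** From a common time t, the arc of each of three elements would reach its private
    time either forwards or backwards.  Two of them agree in the direction, and at
    the nearer of their two private times both would be in front. *)
Lemma no_three V : (forall v, v \in V -> exists s, hull_at A s v) ->
  (forall v, v \in V -> exists t, private V v t) ->
  forall t, #|front t :&: V| <= 2.
Proof.
move=> hV pV t; rewrite leqNgt; apply/negP => /card_gt2P[x [y [z [[xS yS zS] [xy yz zx]]]]].
have loc v : v \in front t :&: V -> exists u, [/\ t <= u <= t + (N + N), private V v u &
    (forall u', t <= u' <= u -> v \in front u') \/ (forall u', u <= u' <= t + (N + N) -> v \in front u')].
  rewrite in_setI => /andP[vS vV]; have [u0 pu0] := pV v vV.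
  have [u [/andP[tu uN] Su]] := same_phase u0 t.
  have pu : private V v u by rewrite /private -[u]addn0 Su addn0.
  have [s hv] := hV v vV; exists u.
  have tuN : t <= u <= t + (N + N) by rewrite tu ltnW.
  by split=> //; exact: (hull_arc hv vS tuN (private_in pu)).
have same v w uv uw : v \in front t :&: V -> w \in front t :&: V -> v != w ->
    private V v uv -> private V w uw ->
    (w \in front uv) || (v \in front uw) -> False.
  rewrite !in_setI => /andP[_ vV] /andP[_ wV] vw pv pw /orP[] h.
    by move: vw; rewrite (private_eq pv wV h) eqxx.
  by move: vw; rewrite (private_eq pw vV h) eqxx.
have fwd v w uv uw : v \in front t :&: V -> w \in front t :&: V -> v != w ->
    t <= uv <= t + (N + N) -> t <= uw <= t + (N + N) ->
    private V v uv -> private V w uw ->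
    (forall u', t <= u' <= uv -> v \in front u') ->
    (forall u', t <= u' <= uw -> w \in front u') -> False.
  move=> vS wS vw /andP[tv _] /andP[tw _] pv pw fv fw.
  apply: (same v w uv uw) => //; case: (leqP uv uw) => h; first by rewrite fw ?tv.
  by rewrite fv ?orbT // tw ltnW.
have bwd v w uv uw : v \in front t :&: V -> w \in front t :&: V -> v != w ->
    t <= uv <= t + (N + N) -> t <= uw <= t + (N + N) ->
    private V v uv -> private V w uw ->
    (forall u', uv <= u' <= t + (N + N) -> v \in front u') ->
    (forall u', uw <= u' <= t + (N + N) -> w \in front u') -> False.
  move=> vS wS vw /andP[_ tv] /andP[_ tw] pv pw fv fw.
  apply: (same v w uv uw) => //; case: (leqP uv uw) => h; first by rewrite fv ?orbT // h.
  by rewrite fw // tv ltnW.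
have [ux [tx px ax]] := loc x xS; have [uy [ty py ay]] := loc y yS.
have [uz [tz pz az]] := loc z zS.
case: ax => fx; case: ay => fy; case: az => fz.
- exact: fwd xS yS xy tx ty px py fx fy.
- exact: fwd xS yS xy tx ty px py fx fy.
- exact: fwd zS xS zx tz tx pz px fz fx.
- exact: bwd yS zS yz ty tz py pz fy fz.
- exact: fwd yS zS yz ty tz py pz fy fz.
- exact: bwd zS xS zx tz tx pz px fz fx.
- exact: bwd xS yS xy tx ty px py fx fy.
- exact: bwd xS yS xy tx ty px py fx fy.
Qed.

End Arcs.

(** If 3 k <= #|A|, one hull element is removed.  Otherwise a minimal hitting set V
    is used, or four of its elements if it is larger: with four, 8 k - 6 critical
    swaps meet them, at least the required 6 k - 3 + (3 k - #|A|); with three, 6 k - 3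
    swaps meet them and [count_extra] supplies the rest. *)
Theorem critical_lower_bound (A : {set T}) k :
  2 * k < #|A| -> critical_bound #|A| k <= ncritical A k.
Proof.
elim/ltn_ind: k A => k IH A kA; case: (posnP k) => [->|k0].
  by rewrite critical_bound_small.
case: (leqP (3 * k) #|A|) => k3.
  have [v vA v0] := exists_place 0 (ltac:(lia) : 0 < #|A|).
  have hv : hull_at A 0 v by rewrite /hull_at vA v0 eqxx.
  apply: leq_trans (remove_one_hull hv kA k0).
  have n1 : #|A| = #|A :\ v|.+1 by rewrite (cardsD1 v A) vA.
  have := IH k.-1 (ltac:(lia)) (A :\ v) (ltac:(lia)).
  rewrite !critical_bound_small //; try lia.
  case: k k0 {IH hv kA k3} => // k _ /=; rewrite [in X in _ -> X]binS bin1; lia.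
have [V [VA hV hit pV V3]] := hitting_set k0 kA.
have V2 := no_three k0 kA hV pV.
have k2 : 2 <= k by lia.
have rec := critical_bound_rec (k - 2) (ltac:(lia) : 3 <= #|A|).
have kE : (k - 2).+2 = k by lia.
rewrite kE in rec; rewrite rec.
case: (eqVneq #|V| 3) => V3'.
  have := remove_hull VA hV k2 kA V2.
  have A' : #|A :\: V| = #|A| - 3 by rewrite cardsD (setIidPr VA) V3'.
  have := count_extra k0 kA VA hV hit pV V3'.
  have := IH (k - 2) (ltac:(lia)) (A :\: V) (ltac:(lia)).
  rewrite A' V3' eqxx mul1n.
  move: (critical_bound _ _) (ncritical (A :\: V) (k - 2)) (count_times _ _ _)
    (ncritical A k) => c m e m'.
  rewrite (_ : 'C(3, 2) = 3) //; clear -k2; lia.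
have [W WV W4] : exists2 W : {set T}, W \subset V & #|W| = 4.
  exists [set x in take 4 (enum V)].
    by apply/subsetP=> x; rewrite inE => /mem_take; rewrite mem_enum.
  have u : uniq (take 4 (enum V)) by rewrite take_uniq ?enum_uniq.
  rewrite cardsE (card_uniqP u) size_take -cardE.
  by case: ifP => h; move: V3 V3' h; clear; lia.
have WA := subset_trans WV VA.
have hW v : v \in W -> exists s, hull_at A s v by move/(subsetP WV)/hV.
have W2 t : #|first_ A k t :&: W| <= 2.
  by apply: leq_trans (V2 t); apply: subset_leq_card; apply: setIS.
have := remove_hull WA hW k2 kA W2.
have A' : #|A :\: W| = #|A| - 4 by rewrite cardsD (setIidPr WA) W4.
have := IH (k - 2) (ltac:(lia)) (A :\: W) (ltac:(lia)).
have := @critical_bound_mono (#|A| - 4) (#|A| - 3) (k - 2) (leq_sub2l _ (leqnSn 3)).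
rewrite A' W4 mul0n addn0 (_ : 'C(4, 2) = 6) //.
move: (critical_bound (#|A| - 3) (k - 2)) (critical_bound (#|A| - 4) (k - 2))
  (ncritical (A :\: W) (k - 2)) (ncritical A k) => c c' m m'.
clear -k2 k3 kA; lia.
Qed.

(** * Swaps in the middle *)
Section Middle.
Variable k : nat.

Hypotheses (k0 : 0 < k) (kn : 2 * k < #|T|).

Local Notation n := #|T|.
Local Notation K := (n - 2 * k).
Local Notation placeT := (place setT).
Local Notation nleftT := (nleft setT).
Local Notation ncriticalT := (ncritical setT).

Definition middle t : {set T} := [set x | k <= placeT t x < n - k].
Definition inner t : bool := k <= nleftT t < n - k - 1.
Definition border t : bool := ((nleftT t).+1 == k) || ((nleftT t).+1 == n - k).
Definition comes x t : bool := (x \notin middle t) && (x \in middle t.+1).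

Lemma card_middle t : #|middle t| = K.
Proof.
have kT : k <= #|[set: T]| by rewrite cardsT; lia.
have nkT : n - k <= #|[set: T]| by rewrite cardsT; lia.
have -> : middle t = first_ setT (n - k) t :\: first_ setT k t.
  by apply/setP=> x; rewrite !inE -leqNgt.
have sub : first_ setT k t \subset first_ setT (n - k) t by apply: first_sub; lia.
by rewrite cardsD (setIidPr sub) !card_first //; lia.
Qed.

Lemma place_rswT t : placeT t (rsw t) = (nleftT t).+1.
Proof. by rewrite place_rsw inE addn1. Qed.

Lemma placeS_lswT t : placeT t.+1 (lsw t) = (nleftT t).+1.
Proof. by rewrite placeS_lsw inE addn1. Qed.

Lemma nleft_maxT t : (nleftT t).+2 <= n.
Proof. by rewrite -cardsT; apply: nleft_max; rewrite /swaps_in !inE. Qed.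

Lemma inner_middle t x : inner t -> swaps_of x t -> (x \in middle t) && (x \in middle t.+1).
Proof.
rewrite /inner /middle !inE => it /orP[] /eqP->.
  by rewrite placeS_lswT -/(nleftT t); lia.
by rewrite placeS_rsw place_rswT; lia.
Qed.

Lemma stay_swap t x : x \in middle t -> x \in middle t.+1 -> swaps_of x t -> inner t.
Proof.
rewrite /inner /middle !inE => m1 m2 /orP[] /eqP E; move: m1 m2; rewrite {}E.
  by rewrite placeS_lswT -/(nleftT t); lia.
by rewrite placeS_rsw place_rswT; lia.
Qed.

Lemma middle_step t x : ~~ swaps_of x t -> (x \in middle t.+1) = (x \in middle t).
Proof. by rewrite /swaps_of negb_or !inE => /andP[xl xr]; rewrite placeS_neq. Qed.

Lemma card_comes t : #|[set x | comes x t]| = border t.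
Proof.
have lr := lsw_neq t; have nm := nleft_maxT t.
have sub x : comes x t -> swaps_of x t.
  by case/andP=> m1 m2; apply: contraNT m1 => /middle_step <-.
have cl : comes (lsw t) t = ((nleftT t).+1 == k).
  by rewrite /comes !inE placeS_lswT -/(nleftT t); lia.
have cr : comes (rsw t) t = ((nleftT t).+1 == n - k).
  by rewrite /comes !inE placeS_rsw place_rswT; lia.
rewrite /border; case: eqP cl => E1 cl; case: eqP cr => E2 cr /=; first by lia.
- rewrite (_ : [set _ | _] = [set lsw t]) ?cards1 //; apply/setP=> x; rewrite !inE.
  apply/idP/eqP => [cx|->//]; case/orP: (sub x cx) => /eqP // E.
  by rewrite E cr in cx.
- rewrite (_ : [set _ | _] = [set rsw t]) ?cards1 //; apply/setP=> x; rewrite !inE.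
  apply/idP/eqP => [cx|->//]; case/orP: (sub x cx) => /eqP // E.
  by rewrite E cl in cx.
apply/eqP; rewrite cards_eq0; apply/eqP/setP=> x; rewrite !inE; apply/negP => cx.
by case/orP: (sub x cx) => /eqP E; rewrite E ?cl ?cr in cx.
Qed.

Lemma card_stay t : border t -> #|middle t :&: middle t.+1| = K - 1.
Proof.
move=> bt; have := card_comes t; rewrite bt => cE.
have := cardsID (middle t) (middle t.+1); rewrite card_middle setIC => <-.
rewrite (_ : middle t.+1 :\: middle t = [set x | comes x t]) ?cE ?addnK //.
Qed.

Lemma swaps_of_pairs x t : \sum_(y | x != y) swaps_pair x y t = swaps_of x t :> nat.
Proof.
have lr := lsw_neq t.
rewrite (_ : \sum_(_ | _) _ = #|[set y | (x != y) && swaps_pair x y t]|); last first.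
  by rewrite -sum1dep_card big_mkcondr; apply: eq_bigr => y _; case: swaps_pair.
rewrite /swaps_of /swaps_pair; case: (eqVneq x (lsw t)) => [->|xl] /=.
  rewrite (_ : [set _ | _] = [set rsw t]) ?cards1 //; apply/setP=> y; rewrite !inE !xpair_eqE.
  rewrite (negbTE lr) (eqxx (lsw t)) orbF /=.
  by case: (eqVneq y (rsw t)) => [->|_]; rewrite ?lr ?andbF.
case: (eqVneq x (rsw t)) => [->|xr] /=.
  rewrite (_ : [set _ | _] = [set lsw t]) ?cards1 //; apply/setP=> y; rewrite !inE !xpair_eqE.
  rewrite [rsw t == lsw t]eq_sym (negbTE lr) (eqxx (rsw t)) /=.
  by case: (eqVneq y (lsw t)) => [->|_]; rewrite ?[rsw t == _]eq_sym ?lr ?andbF.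
apply/eqP; rewrite cards_eq0; apply/eqP/setP=> y; rewrite !inE !xpair_eqE.
by rewrite (negbTE xl) (negbTE xr) !andbF.
Qed.

Lemma count_swaps_of_pairs x a b :
  count_times (swaps_of x) a b = \sum_(y | x != y) count_times (swaps_pair x y) a b.
Proof.
rewrite /count_times exchange_big; apply: eq_bigr => t _; exact/esym/swaps_of_pairs.
Qed.

Lemma count_swaps_of x s : count_times (swaps_of x) s (s + N) = n.-1.
Proof.
rewrite count_swaps_of_pairs (eq_bigr (fun=> 1)) => [|y xy]; last exact: swaps_pair_once.
by rewrite sum1dep_card -(cardC1 x); apply: eq_card => y; rewrite !inE eq_sym.
Qed.

Lemma border_half t : border (t + N) = border t.
Proof.
have := nleft_maxT t; rewrite /border nleft_half ?cardsT /swaps_in ?inE //; lia.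
Qed.

(** Within N steps x meets every other element at most once, and each one it meets
    is either in the middle at time a or arrives there by a border swap. *)
Lemma stay_bound_short x a b : a <= b -> b <= a + N ->
  (forall u, a <= u <= b -> x \in middle u) ->
  count_times (swaps_of x) a b <= count_times border a b + (K - 1).
Proof.
move=> ab bN st; rewrite count_swaps_of_pairs.
have le1 y : x != y -> count_times (swaps_pair x y) a b <= 1.
  move=> xy; rewrite -(swaps_pair_once a xy) (@count_times_cat _ a b (a + N)) ?ab //.
  exact: leq_addr.
pose D := [set y | (x != y) && (0 < count_times (swaps_pair x y) a b)].
pose C := [set y | 0 < count_times (comes y) a b].
apply: leq_trans (_ : #|D| <= _).
  rewrite -sum1dep_card big_mkcondr; apply: leq_sum => y /le1.
  by case: (count_times _ _ _) => [|[]].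
have C_le : #|C| <= count_times border a b.
  apply: leq_trans (_ : \sum_y count_times (comes y) a b <= _).
    rewrite -sum1dep_card big_mkcond; apply: leq_sum => y _.
    by case: (count_times _ _ _).
  rewrite (eq_bigl (mem [set: T])) => [|y]; last by rewrite !inE.
  rewrite sum_count_times /count_times; apply: leq_sum => t _.
  by rewrite -card_comes; apply: subset_leq_card; apply/subsetP => y; rewrite !inE.
have D_sub : D \subset C :|: (middle a :\ x).
  apply/subsetP=> y; rewrite inE => /andP[xy /count_times_exists[t tab sw]].
  rewrite in_setU in_setD1 eq_sym xy /=; case: (boolP (y \in middle a)) => ya.
    by rewrite orbT.
  rewrite orbF inE; have [sx sy] : swaps_of x t /\ swaps_of y t.
    by rewrite /swaps_of; case/orP: sw => /eqP[-> ->]; rewrite !eqxx ?orbT.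
  have it : inner t by apply: (@stay_swap t x) => //; apply: st; lia.
  have /andP[yt _] := inner_middle it sy.
  case/andP: tab => at_ tb.
  have lat : a < t by rewrite ltn_neqAle at_ andbT; apply: contraNneq ya => ->.
  have [u uat cu] := @rising_edge (fun t => y \in middle t) a t lat ya yt.
  rewrite (@count_times_cat _ a u b); last by clear -uat tb; lia.
  rewrite (@count_times_cat _ u u.+1 b); last by clear -uat tb; lia.
  by rewrite count_times1 /comes cu addnCA ltn_addr.
apply: leq_trans (subset_leq_card D_sub) _; apply: leq_trans (leq_card_setU _ _) _.
apply: leq_add => //; have xa : x \in middle a by apply: st; rewrite leqnn.
by have := cardsD1 x (middle a); rewrite xa card_middle; lia.
Qed.

Variable W : nat.
(** Either the border swaps are as many as the swaps of one element in N steps,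
    so that [stay_bound_short] extends to all lengths, or only windows of length
    at most N are considered. *)
Hypothesis long : n.-1 <= count_times border 0 N \/ W <= N.

Lemma stay_bound x a b : a <= b -> b <= W ->
  (forall u, a <= u <= b -> x \in middle u) ->
  count_times (swaps_of x) a b <= count_times border a b + (K - 1).
Proof.
case: long => [En|WN]; last first.
  move=> ab bW; apply: stay_bound_short => //; lia.
elim/ltn_ind: b => b IH ab bW st; case: (leqP b (a + N)) => bN; first exact: stay_bound_short.
have N0 : 0 < N by apply: half_gt0 (k0) (_ : 2 * k < #|[set: T]|); rewrite ?cardsT.
(* The last halfperiod adds n - 1 swaps of x and at least as many border swaps. *)
have bE : b = b - N + N by lia.
have {}IH : count_times (swaps_of x) a (b - N) <= count_times border a (b - N) + (K - 1).
  by apply: IH; try lia; move=> u u1; apply: st; lia.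
rewrite (@count_times_cat (swaps_of x) a (b - N) b); last by lia.
rewrite (@count_times_cat border a (b - N) b); last by lia.
have Nb : N <= b by lia.
have c1 := count_swaps_of x (b - N); rewrite subnK // in c1.
have c2 := count_times_window (b - N) border_half; rewrite subnK // in c2.
by rewrite c1 c2 addnAC; apply: leq_add.
Qed.

Definition stays x t : bool := border t && (x \in middle t :&: middle t.+1).

(** The time that x spends in the middle splits into stays, each of which begins
    at time 0 or with an arrival. *)
Lemma visits_bound x w : w <= W ->
  count_times (fun t => inner t && swaps_of x t) 0 w <=
  count_times (stays x) 0 w + (K - 1) * ((x \in middle 0) + count_times (comes x) 0 w).
Proof.
have run a b : a <= b -> b <= W -> (forall u, a <= u <= b -> x \in middle u) ->
    count_times (fun t => inner t && swaps_of x t) a b <= count_times (stays x) a b + (K - 1).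
  move=> ab bW st; apply: leq_trans (_ : count_times (swaps_of x) a b <= _).
    by apply: leq_count_times => t _ /andP[].
  rewrite (@eq_count_times (stays x) border); first exact: stay_bound.
  by move=> t tab; rewrite /stays in_setI !st ?andbT //; lia.
elim/ltn_ind: w => -[|w] IH wW; first by rewrite !count_times_geq.
case: (boolP (x \in middle w.+1)) => xw; last first.
  rewrite count_times_recr // (_ : inner w && _ = false) ?addn0; last first.
    by apply/negP => /andP[iw /(inner_middle iw)]; rewrite (negbTE xw) andbF.
  apply: leq_trans (IH w (ltnSn w) (ltnW wW)) _.
  rewrite !count_times_recr //; apply: leq_add; first exact: leq_addr.
  by rewrite leq_mul2l addnA leq_addr orbT.
case: (boolP [forall u : 'I_w.+1, x \in middle u]) => [/forallP al|].
  have al' u : 0 <= u <= w.+1 -> x \in middle u.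
    by case/andP=> _; rewrite leq_eqVlt => /predU1P[->//|uw]; exact: (al (Ordinal uw)).
  apply: leq_trans (run 0 w.+1 _ wW al') _ => //.
  rewrite leq_add2l al' // -{1}[K - 1]muln1 leq_mul2l; lia.
rewrite negb_forall => /existsP[u xu].
have [a [_ aw xa st]] := @run_start (fun t => x \in middle t) u w.+1 (ltnW (ltn_ord u)) xu xw.
have aW : a <= W by apply: leq_trans wW; exact: ltnW.
have ca : comes x a by rewrite /comes xa st // ltnSn.
have ia : inner a && swaps_of x a = false.
  by apply/negP => /andP[ia /(inner_middle ia)]; rewrite (negbTE xa).
have := IH a aw aW; have := run a.+1 w.+1 aw wW st.
rewrite !(fun P => @count_times_cat P 0 a w.+1) ?(ltnW aw) //.
rewrite !(fun P => @count_times_cat P a a.+1 w.+1) ?leqnSn //= !count_times1 ia ca.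
set X := K - 1; rewrite !mulnDr !muln1.
move: (count_times _ _ _) => *; lia.
Qed.

(** Summing [visits_bound] over all x counts every inner swap twice.  Each border
    swap is counted K - 1 times for the elements that stay in the middle, and K - 1
    times for the one that arrives. *)
Lemma inner_bound : 2 * count_times inner 0 W <=
  2 * (K - 1) * count_times border 0 W + (K - 1) * K.
Proof.
have : \sum_x count_times (fun t => inner t && swaps_of x t) 0 W <=
  \sum_x (count_times (stays x) 0 W +
           (K - 1) * ((x \in middle 0) + count_times (comes x) 0 W)).
  by apply: leq_sum => x _; exact: visits_bound.
rewrite big_split /= -big_distrr /= big_split /=.
have sumE (P : T -> pred nat) : \sum_x count_times (P x) 0 W = \sum_(0 <= t < W) #|[set x | P x t]|.
  rewrite (eq_bigl (mem [set: T])) => [|y]; last by rewrite !inE.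
  by rewrite sum_count_times; apply: eq_bigr => t _; apply: eq_card => x; rewrite !inE.
rewrite !sumE.
rewrite (_ : \sum_(0 <= t < W) #|[set x | inner t && swaps_of x t]| = 2 * count_times inner 0 W); last first.
  rewrite /count_times big_distrr; apply: eq_bigr => t _; case: (inner t) => /=; last first.
    by apply/eqP; rewrite cards_eq0; apply/eqP/setP=> x; rewrite !inE.
  rewrite (_ : [set _ | _] = [set lsw t; rsw t]) ?cards2 ?lsw_neq //.
  by apply/setP=> x; rewrite !inE.
rewrite (_ : \sum_(0 <= t < W) #|[set x | stays x t]| = (K - 1) * count_times border 0 W); last first.
  rewrite /count_times big_distrr; apply: eq_bigr => t _ /=; case bt: (border t); last first.
    by rewrite muln0; apply/eqP; rewrite cards_eq0; apply/eqP/setP=> x; rewrite !inE /stays bt.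
  rewrite muln1 -(card_stay bt); apply: eq_card => x; by rewrite inE /stays bt.
rewrite (_ : \sum_(0 <= t < W) #|[set x | comes x t]| = count_times border 0 W); last first.
  by apply: eq_bigr => t _; exact: card_comes.
rewrite (_ : \sum_x (x \in middle 0) = K); last first.
  by rewrite -(card_middle 0) -sum1_card [RHS]big_mkcond; apply: eq_bigr => x _; case: (_ \in _).
move: (K - 1) (count_times inner 0 W) (count_times border 0 W) K => X c b K' H.
apply: leq_trans H _; rewrite mulnDr; lia.
Qed.

End Middle.

Section Central.
Variable k : nat.

Hypotheses (k0 : 0 < k) (kn : 2 * k < #|T|).
Local Notation n := #|T|.
Local Notation K := (n - 2 * k).
Local Notation ncriticalT := (ncritical setT).

Lemma count_inner : count_times (inner k) 0 N = N - ncriticalT k.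
Proof.
suff : count_times (inner k) 0 N + ncriticalT k = N by lia.
rewrite /ncritical /count_times -big_split /= (eq_bigr (fun=> 1)) ?sum_nat_const_nat ?subn0 ?muln1 //.
move=> t _; have := nleft_maxT t.
by rewrite /inner /critical_in /swaps_in !inE cardsT /=; lia.
Qed.

Lemma count_border : count_times (border k) 0 N + ncriticalT k.-1 = ncriticalT k.
Proof.
rewrite /ncritical /count_times -big_split /=; apply: eq_bigr => t _.
have := nleft_maxT t.
rewrite /border /critical_in /swaps_in !inE cardsT /=; move: k0 kn.
move: (nleft _ _) k #|T| => c k' n'; lia.
Qed.

(** Over a window of M halfperiods the additive term of [inner_bound] does not grow
    with M; for M = K ^ 2 + 1 it is too small to matter between integers. *)
Theorem central_bound : n.-1 <= ncriticalT k - ncriticalT k.-1 ->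
  N - ncriticalT k <= (K - 1) * (ncriticalT k - ncriticalT k.-1).
Proof.
rewrite -count_border addnK => En; rewrite count_border -count_inner.
have := @inner_bound k k0 kn ((K * K).+1 * N) (or_introl En).
have per1 t : inner k (t + N) = inner k t.
  have := nleft_maxT t; rewrite /inner nleft_half ?cardsT /swaps_in ?inE //; lia.
have := count_times_windows 0 (K * K).+1 per1; rewrite add0n => ->.
have := count_times_windows 0 (K * K).+1 (border_half k0 kn); rewrite add0n => ->.
move: (count_times (inner k) 0 N) (count_times (border k) 0 N) => a b.
have : 0 < K by lia.
move: K => c c0 H; rewrite leqNgt; apply/negP => h.
have {}h : (c - 1) * b + 1 <= a by lia.
have := leq_mul (leqnn (2 * (c * c).+1)) h; nia.
Qed.

Theorem central_bound_weak :
  N - ncriticalT k <= (K - 1) * (ncriticalT k - ncriticalT k.-1) + 'C(K, 2).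
Proof.
rewrite -count_border addnK count_border -count_inner.
have := @inner_bound k k0 kn N (or_intror (leqnn N)).
rewrite bin2; have : odd (K * K.-1) = false by rewrite oddM; case: (K) => //= m; case: (odd m).
by rewrite -{2}[K * K.-1]odd_double_half => ->; rewrite subn1; lia.
Qed.

End Central.

(** * Separation and crossing of pairs *)

Definition separated a b c d : bool :=
  [exists t : 'I_N, swaps_pair a b t &&
    ([&& bef t c a, bef t c b, bef t a d & bef t b d] ||
     [&& bef t d a, bef t d b, bef t a c & bef t b c])].

Lemma pair_time x y : x != y -> exists2 t, t < N & swaps_pair x y t.
Proof.
move=> xy; have := swaps_pair_once 0 xy; rewrite add0n => c1.
by have [t /andP[_ tN] sw] : exists2 t, 0 <= t < N & swaps_pair x y t;
  [apply: count_times_exists; rewrite c1 | exists t].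
Qed.

Lemma pair_time_uniq x y t t' : x != y -> t < N -> t' < N ->
  swaps_pair x y t -> swaps_pair x y t' -> t = t'.
Proof.
move=> xy; wlog tt' : t t' / t < t' => [W|] tN tN' st st'.
  case: (ltngtP t t') => // h; first exact: W st st'.
  by apply/esym; exact: W st' st.
have := swaps_pair_once 0 xy; rewrite add0n.
rewrite (@count_times_cat _ 0 t N); last exact: ltnW.
rewrite (@count_times_cat _ t t.+1 N); last by rewrite leqnSn.
rewrite (@count_times_cat _ t.+1 t' N); last by rewrite tt' ltnW.
rewrite (@count_times_cat _ t' t'.+1 N); last by rewrite leqnSn.
rewrite !count_times1 st st'; clear; lia.
Qed.

Lemma bef_time x y u t : x != y -> u < N -> swaps_pair x y u -> t <= N ->
  bef t x y = bef 0 x y (+) (u < t).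
Proof.
move=> xy uN su tN; rewrite (bef_parity x y (leq0n t)); congr (_ (+) _).
have := swaps_pair_once 0 xy; rewrite add0n (@count_times_cat _ 0 t); last by rewrite tN.
case: ltnP => ut.
  rewrite (@count_times_cat _ 0 u t); last exact: ltnW.
  rewrite (@count_times_cat _ u u.+1 t) ?leqnSn ?ut // count_times1 su => E.
  have -> : count_times (swaps_pair x y) 0 u = 0 by lia.
  by have -> : count_times (swaps_pair x y) u.+1 t = 0 by lia.
rewrite (@count_times_cat _ t u N); last by rewrite ut ltnW.
rewrite (@count_times_cat _ u u.+1 N) ?leqnSn ?uN // count_times1 su => E.
by have -> : count_times (swaps_pair x y) 0 t = 0 by lia.
Qed.

Lemma pair_adj a b t z : swaps_pair a b t -> z != a -> z != b -> bef t z a = bef t z b.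
Proof. by case/orP=> /eqP[-> ->] za zb; rewrite bef_adj. Qed.

(** Once a and b are neighbours, it is enough to compare c and d with a. *)
Lemma separatedE a b c d t : t < N -> swaps_pair a b t -> uniq [:: a; b; c; d] ->
  separated a b c d = (bef t c a != bef t d a).
Proof.
move=> tN sw; rewrite /= !inE !negb_or -!andbA => /and5P[ab ac ad bc /andP[bd /andP[cd _]]].
have cE : bef t c a = bef t c b by apply: pair_adj => //; rewrite eq_sym.
have dE : bef t d a = bef t d b by apply: pair_adj => //; rewrite eq_sym.
have test : ([&& bef t c a, bef t c b, bef t a d & bef t b d] ||
     [&& bef t d a, bef t d b, bef t a c & bef t b c]) = (bef t c a != bef t d a).
  rewrite [bef t a d]befN 1?eq_sym // [bef t b d]befN 1?eq_sym //.
  rewrite [bef t a c]befN 1?eq_sym // [bef t b c]befN 1?eq_sym // -cE -dE.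
  by case: (bef t c a); case: (bef t d a).
rewrite -test; apply/existsP/idP => [[u /andP[su h]]|h].
  by rewrite -(pair_time_uniq ab (ltn_ord u) tN su sw).
by exists (Ordinal tN); rewrite sw.
Qed.

Lemma separatedCl a b c d : separated b a c d = separated a b c d.
Proof.
apply: eq_existsb => t; rewrite swaps_pairC; congr (_ && _).
by case: (bef t c a); case: (bef t c b); case: (bef t a d); case: (bef t b d);
   case: (bef t d a); case: (bef t d b); case: (bef t a c); case: (bef t b c).
Qed.

Lemma separatedCr a b c d : separated a b d c = separated a b c d.
Proof. by apply: eq_existsb => t; rewrite orbC. Qed.

Definition crossing a b c d : bool := separated a b c d && separated c d a b.

(** Each of the three ways of splitting four elements into two pairs contributes
    its two possible separations and its possible crossing. *)
Definition quad a b c d : nat :=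
  (separated a b c d + separated c d a b + crossing a b c d) +
  (separated a c b d + separated b d a c + crossing a c b d) +
  (separated a d b c + separated b c a d + crossing a d b c).

Ltac by_bools a b c d :=
  move: (separated a b c d) (separated c d a b) (separated a c b d) (separated b d a c)
    (separated a d b c) (separated b c a d); do 6!case.

Lemma quad12 a b c d : quad b a c d = quad a b c d.
Proof.
rewrite /quad /crossing (separatedCl a b) (separatedCr _ _ a b).
rewrite (andbC (separated b d a c)) (andbC (separated b c a d));
  by by_bools a b c d.
Qed.

Lemma quad23 a b c d : quad a c b d = quad a b c d.
Proof.
rewrite /quad /crossing (separatedCl b c) (separatedCr _ _ b c);
  by by_bools a b c d.
Qed.

Lemma quad34 a b c d : quad a b d c = quad a b c d.
Proof.
rewrite /quad /crossing (separatedCl c d) (separatedCr _ _ c d);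
  by by_bools a b c d.
Qed.

(** For x before y before z, the pair x, z is exchanged between the two others:
    x and z have to become neighbours. *)
Lemma triple_times x y z txy txz tyz : bef 0 x y -> bef 0 y z ->
  txy < N -> txz < N -> tyz < N ->
  swaps_pair x y txy -> swaps_pair x z txz -> swaps_pair y z tyz ->
  (txy < txz) && (txz < tyz) || (tyz < txz) && (txz < txy).
Proof.
move=> xy yz lxy lxz lyz sxy sxz syz; have xz := bef_trans xy yz.
have nxy := bef_neq xy; have nxz := bef_neq xz; have nyz := bef_neq yz.
have Exy := bef_time nxy lxy sxy; have Exz := bef_time nxz lxz sxz.
have Eyz := bef_time nyz lyz syz.
(* When two of them are neighbours, the third lies on the same side of both. *)
have := pair_adj sxz (_ : y != x) nyz; rewrite eq_sym => /(_ nxy).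
rewrite befN // Exy ?(ltnW lxz) // Eyz ?(ltnW lxz) // xy yz.
have := pair_adj sxy (_ : z != x) (_ : z != y); rewrite ![z == _]eq_sym => /(_ nxz nyz).
rewrite [bef _ z x]befN // [bef _ z y]befN // Exz ?(ltnW lxy) // Eyz ?(ltnW lxy) // xz yz.
have := pair_adj syz nxy nxz; rewrite Exy ?(ltnW lyz) // Exz ?(ltnW lyz) // xy xz !addTb.
clear; lia.
Qed.

(** The order of the six swap times decides all separations, and [triple_times]
    for the four triples leaves only a few such orders. *)
Lemma quad_sorted a b c d : bef 0 a b -> bef 0 b c -> bef 0 c d -> quad a b c d = 3.
Proof.
move=> ab bc cd; have ac := bef_trans ab bc; have bd := bef_trans bc cd.
have ad := bef_trans ab bd.
have nab := bef_neq ab; have nac := bef_neq ac; have nad := bef_neq ad.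
have nbc := bef_neq bc; have nbd := bef_neq bd; have ncd := bef_neq cd.
have [tab lab sab] := pair_time nab; have [tac lac sac] := pair_time nac.
have [tad lad sad] := pair_time nad; have [tbc lbc sbc] := pair_time nbc.
have [tbd lbd sbd] := pair_time nbd; have [tcd lcd scd] := pair_time ncd.
have := triple_times ab bc lab lac lbc sab sac sbc.
have := triple_times ab bd lab lad lbd sab sad sbd.
have := triple_times ac cd lac lad lcd sac sad scd.
have := triple_times bc cd lbc lbd lcd sbc sbd scd.
have sepE x y z w t := @separatedE x y z w t.
have nE : (nab, nac, nad, nbc, nbd, ncd) = (nab, nac, nad, nbc, nbd, ncd) by [].
rewrite /quad /crossing.
rewrite (sepE a b c d tab) // ?(sepE c d a b tcd) // ?(sepE a c b d tac) //
  ?(sepE b d a c tbd) // ?(sepE a d b c tad) // ?(sepE b c a d tbc) //; last 6 first.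
all: try by rewrite /= !inE !negb_or ?nab ?nac ?nad ?nbc ?nbd ?ncd
  ?(eq_sym b a) ?(eq_sym c a) ?(eq_sym d a) ?(eq_sym c b) ?(eq_sym d b) ?(eq_sym d c)
  ?nab ?nac ?nad ?nbc ?nbd ?ncd.
rewrite ![bef _ c a]befN // ![bef _ d a]befN // ![bef _ b a]befN // ![bef _ c b]befN //
  ![bef _ d b]befN //.
rewrite (bef_time nac lac sac (ltnW lab)) (bef_time nad lad sad (ltnW lab)).
rewrite (bef_time nac lac sac (ltnW lcd)) (bef_time nbc lbc sbc (ltnW lcd)).
rewrite (bef_time nab lab sab (ltnW lac)) (bef_time nad lad sad (ltnW lac)).
rewrite (bef_time nab lab sab (ltnW lbd)) (bef_time nbc lbc sbc (ltnW lbd)).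
rewrite (bef_time nab lab sab (ltnW lad)) (bef_time nac lac sac (ltnW lad)).
rewrite (bef_time nab lab sab (ltnW lbc)) (bef_time nbd lbd sbd (ltnW lbc)).
rewrite ab ac ad bc bd /=; clear.
by case/orP=> /andP[h1 h2]; case/orP=> /andP[h3 h4]; case/orP=> /andP[h5 h6];
   case/orP=> /andP[h7 h8]; lia.
Qed.

Lemma quad_uniq a b c d : uniq [:: a; b; c; d] -> quad a b c d = 3.
Proof.
have dich x y : x != y -> {bef 0 x y} + {bef 0 y x}.
  by move=> xy; case: (boolP (bef 0 x y)) => h; [left | right; rewrite befN].
rewrite /= !inE !negb_or -!andbA => /and5P[ab ac ad bc /andP[bd /andP[cd _]]].
have Q3 x y z w : bef 0 x y -> bef 0 y z -> x != w -> y != w -> z != w -> quad x y z w = 3.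
  move=> xy yz xw yw zw; case: (dich _ _ zw) => h; first exact: quad_sorted.
  rewrite -quad34; case: (dich _ _ yw) => h'; first exact: quad_sorted.
  rewrite -quad23; case: (dich _ _ xw) => h''; first exact: quad_sorted.
  by rewrite -quad12; apply: quad_sorted.
have Q2 x y z w : bef 0 x y -> x != z -> y != z -> x != w -> y != w -> z != w -> quad x y z w = 3.
  move=> xy xz yz xw yw zw; case: (dich _ _ yz) => h; first exact: Q3.
  rewrite -quad23; case: (dich _ _ xz) => h'; first exact: Q3.
  by rewrite -quad12; apply: Q3.
case: (dich _ _ ab) => h; first exact: Q2.
by rewrite -quad12; apply: Q2.
Qed.

End Sweep.

(** * Crossings and sides *)

Lemma sum_sym_ord n (G : 'I_n -> 'I_n -> nat) :
  (forall i j, G i j = G j i) -> (forall i, G i i = 0) ->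
  \sum_i \sum_j G i j = 2 * \sum_(i : 'I_n) \sum_(j : 'I_n | i < j) G i j.
Proof.
move=> Gs G0; have E : \sum_(i : 'I_n) \sum_(j : 'I_n | j < i) G i j =
    \sum_(i : 'I_n) \sum_(j : 'I_n | i < j) G i j.
  under eq_bigr do rewrite big_mkcond; rewrite exchange_big /=.
  by apply: eq_bigr => i _; rewrite -big_mkcond; apply: eq_bigr => j _; rewrite Gs.
rewrite mul2n -addnn -{1}E -big_split; apply: eq_bigr => i _.
rewrite (bigID (fun j : 'I_n => j < i)) /=; congr (_ + _).
rewrite (bigD1 i) /= ?ltnn // G0 add0n; apply: eq_bigl => j.
by rewrite -leqNgt ltn_neqAle andbC eq_sym.
Qed.

Lemma sum_card (I : finType) (P : pred I) : \sum_i (P i : nat) = #|[set i | P i]|.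
Proof. by rewrite -sum1dep_card [RHS]big_mkcond; apply: eq_bigr => i _; case: (P i). Qed.

Lemma card_uniq4 (T : finType) :
  \sum_(a : T) \sum_(b : T) \sum_(c : T) \sum_(d : T) uniq [:: a; b; c; d]
  = #|T| * (#|T| - 1) * (#|T| - 2) * (#|T| - 3).
Proof.
pose n := #|T|.
have cnt (s : seq T) : uniq s -> \sum_(x : T) (x \notin s) = n - size s.
  move=> us; rewrite sum_card -[n](cardC (mem s)) (card_uniqP us) addKn.
  by apply: eq_card => x; rewrite !inE.
have stepS (s : seq T) (f : bool -> nat) : uniq s -> f false = 0 ->
    \sum_(x : T) f (x \notin s) = (n - size s) * f true.
  move=> us f0; rewrite -cnt // big_distrl /=; apply: eq_bigr => x _.
  by case: (x \notin s); rewrite ?mul1n ?mul0n.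
have U (a b c d : T) : uniq [:: a; b; c; d] =
   [&& d \notin [:: a; b; c], c \notin [:: a; b] & b \notin [:: a]].
  by rewrite /= !inE !negb_or !(eq_sym d) !(eq_sym c) !(eq_sym b);
     do 6!case: (_ == _) => //=.
rewrite (eq_bigr (fun a : T => (n - 1) * ((n - 2) * (n - 3)))).
  by rewrite sum_nat_const !mulnA.
move=> a _.
have := stepS [:: a] (fun e : bool => e * ((n - 2) * (n - 3))) isT (mul0n _).
rewrite [X in _ = _ * X]mul1n => <-.
apply: eq_bigr => b _; case: (boolP (b \notin [:: a])) => ba; last first.
  rewrite mul0n; apply: big1 => c _; apply: big1 => d _; rewrite U (negbTE ba) !andbF //.
have uba : uniq [:: a; b] by move: ba; rewrite /= !inE eq_sym => ->.
rewrite mul1n; have := stepS [:: a; b] (fun e : bool => e * (n - 3)) uba (mul0n _).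
rewrite [X in _ = _ * X]mul1n => <-.
apply: eq_bigr => c _; case: (boolP (c \notin [:: a; b])) => ca; last first.
  rewrite mul0n; apply: big1 => d _; rewrite U (negbTE ca) !andbF //.
have uca : uniq [:: a; b; c].
  by move: ca uba; rewrite /= !inE !negb_or !(eq_sym c) => /andP[-> ->]; rewrite !andbT.
rewrite mul1n -[n - 3]/(n - size [:: a; b; c]) -cnt //.
by apply: eq_bigr => d _; rewrite U ca ba !andbT.
Qed.

Section CrossingNumber.
Variables (n N : nat) (F : sweep 'I_n N).
Implicit Types (a b c d : 'I_n) (t : nat).

Local Notation bef := (bef F).
Local Notation lsw := (lsw F).
Local Notation rsw := (rsw F).
Local Notation nleftT := (nleft F setT).

Definition opposite t c d : bool :=
  bef t c (lsw t) && bef t (rsw t) d || bef t d (lsw t) && bef t (rsw t) c.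

Lemma nleftE t : nleftT t = #|[set z | bef t z (lsw t)]|.
Proof. by rewrite /nleft /place; apply: eq_card => z; rewrite !inE. Qed.

Lemma card_after t : #|[set z | bef t (rsw t) z]| = n - 2 - nleftT t.
Proof.
have := place_half F t (in_setT (rsw t)).
rewrite place_rsw inE addn1 cardsT card_ord /place.
rewrite (_ : [set z in _ | _] = [set z | bef t (rsw t) z]); first by move=> ->; lia.
by apply/setP=> z; rewrite !inE bef_half.
Qed.

Lemma sum_opposite t : \sum_c \sum_d opposite t c d = 2 * (nleftT t * (n - 2 - nleftT t)).
Proof.
pose L := [set z | bef t z (lsw t)]; pose R := [set z | bef t (rsw t) z].
have dis z : z \in L -> z \in R -> False.
  rewrite !inE => zl /(bef_trans (bef_sw F t)) /(bef_trans zl).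
  by rewrite bef_irr.
have E c d : opposite t c d = (c \in L) * (d \in R) + (d \in L) * (c \in R) :> nat.
  rewrite /opposite -[bef t c _](in_set (fun z => bef t z (lsw t))) -/L.
  rewrite -[bef t d _](in_set (fun z => bef t z (lsw t))) -/L.
  rewrite -[bef t _ d](in_set (fun z => bef t (rsw t) z)) -/R.
  rewrite -[bef t _ c](in_set (fun z => bef t (rsw t) z)) -/R.
  have := dis c; have := dis d.
  by case: (c \in L); case: (d \in L); case: (c \in R); case: (d \in R) => // h h';
    exfalso; first [exact: h | exact: h'].
under eq_bigr => c _ do under eq_bigr => d _ do rewrite E.
have S (X Y : {set 'I_n}) : \sum_c \sum_d (c \in X) * (d \in Y) = #|X| * #|Y|.
  rewrite -!sum1_card !(big_mkcond (fun i => i \in _)) big_distrl; apply: eq_bigr => c _.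
  by rewrite big_distrr; apply: eq_bigr => d _; case: (c \in X); case: (d \in Y).
under eq_bigr => c _ do rewrite big_split /=.
rewrite big_split /= S exchange_big /= S addnn -mul2n.
by rewrite nleftE card_after nleftE.
Qed.

Lemma separated_sum a b c d :
  separated F a b c d = \sum_(0 <= t < N) swaps_pair F a b t && opposite t c d :> nat.
Proof.
have E t : (swaps_pair F a b t &&
    ([&& bef t c a, bef t c b, bef t a d & bef t b d] ||
     [&& bef t d a, bef t d b, bef t a c & bef t b c])) = swaps_pair F a b t && opposite t c d.
  case sw: (swaps_pair F a b t) => //=; rewrite /opposite.
  have lr z : bef t z (lsw t) -> bef t z (rsw t) by move=> h; apply: bef_trans (bef_sw F t).
  have rl z : bef t (rsw t) z -> bef t (lsw t) z by apply: bef_trans; exact: bef_sw.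
  have H z z' : [&& bef t z a, bef t z b, bef t a z' & bef t b z'] =
      bef t z (lsw t) && bef t (rsw t) z'.
    have := rl z'; have := lr z; case/orP: sw => /eqP[-> ->];
    case: (bef t z (lsw t)) => [/(_ isT)->|_]; rewrite ?andbF //=;
    by case: (bef t (rsw t) z') => [/(_ isT)->|_]; rewrite ?andbF.
  by rewrite !H.
rewrite big_mkord sum_card /separated.
case: existsP => [[t]|no].
  rewrite E => st; rewrite (_ : [set _ | _] = [set t]) ?cards1 //; apply/setP=> u; rewrite !inE.
  apply/idP/eqP => [/andP[su _]|->//]; case/andP: st => st _.
  apply/val_inj/(pair_time_uniq _ _ _ su st) => //.
  by case/orP: su => /eqP[-> ->]; rewrite 1?[rsw _ == _]eq_sym lsw_neq.
apply/esym/eqP; rewrite cards_eq0; apply/eqP/setP=> u; rewrite !inE.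
by apply/negP => h; apply: no; exists u; rewrite E.
Qed.

Definition sum_left_right := \sum_(0 <= t < N) nleftT t * (n - 2 - nleftT t).

(** Every swap separates l elements from n - 2 - l others.  Each pair of pairs is
    counted four times, according to the orders within the two pairs. *)
Lemma sum_separated : \sum_a \sum_b \sum_c \sum_d separated F a b c d = 4 * sum_left_right.
Proof.
under eq_bigr => a _ do under eq_bigr => b _ do under eq_bigr => c _ do
  (under eq_bigr => d _ do rewrite separated_sum; rewrite exchange_big /=).
under eq_bigr => a _ do under eq_bigr => b _ do rewrite exchange_big /=.
under eq_bigr => a _ do rewrite exchange_big /=.
rewrite exchange_big /= /sum_left_right big_distrr; apply: eq_bigr => t _ /=.
have P a b : \sum_c \sum_d (swaps_pair F a b t && opposite t c d) =
    swaps_pair F a b t * (2 * (nleftT t * (n - 2 - nleftT t))).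
  rewrite -sum_opposite; case: (swaps_pair F a b t); first by rewrite mul1n.
  by rewrite mul0n big1 // => c _; rewrite big1.
under eq_bigr => a _ do under eq_bigr => b _ do rewrite P.
under eq_bigr => a _ do rewrite -big_distrl /=.
rewrite -big_distrl /= (_ : \sum_a \sum_b _ = 2); first by rewrite mulnA.
have := sum_swaps_pair F setT t; rewrite /swaps_in !inE muln1 => <-.
rewrite [RHS](eq_bigl predT) => [|a]; last by rewrite inE.
apply: eq_bigr => a _; rewrite [RHS]big_mkcond /=; apply: eq_bigr => b _.
rewrite inE /=; case: (eqVneq a b) => [->|//]; rewrite /swaps_pair.
apply/eqP; rewrite eqb0; apply/negP => /orP[] /eqP[E1 E2]; move: (lsw_neq F t); by rewrite -E1 -E2 eqxx.
Qed.

Lemma separated_uniq a b c d : separated F a b c d -> uniq [:: a; b; c; d].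
Proof.
case/existsP=> t /andP[sw]; have ab : a != b.
  by case/orP: sw => /eqP[-> ->]; rewrite 1?[rsw _ == _]eq_sym lsw_neq.
have irr x y z : bef t x y -> bef t y z -> [&& x != y, y != z & x != z].
  by move=> xy yz; rewrite (bef_neq xy) (bef_neq yz) (bef_neq (bef_trans xy yz)).
rewrite /= !inE !negb_or ab /= => /orP[] /and4P[h1 h2 h3 h4];
 have := irr _ _ _ h1 h3; have := irr _ _ _ h2 h4;
 rewrite !(eq_sym c) !(eq_sym d) => /and3P[k1 k2 k3] /and3P[k4 k5 k6];
 rewrite ?(eq_sym c d) ?k1 ?k2 ?k3 ?k4 ?k5 ?k6 //;
 by rewrite 1?(eq_sym d c) ?k1 ?k2 ?k3 ?k4 ?k5 ?k6.
Qed.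

Definition ncrossings : nat :=
  #|[set q : ('I_n * 'I_n) * ('I_n * 'I_n) |
      [&& (q.1.1 < q.1.2)%N, (q.2.1 < q.2.2)%N, (q.1.1 < q.2.1)%N
        & crossing F q.1.1 q.1.2 q.2.1 q.2.2]]|.

(** An unordered pair of unordered pairs is counted eight times. *)
Lemma sum_crossing : \sum_a \sum_b \sum_c \sum_d crossing F a b c d = 8 * ncrossings.
Proof.
have ss a b : (\sum_c \sum_d crossing F a b c d) =
      2 * \sum_(c : 'I_n) \sum_(d : 'I_n | c < d) crossing F a b c d.
  apply: sum_sym_ord => [c d|c].
    by rewrite /crossing (separatedCr F a b c d) (separatedCl F c d a b).
  by apply/eqP; rewrite eqb0; apply/negP => /andP[/separated_uniq]; rewrite /= !inE eqxx !andbF.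
under eq_bigr => a _ do under eq_bigr => b _ do rewrite ss.
rewrite sum_sym_ord => [|a b|a]; last 2 first.
- congr (2 * _); apply: eq_bigr => c _; apply: eq_bigr => d _.
  by rewrite /crossing (separatedCr F c d a b) (separatedCl F a b c d).
- rewrite big1 ?muln0 // => c _; rewrite big1 // => d _.
  by apply/eqP; rewrite eqb0; apply/negP => /andP[/separated_uniq]; rewrite /= !inE eqxx.
under eq_bigr => a _ do rewrite -big_distrr /=.
rewrite -big_distrr /= mulnA.
under eq_bigr => a _ do rewrite exchange_big /=.
rewrite (sum_sym_ord (G := fun a c => \sum_(b : 'I_n | a < b) \sum_(d : 'I_n | c < d) crossing F a b c d)) => [|a c|a]; last 2 first.
- rewrite exchange_big /=; apply: eq_bigr => d _; apply: eq_bigr => b _.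
  by rewrite /crossing andbC.
- rewrite big1 // => b _; rewrite big1 // => d _.
  by apply/eqP; rewrite eqb0; apply/negP => /andP[/separated_uniq]; rewrite /= !inE eqxx !orbT.
rewrite mulnA; congr (_ * _); rewrite /ncrossings -sum1dep_card.
rewrite -(pair_big_dep xpredT (fun e f : 'I_n * 'I_n => [&& e.1 < e.2, f.1 < f.2, e.1 < f.1
    & crossing F e.1 e.2 f.1 f.2]) (fun _ _ => 1)) /=.
rewrite -(pair_bigA _ (fun a b => \sum_(f : 'I_n * 'I_n | [&& a < b, f.1 < f.2, a < f.1 & crossing F a b f.1 f.2]) 1)) /=.
apply: eq_bigr => a _; rewrite [LHS]big_mkcond /=.
transitivity (\sum_(c : 'I_n) \sum_(b : 'I_n) \sum_(d : 'I_n) ([&& a < b, c < d, a < c & crossing F a b c d] : nat)).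
  apply: eq_bigr => c _; case: ltnP => ac; last first.
    by rewrite big1 // => b _; rewrite big1 // => d _; rewrite ?andbF //= !andbF.
  rewrite big_mkcond; apply: eq_bigr => b _; case: ltnP => ab; last by rewrite big1.
  by rewrite big_mkcond; apply: eq_bigr => d _; case: ltnP.
rewrite exchange_big; apply: eq_bigr => b _ /=.
by rewrite pair_bigA /= [RHS]big_mkcond; apply: eq_bigr => f _; case: ifP.
Qed.

(** [quad_uniq] summed over all ordered quadruples of distinct elements. *)
Theorem ncrossings_sum : ncrossings + sum_left_right = 3 * 'C(n, 4).
Proof.
have Q a b c d : uniq [:: a; b; c; d] * 3 =
   (separated F a b c d + separated F c d a b + crossing F a b c d) +
  (separated F a c b d + separated F b d a c + crossing F a c b d) +
  (separated F a d b c + separated F b c a d + crossing F a d b c).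
  rewrite -/(quad F a b c d); case: (boolP (uniq _)) => u; first by rewrite quad_uniq.
  have nz x y z w : perm_eq [:: x; y; z; w] [:: a; b; c; d] -> separated F x y z w = false.
    by move=> p; apply: contraNF u => /separated_uniq; rewrite (perm_uniq p).
  rewrite /quad /crossing !nz //; apply/seq.permP => p /=; lia.
have : (\sum_(a : 'I_n) \sum_(b : 'I_n) \sum_(c : 'I_n) \sum_(d : 'I_n) uniq [:: a; b; c; d]) * 3 =
   24 * sum_left_right + 24 * ncrossings.
  rewrite big_distrl /=; under eq_bigr do rewrite big_distrl /=.
  under eq_bigr do under eq_bigr do rewrite big_distrl /=.
  under eq_bigr do under eq_bigr do under eq_bigr do rewrite big_distrl /=.
  under eq_bigr => a _ do under eq_bigr => b _ do under eq_bigr => c _ do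
    under eq_bigr => d _ do rewrite Q.
  have split6 (f g : 'I_n -> 'I_n -> 'I_n -> 'I_n -> nat) :
    \sum_a \sum_b \sum_c \sum_d (f a b c d + g a b c d) =
    \sum_a \sum_b \sum_c \sum_d f a b c d + \sum_a \sum_b \sum_c \sum_d g a b c d.
    rewrite -big_split; apply: eq_bigr => a _; rewrite -big_split; apply: eq_bigr => b _.
    by rewrite -big_split; apply: eq_bigr => c _; rewrite -big_split.
  have sw12 (f : 'I_n -> 'I_n -> 'I_n -> 'I_n -> nat) :
    \sum_a \sum_b \sum_c \sum_d f b a c d = \sum_a \sum_b \sum_c \sum_d f a b c d.
    by rewrite exchange_big.
  have sw23 (f : 'I_n -> 'I_n -> 'I_n -> 'I_n -> nat) :
    \sum_a \sum_b \sum_c \sum_d f a c b d = \sum_a \sum_b \sum_c \sum_d f a b c d.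
    by apply: eq_bigr => a _; rewrite exchange_big.
  have sw34 (f : 'I_n -> 'I_n -> 'I_n -> 'I_n -> nat) :
    \sum_a \sum_b \sum_c \sum_d f a b d c = \sum_a \sum_b \sum_c \sum_d f a b c d.
    by apply: eq_bigr => a _; apply: eq_bigr => b _; rewrite exchange_big.
  rewrite !split6.
  have rc (f : 'I_n -> 'I_n -> 'I_n -> 'I_n -> nat) :
    \sum_a \sum_b \sum_c \sum_d f a d b c = \sum_a \sum_b \sum_c \sum_d f a b c d.
    by rewrite (sw34 (fun a b c d => f a c b d)) (sw23 f).
  rewrite (sw23 (fun a b c d => separated F a b c d : nat)).
  rewrite (sw23 (fun a b c d => crossing F a b c d : nat)).
  rewrite (rc (fun a b c d => separated F a b c d : nat)).
  rewrite (rc (fun a b c d => crossing F a b c d : nat)).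
  rewrite (sw12 (fun a b c d => separated F a c b d : nat)).
  rewrite (sw23 (fun a b c d => separated F a b c d : nat)).
  rewrite (sw12 (fun a b c d => separated F a d b c : nat)).
  rewrite (rc (fun a b c d => separated F a b c d : nat)).
  rewrite (sw23 (fun a b c d => separated F b d a c : nat)).
  rewrite (sw12 (fun a b c d => separated F a d b c : nat)).
  rewrite (rc (fun a b c d => separated F a b c d : nat)).
  rewrite sum_separated sum_crossing; lia.
rewrite card_uniq4 card_ord; have <- : n ^_ 4 = n * (n - 1) * (n - 2) * (n - 3).
  by rewrite !ffactnS ffactn0 muln1 -!subn1 -!subnDA !mulnA.
by rewrite -bin_ffact (_ : 4`! = 24) //; lia.
Qed.

End CrossingNumber.

(** * Bounds for every sweep *)

(** Critical swaps for [kmax n] are all swaps but the halving ones. *)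
Definition kmax (n : nat) : nat := n./2.-1.

(** Let h be the number of halving swaps, c the bound on the critical swaps for
    [kmax n] - 1, and E <= N - h - c the number of swaps at the border of the middle.
    If [central_bound] applies then h <= (K - 1) (N - h - c), whence the
    first term; otherwise E is at most n - 2 and the second term is the one of
    [central_bound_weak]. *)
Definition halving_bound (n : nat) : nat :=
  let K := n - 2 * kmax n in
  maxn ((K - 1) * ('C(n, 2) - critical_bound n (kmax n).-1) %/ K)
       ((K - 1) * (n - 2) + 'C(K, 2)).

(** The value of 3 'C(n, 4) minus the sum of l (n - 2 - l) over all swaps, when the
    numbers of critical swaps are replaced by their lower bounds. *)
Definition crossing_bound (n : nat) : nat :=
  3 * 'C(n, 4) + sumn [seq (n - 1 - 2 * k) * critical_bound n k | k <- iota 1 (kmax n - 1)]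
  + (n - 1 - 2 * kmax n) * ('C(n, 2) - halving_bound n)
  - 'C(n, 2) * sumn [seq n - 1 - 2 * k | k <- iota 1 (kmax n)].

Lemma crossing_boundE n : crossing_bound n =
  3 * 'C(n, 4) + \sum_(1 <= k < kmax n) (n - 1 - 2 * k) * critical_bound n k
  + (n - 1 - 2 * kmax n) * ('C(n, 2) - halving_bound n)
  - 'C(n, 2) * \sum_(1 <= k < (kmax n).+1) (n - 1 - 2 * k).
Proof. by rewrite /crossing_bound !sumnE !big_map /index_iota !subn1. Qed.

Section Bounds.
Variables (n : nat) (F : sweep 'I_n 'C(n, 2)).
Hypothesis n4 : 3 < n.

Local Notation nleftT := (nleft F setT).
Local Notation ncrit := (ncritical F setT).

Definition nhalving : nat :=
  count_times (fun t => ((nleftT t).+1 == n./2) || ((nleftT t).+1 == n - n./2)) 0 'C(n, 2).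

Lemma nhalving_ncritical : nhalving + ncrit (kmax n) = 'C(n, 2).
Proof.
rewrite /nhalving /ncritical /count_times -big_split /= -[RHS]subn0 -[RHS]muln1 -sum_nat_const_nat.
apply: eq_bigr => t _; have := nleft_maxT F t.
rewrite /critical_in /swaps_in !inE cardsT card_ord /kmax /=; move: n4; clear.
move: (nleftT t) => l; lia.
Qed.

Theorem nhalving_bound : nhalving <= halving_bound n.
Proof.
have kn : 2 * (kmax n) < #|'I_n| by rewrite card_ord /kmax; lia.
have k0 : 0 < kmax n by rewrite /kmax; lia.
have H := nhalving_ncritical.
have B := @critical_lower_bound _ _ F setT (kmax n).-1.
rewrite cardsT card_ord in B; have {}B := B (ltac:(rewrite /kmax; lia)).
rewrite /halving_bound; set K := n - 2 * kmax n; have K2 : 1 < K by rewrite /K /kmax; lia.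
have := @central_bound _ _ F _ k0 kn; have := @central_bound_weak _ _ F _ k0 kn.
rewrite card_ord -/K.
have -> : 'C(n, 2) - ncrit (kmax n) = nhalving by lia.
have mono : ncrit (kmax n).-1 <= ncrit (kmax n) by rewrite -(@count_border _ _ F _ k0 kn) leq_addl.
case: (leqP n.-1 (ncrit (kmax n) - ncrit (kmax n).-1)) => E W S; rewrite leq_max; apply/orP.
  left; rewrite leq_divRL; last by lia.
  have {}S := S isT.
  move: (critical_bound _ _) (ncrit (kmax n)) (ncrit (kmax n).-1) nhalving B H mono S {E W}.
  move: 'C(n, 2) K K2 => N c c2 b x y h B H mono S.
  have : h + (c - 1) * h <= (c - 1) * (x - y) + (c - 1) * h by rewrite leq_add2r.
  rewrite -mulnDr => S'; have : (c - 1) * (x - y + h) <= (c - 1) * (N - b).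
    by rewrite leq_mul2l; lia.
  by move=> S''; have := leq_trans S' S''; rewrite -mulSn mulnC; have -> : (c - 1).+1 = c by lia.
right; apply: leq_trans W _; rewrite leq_add2r leq_mul2l; lia.
Qed.

(** Partial summation: l (n - 2 - l) is the sum of n - 1 - 2 k over 1 <= k <= l for
    l on the short side, and the swap is critical for the remaining k. *)
Lemma left_right_sum l : l.+2 <= n ->
  l * (n - 2 - l) + \sum_(1 <= k < (kmax n).+1) (n - 1 - 2 * k) * ((l < k) || (n - 2 - l < k))
  = \sum_(1 <= k < (kmax n).+1) (n - 1 - 2 * k).
Proof.
wlog ll : l / l <= n - 2 - l => [W|] ln.
  case: (leqP l (n - 2 - l)) => h; first exact: W.
  have E : n - 2 - (n - 2 - l) = l by lia.
  have := W (n - 2 - l); rewrite E => /(_ _ _) <-; try lia.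
  by rewrite mulnC; congr (_ + _); apply: eq_bigr => k _; rewrite orbC.
have lk : l <= kmax n by rewrite /kmax; lia.
rewrite (eq_big_nat _ _ (F2 := fun k => (n - 1 - 2 * k) * (l < k))); last first.
  by move=> k _; congr (_ * _); lia.
have P m : m <= l -> m * (n - 2 - m) = \sum_(1 <= k < m.+1) (n - 1 - 2 * k).
  elim: m => [|m IH] ml; first by rewrite mul0n big_geq.
  rewrite big_nat_recr // -IH /=; last by lia.
  have [r nE] : exists r, n = 2 * m + 4 + r by exists (n - (2 * m + 4)); lia.
  have -> : n - 2 - m.+1 = m + 1 + r by lia.
  have -> : n - 2 - m = m + 2 + r by lia.
  have -> : n - 1 - 2 * m.+1 = r + 1 by lia.
  lia.
rewrite [in RHS](big_cat_nat (n := l.+1)) //= (P l) //; congr (_ + _).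
rewrite (big_cat_nat (n := l.+1)) //= big_nat big1 => [|k kl]; last first.
  by rewrite (_ : l < k = false) ?muln0 //; lia.
rewrite add0n [LHS]big_nat [RHS]big_nat; apply: eq_bigr => k /andP[lk' _].
by rewrite lk' muln1.
Qed.

Lemma sum_left_right_ncritical :
  sum_left_right F + \sum_(1 <= k < (kmax n).+1) (n - 1 - 2 * k) * ncrit k
  = 'C(n, 2) * \sum_(1 <= k < (kmax n).+1) (n - 1 - 2 * k).
Proof.
rewrite /sum_left_right /ncritical /count_times.
under [X in _ + X]eq_bigr do rewrite big_distrr /=.
rewrite exchange_big -big_split /= -[X in X * _]subn0 -sum_nat_const_nat.
apply: eq_bigr => t _; have := nleft_maxT F t; rewrite card_ord => nt.
rewrite -(left_right_sum nt); congr (_ + _); apply: eq_bigr => k _.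
by rewrite /critical_in /swaps_in !inE cardsT card_ord.
Qed.

Theorem ncrossings_bound : crossing_bound n <= ncrossings F.
Proof.
rewrite crossing_boundE leq_subLR -(ncrossings_sum F).
have := sum_left_right_ncritical; have := nhalving_ncritical; have := nhalving_bound.
have kk : 1 <= kmax n by rewrite /kmax; lia.
rewrite !big_nat_recr //=.
set w := n - 1 - 2 * kmax n.
have : \sum_(1 <= k < kmax n) (n - 1 - 2 * k) * critical_bound n k <=
       \sum_(1 <= k < kmax n) (n - 1 - 2 * k) * ncrit k.
  rewrite big_nat [X in _ <= X]big_nat; apply: leq_sum => k kk'; rewrite leq_mul2l; apply/orP; right.
  have := @critical_lower_bound _ _ F setT k; rewrite cardsT card_ord; apply.
  move: kk'; rewrite /kmax; lia.
move=> S1 Hb Hn E.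
have : w * ('C(n, 2) - halving_bound n) <= w * ncrit (kmax n).
  by rewrite leq_mul2l; apply/orP; right; lia.
move: E S1; rewrite mulnDr.
move: (\sum_(_ <= _ < _) _ * critical_bound _ _) (\sum_(_ <= _ < _) _ * ncrit _) => s1 s2.
move: (\sum_(_ <= _ < _) _) => s3; lia.
Qed.

End Bounds.

(** * Allowable sequences are sweeps *)
Import GRing.Theory.

Lemma tperm_eq (T : finType) (a b l r : T) : l != r ->
  ((a != b) && (tperm l r == tperm a b)) = ((a, b) == (l, r)) || ((a, b) == (r, l)).
Proof.
move=> lr; rewrite !xpair_eqE; apply/andP/orP => [[ab /eqP E]|[] /andP[/eqP-> /eqP->]].
- have := congr1 (fun s : {perm T} => s a) E; rewrite /= tpermL.
  case: tpermP => [->|->|_ _ aE]; last by rewrite aE eqxx in ab.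
    by move=> ->; rewrite !eqxx; left.
  by move=> ->; rewrite !eqxx; right.
- by [].
by rewrite tpermC eq_sym.
Qed.

Section Represents.
Variables (n : nat) (F : sweep 'I_n 'C(n, 2)) (Pi : int -> 'S_n).

(** At nonnegative times the sweep orders the elements by their positions in Pi. *)
Definition represents : Prop := forall (t : nat) x y,
  bef F t x y = (((Pi (Posz t))^-1)%g x < ((Pi (Posz t))^-1)%g y).

Hypothesis rep : represents.
Implicit Types (t : nat) (x y a b c d : 'I_n).

Local Notation lsw := (lsw F).
Local Notation rsw := (rsw F).
Local Notation nleftT := (nleft F [set: 'I_n]).

Lemma represents_place t x : place F [set: 'I_n] t x = ((Pi (Posz t))^-1)%g x.
Proof.
rewrite /place; set q := ((Pi (Posz t))^-1)%g.
rewrite (_ : [set z in _ | _] = q @^-1: [set i : 'I_n | i < q x]); last first.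
  by apply/setP=> z; rewrite !inE rep.
rewrite card_preimset; last exact: perm_inj.
have le : q x <= n by apply: ltnW.
by rewrite -sum1dep_card -(big_ord_widen _ (fun=> 1) le) sum1_card card_ord.
Qed.

Lemma represents_step t : Pi ((Posz t) + 1)%R = (Pi (Posz t) * tperm (lsw t) (rsw t))%g.
Proof.
have -> : ((Posz t) + 1)%R = Posz t.+1 by rewrite -addn1 PoszD.
apply: invg_inj; apply/permP=> x; apply: ord_inj.
rewrite -represents_place invMg tpermV permM -represents_place.
case: tpermP => [->|->|/eqP xl /eqP xr].
- by rewrite placeS_lsw place_rsw !inE.
- by rewrite placeS_rsw.
exact: placeS_neq.
Qed.

Lemma represents_swaps t a b : swaps Pi (Posz t) a b = swaps_pair F a b t.
Proof.
rewrite /swaps represents_step (inj_eq (mulgI _)) tperm_eq //; exact: lsw_neq.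
Qed.

Lemma represents_transposition t k : transposition_at Pi (Posz t) k = ((nleftT t).+1 == k).
Proof.
have lr := lsw_neq F t; set q := (Pi (Posz t))^-1%g.
have E : Pi ((Posz t) + 1)%R = (tperm (q (lsw t)) (q (rsw t)) * Pi (Posz t))%g.
  by rewrite represents_step /q -tpermJ /conjg invgK !mulgA mulgKV.
have ql : q (lsw t) = nleftT t :> nat by rewrite -represents_place.
have qr : q (rsw t) = (nleftT t).+1 :> nat by rewrite -represents_place place_rswT.
have qlr : q (lsw t) != q (rsw t) by rewrite (inj_eq perm_inj).
rewrite /transposition_at E; apply/existsP/eqP => [[u /existsP[v]]|<-].
  case/and3P=> /eqP uk /eqP vk; rewrite (inj_eq (mulIg _)) => tE.
  have uv : u != v by apply/eqP => uv; move: uk; rewrite uv vk => /eqP; rewrite eqn_leq ltnn.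
  have := tperm_eq u v qlr; rewrite uv tE => /esym/orP[] /eqP[uE vE].
    by rewrite -uk uE ql.
  by move: uk; rewrite uE -vk vE ql qr => /eqP; rewrite gtn_eqF.
exists (q (lsw t)); apply/existsP; exists (q (rsw t)).
by rewrite ql qr !eqxx.
Qed.

Lemma represents_E k :
  E_ Pi k = count_times (fun t => ((nleftT t).+1 == k.+1) || ((nleftT t).+1 == n - k.+1)) 0 'C(n, 2).
Proof.
rewrite /E_ /count_times big_mkord sum_card; apply: eq_card => t.
by rewrite !inE /critical !represents_transposition.
Qed.

Lemma represents_h : 1 < n -> h_seq Pi = nhalving F.
Proof. by move=> n1; rewrite /h_seq represents_E /nhalving prednK //; case: n n1 => [|[]]. Qed.

Lemma represents_before t c a : before Pi (Posz t) c a = bef F t c a.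
Proof. by rewrite /before rep. Qed.

Lemma represents_separates a b c d : separates Pi a b c d = separated F a b c d.
Proof.
by apply: eq_existsb => t; rewrite /= represents_swaps !represents_before.
Qed.

Lemma represents_cr : cr_seq Pi = ncrossings F.
Proof.
rewrite /cr_seq /nb_segment_pairs; apply: eq_card => q.
by rewrite !inE /pseudosegments_cross !represents_separates.
Qed.

End Represents.

Lemma allowable_sweep n (Pi : int -> 'S_n) : allowable Pi ->
  exists F : sweep 'I_n 'C(n, 2), represents F Pi.
Proof.
case=> step half.
have /choice [uv uvP] : forall t : nat, exists uv : 'I_n * 'I_n,
    uv.2 = uv.1.+1 :> nat /\ Pi ((Posz t) + 1)%R = (tperm uv.1 uv.2 * Pi (Posz t))%g.
  move=> t; have [k /existsP[u /existsP[v /and3P[/eqP uk /eqP vk /eqP E]]]] := step (Posz t).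
  by exists (u, v); rewrite vk uk.
pose bef (t : nat) : rel 'I_n := fun x y => ((Pi (Posz t))^-1)%g x < ((Pi (Posz t))^-1)%g y.
pose l (t : nat) := Pi (Posz t) (uv t).1; pose r (t : nat) := Pi (Posz t) (uv t).2.
have irr t x : bef t x x = false by rewrite /bef ltnn.
have trans t : transitive (bef t) by move=> y x z; exact: ltn_trans.
have total t x y : x != y -> bef t x y || bef t y x.
  by move=> xy; rewrite /bef -neq_ltn (inj_eq val_inj) (inj_eq perm_inj).
have bhalf t x y : bef (t + 'C(n, 2)) x y = bef t y x.
  have E z : ((Pi (Posz (t + 'C(n, 2))))^-1)%g z = rev_ord (((Pi (Posz t))^-1)%g z).
    apply: (@perm_inj _ (Pi (Posz (t + 'C(n, 2))))); rewrite permKV PoszD half rev_ordK permKV.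
    by [].
  rewrite /bef !E /=; move: (((Pi (Posz t))^-1)%g x) (((Pi (Posz t))^-1)%g y) => [i li] [j lj] /=; lia.
have sw t : bef t (l t) (r t) by rewrite /bef /l /r !permK; have [-> _] := uvP t.
have bstep t x y : bef t.+1 x y =
    bef t x y (+) (((x, y) == (l t, r t)) || ((x, y) == (r t, l t))).
  have [vE E] := uvP t.
  have q' z : ((Pi (Posz t.+1))^-1)%g z = tperm (uv t).1 (uv t).2 (((Pi (Posz t))^-1)%g z).
    by rewrite -addn1 PoszD E invMg permM tpermV.
  rewrite /bef !q' !xpair_eqE /l /r.
  have eqq z w : (z == Pi (Posz t) w) = (((Pi (Posz t))^-1)%g z == w).
    by apply/eqP/eqP => [->|<-]; rewrite ?permK ?permKV.
  rewrite !eqq; move: (((Pi (Posz t))^-1)%g x) (((Pi (Posz t))^-1)%g y) => i j.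
  move: (uv t) vE => [u v] /= vE; rewrite !permE /= -!(inj_eq val_inj) /=.
  case: (eqVneq (i : nat) u) => iu; case: (eqVneq (j : nat) u) => ju;
  case: (eqVneq (i : nat) v) => iv; case: (eqVneq (j : nat) v) => jv /=; lia.
have hp : 'C(n, 2) = 'C(#|'I_n|, 2) by rewrite card_ord.
by exists (Sweep irr trans total bhalf sw bstep hp).
Qed.

(** Positions at negative times are obtained from the period 2 N. *)
Lemma sweep_allowable n (F : sweep 'I_n 'C(n, 2)) : 1 < n ->
  exists2 Pi : int -> 'S_n, allowable Pi & represents F Pi.
Proof.
move=> n1; have pl t x : place F [set: 'I_n] t x < n.
  by have := @place_max _ _ F setT t x (in_setT _); rewrite cardsT card_ord.
have qinj t : injective (fun x => Ordinal (pl t x)).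
  by move=> x y /(congr1 val) /= /(@place_inj _ _ F setT t x y (in_setT _) (in_setT _)).
pose q t := perm (@qinj t).
set N := 'C(n, 2) in F pl qinj q *.
have N0 : 0 < N by rewrite /N bin_gt0.
pose ph (j : int) : nat := absz (j %% (N + N)%N%:Z)%Z.
have qE t x : q t x = place F [set: 'I_n] t x :> nat by rewrite permE.
have qper t : q (t + N + N) = q t.
  by apply/permP=> x; apply: ord_inj; rewrite !qE; apply: eq_card => z; rewrite !inE !bef_half.
have qper' t m : q (t + m * (N + N)) = q t.
  elim: m => [|m IH]; first by rewrite mul0n addn0.
  by rewrite mulSnr !addnA qper.
have qhalf t x : q (t + N) x = rev_ord (q t x).
  apply: ord_inj; rewrite /= !qE place_half // cardsT card_ord; have := pl t x; lia.
have phE (j : int) (m t : nat) : (j + m%:Z * (N + N)%N%:Z)%R = Posz t -> q (ph j) = q t.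
  move=> jt; have E : (t %% (N + N))%N = ph j.
    by rewrite /ph -(modzMDl m%:Z) addrC jt modz_nat absz_nat.
  by rewrite -E [in RHS](divn_eq t (N + N)) addnC qper'.
have shift (j : int) : exists (m t : nat), (j + m%:Z * (N + N)%N%:Z)%R = Posz t.
  exists (absz j), (absz (j + (absz j)%:Z * (N + N)%N%:Z)%R).
  by apply/esym/gez0_abs; nia.
have qS t : q t.+1 = (tperm (lsw F t) (rsw F t) * q t)%g.
  apply/permP=> x; apply: ord_inj; rewrite permM !qE.
  case: tpermP => [->|->|/eqP xl /eqP xr].
  - by rewrite placeS_lsw place_rsw !inE.
  - by rewrite placeS_rsw.
  exact: placeS_neq.
exists (fun j => ((q (ph j))^-1)%g).
  split=> [j|j i].
    have [m [t jt]] := shift j; have jt1 : (j + 1 + m%:Z * (N + N)%N%:Z)%R = Posz t.+1.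
      by rewrite addrAC jt -addn1 PoszD.
    exists (nleft F [set: 'I_n] t).+1; apply/existsP; exists (q t (lsw F t)).
    apply/existsP; exists (q t (rsw F t)).
    rewrite (phE _ _ _ jt) (phE _ _ _ jt1) !qE place_rswT !eqxx /= qS invMg tpermV.
    by rewrite -tpermJ /conjg !mulgA mulgK.
  have [m [t jt]] := shift j; have jtN : (j + N%:Z + m%:Z * (N + N)%N%:Z)%R = Posz (t + N).
    by rewrite addrAC jt PoszD.
  rewrite (phE _ _ _ jt) (phE _ _ _ jtN).
  by apply: (@perm_inj _ (q (t + N))); rewrite permKV qhalf permKV rev_ordK.
move=> t x y; rewrite (phE (Posz t) 0 t) ?mul0r ?addr0 // invgK !qE.
by rewrite -(bef_place F t) ?inE.
Qed.

(** * Point sets are sweeps *)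
From mathcomp Require Import ring lra.
Import Order.TTheory GRing.Theory Num.Theory.

Section Planar.
Local Open Scope ring_scope.
Variable R : realType.
Implicit Types (a b c d x : R * R).

Lemma orient_swap a b c : orient b a c = - orient a b c.
Proof. by rewrite /orient; ring. Qed.

Lemma orient_left a b : orient a b a = 0.
Proof. by rewrite /orient; ring. Qed.

Lemma orient_right a b : orient a b b = 0.
Proof. by rewrite /orient; ring. Qed.

(** If the endpoints lie on opposite sides both ways, the parameters of the common
    point are A / (A - B), with A and B the two orientations of the endpoints. *)
Lemma segments_crossP a b c d : orient a b c != 0 -> orient a b d != 0 ->
  orient c d a != 0 -> orient c d b != 0 ->
  segments_cross a b c d <->
  ((orient a b c < 0) != (orient a b d < 0)) /\ ((orient c d a < 0) != (orient c d b < 0)).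
Proof.
have opp (A B s : R) : 0 < s -> s < 1 -> (1 - s) * A + s * B = 0 -> A != 0 -> (A < 0) != (B < 0).
  move=> s0 s1 E A0; have s1' : 0 < 1 - s by rewrite subr_gt0.
  have : (1 - s) * A = - (s * B) by lra.
  case: (ltgtP A 0) A0 => // hA _; case: (ltgtP B 0) => hB //= E'.
  - have : (1 - s) * A < 0 by rewrite pmulr_rlt0.
    by rewrite E' oppr_lt0 pmulr_rgt0 // ltNge (ltW hB).
  - have : 0 < (1 - s) * A by rewrite pmulr_rgt0.
    by rewrite E' oppr_gt0 pmulr_rlt0 // ltNge (ltW hB).
  - have : 0 < (1 - s) * A by rewrite pmulr_rgt0.
    by rewrite E' hB mulr0 oppr0 ltxx.
move=> abc abd cda cdb; split.
  case=> x [[t [t0 t1 xt]] [s [s0 s1 xs]]]; split.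
    apply: (opp _ _ s) => //.
    transitivity (orient a b x); first by rewrite xs /orient /=; ring.
    by rewrite xt /orient /=; ring.
  apply: (opp _ _ t) => //.
  transitivity (orient c d x); first by rewrite xt /orient /=; ring.
  by rewrite xs /orient /=; ring.
case=> h1 h2.
have frac (A B : R) : A != 0 -> B != 0 -> (A < 0) != (B < 0) ->
    [/\ A - B != 0, 0 < A / (A - B) & A / (A - B) < 1].
  move=> A0 B0; case: (ltgtP A 0) A0 => // hA _; case: (ltgtP B 0) B0 => // hB _ _.
    have D : A - B < 0 by lra.
    split; [exact: ltr0_neq0 | by rewrite nmulr_rgt0 ?invr_lt0 | ].
    by rewrite ltr_ndivrMr // mul1r; lra.
  have D : 0 < A - B by lra.
  split; [exact: lt0r_neq0 | by rewrite divr_gt0 | ].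
  by rewrite ltr_pdivrMr // mul1r; lra.
have [D1 s0 s1] := frac _ _ abc abd h1; have [D2 t0 t1] := frac _ _ cda cdb h2.
move: s0 s1 t0 t1; set s := orient a b c / _; set t := orient c d a / _ => s0 s1 t0 t1.
(* Both differences are, up to sign, the determinant of the two directions. *)
have DE : orient c d a - orient c d b = - (orient a b c - orient a b d) by rewrite /orient; ring.
exists ((1 - t) * a.1 + t * b.1, (1 - t) * a.2 + t * b.2); split; first by exists t.
exists s; split=> //.
have D3 := D1; rewrite /t /s DE; move: D3; rewrite /orient => D3.
by congr (_, _); field.
Qed.

Lemma segments_share a b d : orient a b d != 0 -> ~ segments_cross a b b d /\ ~ segments_cross a b d b.
Proof.
move=> abd; suff H : forall s t : R, 0 < s -> (1 - t) * a.1 + t * b.1 = (1 - s) * b.1 + s * d.1 ->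
    (1 - t) * a.2 + t * b.2 = (1 - s) * b.2 + s * d.2 -> orient a b d = 0.
  split; case=> x [[t [t0 t1 ->]] [s [s0 s1 [E1 E2]]]]; move/eqP: abd; apply.
    exact: (H s t).
  apply: (H (1 - s) t); first by rewrite subr_gt0.
    by rewrite E1; ring.
  by rewrite E2; ring.
move=> s t s0 E1 E2; apply: (mulfI (lt0r_neq0 s0)); rewrite mulr0.
transitivity ((b.1 - a.1) * ((1 - s) * b.2 + s * d.2 - a.2) -
   (b.2 - a.2) * ((1 - s) * b.1 + s * d.1 - a.1)); first by rewrite /orient; ring.
by rewrite -E1 -E2; ring.
Qed.

End Planar.

(** As a function of r < N, the quotient (t + N - 1 - r) / N is nonincreasing and takes
    at most two consecutive values, so its parity at a middle argument cannot
    differ from two equal parities at the outer ones. *)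
Lemma odd_div_between (N t a b c : nat) : (0 < N)%N -> (a < N)%N -> (c < N)%N ->
  (a < b < c)%N || (c < b < a)%N ->
  odd ((t + (N.-1 - a)) %/ N) = odd ((t + (N.-1 - c)) %/ N) ->
  odd ((t + (N.-1 - b)) %/ N) = odd ((t + (N.-1 - a)) %/ N).
Proof.
move=> N0; wlog ac : a c / (a < c)%N => [W|] aN cN abc E.
  case: (ltngtP a c) => h; first exact: (W a c h aN cN abc E).
    by rewrite E; apply: (W c a h cN aN _ (esym E)); rewrite orbC.
  by move: abc; rewrite h; case: ltngtP.
have par A B C : (A <= B <= C)%N -> (C <= A.+1)%N -> odd A = odd C -> odd B = odd A.
  case/andP=> AB BC; rewrite leq_eqVlt ltnS => /predU1P[->|CA]; first by rewrite /=; case: (odd A).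
  by move=> _; congr odd; apply/eqP; rewrite eqn_leq AB (leq_trans BC CA).
have /andP[ab bc] : (a < b < c)%N by case/orP: abc => // /andP[cb /(ltn_trans cb)]; case: ltngtP ac.
rewrite E; apply: (par _ _ ((t + (N.-1 - a)) %/ N)%N); last by rewrite E.
  by rewrite !leq_div2r // leq_add2l leq_sub2l // ltnW.
apply: (@leq_trans ((t + (N.-1 - c) + N) %/ N)); last by rewrite divnDr ?dvdnn // divnn N0 addn1.
apply: leq_div2r; rewrite -addnA leq_add2l (leq_trans (leq_subr _ _)) //.
by rewrite (leq_trans (leq_pred N)) // leq_addl.
Qed.

Lemma odd_divS (N t r : nat) : (r < N)%N ->
  odd ((t.+1 + (N.-1 - r)) %/ N) = odd ((t + (N.-1 - r)) %/ N) (+) (t %% N == r)%N.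
Proof.
move=> rN; have N0 : (0 < N)%N by case: N rN.
have sN : (t %% N < N)%N by rewrite ltn_mod.
rewrite {1 2}(divn_eq t N); move: (t %/ N)%N (t %% N)%N sN => q s sN.
have D m : (m < N)%N -> ((q * N + m) %/ N = q)%N.
  by move=> mN; rewrite divnMDl // divn_small // addn0.
have D' m : (N <= m)%N -> (m < N + N)%N -> ((q * N + m) %/ N = q.+1)%N.
  move=> h1 h2; rewrite divnMDl // -(subnK h1) divnDr ?dvdnn // divnn N0 divn_small ?addn1 //.
  by rewrite ltn_subLR.
rewrite -!addnS -!addnA; case: (ltngtP s r) => h.
- by rewrite !D ?addbF //; clear -h sN rN; lia.
- by rewrite !D' ?addbF //; clear -h sN rN; lia.
have -> : (s + (N.-1 - r) = N.-1)%N by clear -h rN; lia.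
have -> : (s.+1 + (N.-1 - r) = N)%N by clear -h rN; lia.
rewrite (D N.-1) ?ltn_predL // (D' N) //=; first by case: (odd q).
by rewrite -{1}[N]addn0 ltn_add2l.
Qed.

Section PointSet.
Local Open Scope ring_scope.
Variables (R : realType) (n : nat) (p : 'I_n -> R * R).
Hypotheses (n1 : (1 < n)%N) (gp : general_position p).
Implicit Types (x y z : 'I_n) (e f : 'I_n * 'I_n) (t : nat).

Local Notation N := 'C(n, 2).

(** The order before the sweep begins; points with equal first coordinates are
    ordered by the second one, as for a direction turned slightly from the
    horizontal. *)
Definition leftof x y : bool :=
  ((p x).1 < (p y).1) || (((p x).1 == (p y).1) && ((p x).2 < (p y).2)).

Lemma leftof_irr x : leftof x x = false.
Proof. by rewrite /leftof !ltxx andbF. Qed.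

Lemma leftof_asym x y : leftof x y -> leftof y x = false.
Proof.
rewrite /leftof; case: (ltgtP (p x).1 (p y).1) => //= h h'.
by rewrite ltNge (ltW h').
Qed.

Lemma leftof_total x y : x != y -> leftof x y || leftof y x.
Proof.
move=> xy; rewrite /leftof; case: (ltgtP (p x).1 (p y).1) => //= h1.
case: (ltgtP (p x).2 (p y).2) => //= h2; case/eqP: xy; apply: gp.1.
by rewrite [LHS]surjective_pairing h1 h2 -surjective_pairing.
Qed.

Lemma leftof_trans : transitive leftof.
Proof.
move=> y x z; rewrite /leftof => /orP[h1|/andP[/eqP-> h1]] /orP[h2|/andP[/eqP<- h2]].
- by rewrite (lt_trans h1 h2).
- by rewrite h1.
- by rewrite h2.
by rewrite eqxx (lt_trans h1 h2) orbT.
Qed.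

Definition dir e : R * R := ((p e.2).1 - (p e.1).1, (p e.2).2 - (p e.1).2).
Definition turn (u v : R * R) : R := u.1 * v.2 - u.2 * v.1.

(** Pairs are exchanged in the order of their slopes, vertical ones last.  Parallel
    pairs are disjoint in general position, hence their order is arbitrary and
    is settled by the enumeration. *)
Definition key e : (bool *l (R *l 'I_#|{: 'I_n * 'I_n}|))%type :=
  ((dir e).1 == 0, ((dir e).2 / (dir e).1, enum_rank e)).

Lemma dir_leftof e : leftof e.1 e.2 -> 0 < (dir e).1 \/ (dir e).1 = 0 /\ 0 < (dir e).2.
Proof.
rewrite /leftof /dir /= => /orP[h|/andP[/eqP-> h]]; [left|right]; rewrite ?subrr ?subr_gt0 //.
Qed.

(** The slopes of two non-parallel pairs compare as the two vectors turn. *)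
Lemma key_turn e f : leftof e.1 e.2 -> leftof f.1 f.2 -> turn (dir e) (dir f) != 0 ->
  (key e < key f)%O = (0 < turn (dir e) (dir f)).
Proof.
move=> /dir_leftof he /dir_leftof hf; rewrite /turn /key.
move: (dir e) (dir f) (enum_rank e) (enum_rank f) he hf => [u1 u2] [v1 v2] i j /= he hf.
rewrite ltEprodlexi /= ltEprodlexi /=.
case: he => [e1|[-> e2]]; case: hf => [f1|[-> f2]].
- rewrite (gt_eqF e1) (gt_eqF f1) /= => T0.
  have -> : (u2 / u1 <= v2 / v1) = (0 <= u1 * v2 - u2 * v1).
    by rewrite ler_pdivrMr // mulrAC ler_pdivlMr // subr_ge0 [v2 * _]mulrC.
  have -> : (v2 / v1 <= u2 / u1) = (u1 * v2 - u2 * v1 <= 0).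
    by rewrite ler_pdivrMr // mulrAC ler_pdivlMr // subr_le0 [v2 * _]mulrC.
  move: T0; case: (ltgtP 0 (u1 * v2 - u2 * v1)) => //=.
- by rewrite eqxx (gt_eqF e1) /= mulr0 subr0 mulr_gt0.
- rewrite eqxx (gt_eqF f1) /= mul0r sub0r oppr_gt0 => _; apply/esym/negbTE.
  by rewrite -leNgt ltW // mulr_gt0.
by rewrite mul0r mulr0 subrr eqxx.
Qed.

Lemma key_inj : injective key.
Proof. by move=> e f [_ _ /enum_rank_inj]. Qed.

Definition left_pairs : {set 'I_n * 'I_n} := [set e | leftof e.1 e.2].

Definition rank e : nat := #|[set f in left_pairs | (key f < key e)%O]|.

Lemma sum_leftof (G : 'I_n -> 'I_n -> nat) : (forall i j, G i j = G j i) ->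
  \sum_(e in left_pairs) G e.1 e.2 = \sum_(i : 'I_n) \sum_(j : 'I_n | (i < j)%N) G i j.
Proof.
move=> Gs; rewrite pair_big_dep /=.
rewrite (bigID (fun e : 'I_n * 'I_n => (e.1 < e.2)%N)) /=.
rewrite [RHS](bigID (fun e : 'I_n * 'I_n => leftof e.1 e.2)) /=; congr (_ + _)%N.
  by apply: eq_bigl => e; rewrite inE andbC.
have sK : involutive (fun e : 'I_n * 'I_n => (e.2, e.1)) by case.
rewrite (reindex_inj (inv_inj sK)) /=.
apply: eq_big => [[x y]|[x y] _]; last exact: Gs.
rewrite inE /= -leqNgt; case: (eqVneq x y) => [->|xy]; first by rewrite leftof_irr ltnn.
rewrite (leqNgt x) -leqNgt andbC.
have -> : (x <= y)%N = (x < y)%N by rewrite ltn_neqAle xy.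
case: (x < y)%N => //=; apply/idP/idP => [/leftof_asym ->//|nl].
by move: (leftof_total xy); rewrite (negbTE nl).
Qed.

Lemma card_left_pairs : #|left_pairs| = N.
Proof.
have := @sum_leftof (fun _ _ => 1%N) (fun _ _ => erefl).
rewrite sum1_card => ->; have := @sum_sym_ord n (fun i j => i != j).
move=> /(_ _ _) H.
have {}H : (\sum_(i < n) \sum_(j < n) (i != j) =
   2 * \sum_(i : 'I_n) \sum_(j : 'I_n | (i < j)%N) (i != j))%N.
  by apply: H => [i j|i]; rewrite ?eqxx // eq_sym.
have : (\sum_(i < n) \sum_(j < n) (i != j) = n * n.-1)%N.
  rewrite (eq_bigr (fun=> n.-1)) ?sum_nat_const ?card_ord // => i _.
  rewrite sum_card -[in RHS](card_ord n) -(cardC1 i); apply: eq_card => j.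
  by rewrite !inE eq_sym.
rewrite H (eq_bigr (fun i : 'I_n => (\sum_(j : 'I_n | (i < j)%N) 1)%N)); last first.
  by move=> i _; apply: eq_bigr => j ij; rewrite -(inj_eq val_inj) ltn_eqF.
move=> E; rewrite bin2 -E mul2n doubleK //.
Qed.

Lemma rank_lt e f : e \in left_pairs -> (key e < key f)%O -> (rank e < rank f)%N.
Proof.
move=> eP ef; apply: proper_card; apply/properP; split.
  by apply/subsetP=> g; rewrite !inE => /andP[-> /= /lt_trans]; exact.
by exists e; rewrite !inE -?/(leftof _ _) ?ltxx ?andbF // ef andbT; move: eP; rewrite inE.
Qed.

Lemma rank_key e f : e \in left_pairs -> f \in left_pairs ->
  (rank e < rank f)%N = (key e < key f)%O.
Proof.
move=> eP fP; apply/idP/idP => [|]; last exact: rank_lt.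
case: (ltgtP (key e) (key f)) => // [/(rank_lt fP)/ltnW|/key_inj ->]; last by rewrite ltnn.
by rewrite leqNgt => /negbTE ->.
Qed.

Lemma rank_inj : {in left_pairs &, injective rank}.
Proof.
move=> e f eP fP E; apply: key_inj; apply/eqP; case: ltgtP => //.
  by move/(rank_lt eP); rewrite E ltnn.
by move/(rank_lt fP); rewrite E ltnn.
Qed.

Lemma rank_max e : e \in left_pairs -> (rank e < N)%N.
Proof.
move=> eP; rewrite -card_left_pairs; apply: proper_card; apply/properP; split.
  by apply/subsetP=> f; rewrite inE => /andP[].
by exists e => //; rewrite inE ltxx andbF.
Qed.

Lemma exists_rank t : (t < N)%N -> exists2 e, e \in left_pairs & rank e = t.
Proof.
move=> tN; have u : uniq [seq rank e | e <- enum left_pairs].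
  by rewrite map_inj_in_uniq ?enum_uniq // => e f; rewrite !mem_enum; exact: rank_inj.
have [||_ me] := @uniq_min_size _ _ (iota 0 N) u.
- move=> _ /mapP[e eP ->]; rewrite mem_iota add0n /= rank_max //; by rewrite mem_enum in eP.
- by rewrite size_map size_iota -cardE card_left_pairs.
have : t \in [seq rank e | e <- enum left_pairs] by rewrite me mem_iota.
by case/mapP=> e; rewrite mem_enum => eP ->; exists e.
Qed.

(** In a triangle the slope of the long side lies between the two others. *)
Lemma rank_between x y z : leftof x y -> leftof y z ->
  (rank (x, y) < rank (x, z) < rank (y, z))%N || (rank (y, z) < rank (x, z) < rank (x, y))%N.
Proof.
move=> xy yz; have xz := leftof_trans xy yz.
have nxy : x != y by apply/eqP => E; rewrite E leftof_irr in xy.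
have nyz : y != z by apply/eqP => E; rewrite E leftof_irr in yz.
have nxz : x != z by apply/eqP => E; rewrite E leftof_irr in xz.
have := gp.2 x y z nxy nxz nyz.
have -> : orient (p x) (p y) (p z) = turn (dir (x, y)) (dir (y, z)).
  by rewrite /orient /turn /dir /=; ring.
move=> T0.
have T1 : turn (dir (x, y)) (dir (x, z)) = turn (dir (x, y)) (dir (y, z)).
  by rewrite /turn /dir /=; ring.
have T2 : turn (dir (x, z)) (dir (y, z)) = turn (dir (x, y)) (dir (y, z)).
  by rewrite /turn /dir /=; ring.
have T3 e f : turn (dir f) (dir e) = - turn (dir e) (dir f) by rewrite /turn; ring.
rewrite !rank_key ?inE //; move: T0; set X := turn (dir (x, y)) (dir (y, z)) in T1 T2 * => T0.
have k1 : (key (x, y) < key (x, z))%O = (0 < X) by rewrite key_turn // T1.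
have k2 : (key (x, z) < key (y, z))%O = (0 < X) by rewrite key_turn // T2.
have k3 : (key (y, z) < key (x, z))%O = (X < 0).
  by rewrite key_turn // T3 T2 ?oppr_eq0 ?oppr_gt0.
have k4 : (key (x, z) < key (x, y))%O = (X < 0).
  by rewrite key_turn // T3 T1 ?oppr_eq0 ?oppr_gt0.
rewrite k1 k2 k3 k4 !andbb.
by move: T0; case: ltgtP.
Qed.

Local Notation gap e := (N.-1 - rank e)%N.

(** The pair of rank r has been exchanged an odd number of times: its exchanges are
    the steps from t to t + 1 with t congruent to r modulo N. *)
Definition flipped t e : bool := odd ((t + gap e) %/ N).
Definition pbef t x y : bool :=
  if leftof x y then ~~ flipped t (x, y) else leftof y x && flipped t (y, x).

Lemma N_gt0 : (0 < N)%N.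
Proof. by rewrite bin_gt0. Qed.

Lemma pbefN t x y : x != y -> pbef t y x = ~~ pbef t x y.
Proof.
move=> xy; rewrite /pbef; case/orP: (leftof_total xy) => h; rewrite h (leftof_asym h) //=.
by rewrite negbK.
Qed.

Lemma pbef_irr t x : pbef t x x = false.
Proof. by rewrite /pbef leftof_irr. Qed.

Lemma flipped_between t x y z : leftof x y -> leftof y z ->
  flipped t (x, y) = flipped t (y, z) -> flipped t (x, z) = flipped t (x, y).
Proof.
move=> xy yz; have xz := leftof_trans xy yz.
have rP e : leftof e.1 e.2 -> (rank e < N)%N by move=> h; apply: rank_max; rewrite inE.
exact: odd_div_between N_gt0 (rP (x, y) xy) (rP (y, z) yz) (rank_between xy yz).
Qed.

(** A failure would be a directed triangle, in which the two short sides are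
    flipped alike and the long side differently, against [rank_between]. *)
Lemma pbef_trans t : transitive (pbef t).
Proof.
have neq x y : pbef t x y -> x != y by move=> h; apply/eqP => E; rewrite E pbef_irr in h.
have bL x y : leftof x y -> pbef t x y = ~~ flipped t (x, y) by rewrite /pbef => ->.
have bR x y : leftof x y -> pbef t y x = flipped t (x, y).
  by move=> h; rewrite /pbef h (leftof_asym h).
have cyc x y z : leftof x y -> leftof y z ->
    ~ (pbef t x y /\ pbef t y z /\ pbef t z x) /\ ~ (pbef t y x /\ pbef t z y /\ pbef t x z).
  move=> xy yz; have xz := leftof_trans xy yz; have fb := flipped_between (t := t) xy yz.
  rewrite !(bL _ _ xy) !(bL _ _ yz) !(bL _ _ xz) !(bR _ _ xy) !(bR _ _ yz) !(bR _ _ xz).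
  by move: fb; case: (flipped t (x, y)); case: (flipped t (y, z)); case: (flipped t (x, z)) => h;
    split=> -[h1 [h2 h3]] //; have := h erefl.
move=> y x z xy yz; have nxy := neq _ _ xy; have nyz := neq _ _ yz.
case: (eqVneq x z) => [E|nxz]; first by move: yz; rewrite -E (pbefN t nxy) xy.
case: (boolP (pbef t x z)) => // nz; have zx : pbef t z x by rewrite (pbefN t nxz).
exfalso; case/orP: (leftof_total nxy) => h1; case/orP: (leftof_total nyz) => h2;
  case/orP: (leftof_total nxz) => h3.
- by case: (cyc x y z h1 h2) => h _; apply: h.
- by case: (cyc x y z h1 h2) => h _; apply: h.
- by case: (cyc x z y h3 h2) => _ h; apply: h.
- by case: (cyc z x y h3 h1) => h _; apply: h.
- by case: (cyc y x z h1 h3) => _ h; apply: h.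
- by case: (cyc y z x h2 h3) => h _; apply: h.
- by case: (cyc z y x h2 h1) => _ h; apply: h.
- by case: (cyc z y x h2 h1) => _ h; apply: h.
Qed.

Lemma flipped_half t e : flipped (t + N) e = ~~ flipped t e.
Proof. by rewrite /flipped addnAC divnDr ?dvdnn // divnn N_gt0 addn1 oddS. Qed.

Lemma flippedS t e : e \in left_pairs ->
  flipped t.+1 e = flipped t e (+) (t %% N == rank e)%N.
Proof.
by move=> /rank_max eN; rewrite /flipped odd_divS.
Qed.

Lemma flipped_rank t e : e \in left_pairs -> (t %% N = rank e)%N ->
  flipped t e = odd (t %/ N).
Proof.
move=> /rank_max eN tE; have sm : (rank e + gap e < N)%N.
  by rewrite subnKC ?ltn_predL ?N_gt0 // -ltnS prednK ?N_gt0.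
rewrite /flipped {1}(divn_eq t N) tE -addnA divnMDl ?N_gt0 //.
by rewrite (divn_small sm) addn0.
Qed.

Lemma points_sweep : exists F : sweep 'I_n N, forall t x y, bef F t x y = pbef t x y.
Proof.
have /choice [e eP] : forall t : nat, exists e, e \in left_pairs /\ rank e = (t %% N)%N.
  by move=> t; have [|e eP eE] := @exists_rank (t %% N); [rewrite ltn_mod N_gt0 | exists e].
pose l t := if odd (t %/ N) then (e t).2 else (e t).1.
pose r t := if odd (t %/ N) then (e t).1 else (e t).2.
have total t x y : x != y -> pbef t x y || pbef t y x.
  by move=> xy; rewrite (pbefN t xy) orbN.
have phalf t x y : pbef (t + N) x y = pbef t y x.
  rewrite /pbef !flipped_half negbK; case h: (leftof x y); first by rewrite (leftof_asym h).
  by case: (leftof y x).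
have lr t : (leftof (e t).1 (e t).2) /\ flipped t (e t) = odd (t %/ N).
  by have [eL eR] := eP t; rewrite flipped_rank //; split=> //; move: eL; rewrite inE.
have sw t : pbef t (l t) (r t).
  have [h E] := lr t; rewrite /l /r; case: ifP => o; rewrite /pbef h ?(leftof_asym h) /= -surjective_pairing E o //.
have step t x y : pbef t.+1 x y =
    pbef t x y (+) (((x, y) == (l t, r t)) || ((x, y) == (r t, l t))).
  have [h _] := lr t; have [eL eR] := eP t.
  have -> : ((x, y) == (l t, r t)) || ((x, y) == (r t, l t)) =
     ((x, y) == e t) || ((y, x) == e t).
    rewrite /l /r [in RHS](surjective_pairing (e t)) !xpair_eqE.
    by case: ifP => _; rewrite // ![(y == _) && _]andbC // orbC.
  have rE f : f \in left_pairs -> (t %% N == rank f)%N = (f == e t).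
    by move=> fL; rewrite -eR eq_sym; apply/eqP/eqP => [/(rank_inj fL eL)|->].
  have ne a b : leftof b a -> ((a, b) == e t) = false.
    by move=> ba; apply/eqP => E; move: h; rewrite -E /= (leftof_asym ba).
  rewrite /pbef; case xy: (leftof x y).
    by rewrite flippedS ?rE ?inE // (ne y x xy) orbF addNb.
  case yx: (leftof y x) => /=; first by rewrite flippedS ?rE ?inE // (ne x y yx).
  case: (eqVneq x y) => [->|nxy]; last by move: (leftof_total nxy); rewrite xy yx.
  by rewrite orbb; apply/esym/eqP => E; move: h; rewrite -E /= leftof_irr.
have hp : N = 'C(#|'I_n|, 2) by rewrite card_ord.
by exists (Sweep pbef_irr pbef_trans total phalf sw step hp).
Qed.

End PointSet.

(** * Sides of lines and crossings of segments *)

(** Every unordered pair is exchanged exactly once during N steps. *)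
Lemma sum_swapped_pairs n N (F : sweep 'I_n N) (G : 'I_n -> 'I_n -> nat) :
  (forall i j, G i j = G j i) ->
  (\sum_(0 <= t < N) G (lsw F t) (rsw F t) =
   \sum_(i : 'I_n) \sum_(j : 'I_n | (i < j)%N) G i j)%N.
Proof.
move=> Gs; pose H (i j : 'I_n) := ((i != j) * G i j)%N.
have Hs i j : H i j = H j i by rewrite /H eq_sym Gs.
have H0 i : H i i = 0%N by rewrite /H eqxx.
have E : (\sum_i \sum_j H i j = 2 * \sum_(0 <= t < N) G (lsw F t) (rsw F t))%N.
  rewrite big_distrr /= (eq_bigr (fun t => \sum_i \sum_j swaps_pair F i j t * H i j)%N); last first.
    move=> t _; rewrite (eq_bigr (fun i => \sum_(j | i != j) swaps_pair F i j t * G (lsw F t) (rsw F t)))%N.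
      have := sum_swaps_pair F setT t; rewrite /swaps_in !inE muln1 => E2.
      rewrite -[2%N]E2 (eq_bigl predT) => [|i]; last by rewrite inE.
      rewrite big_distrl; apply: eq_bigr => i _; rewrite big_distrl /=.
      by apply: eq_bigl => j; rewrite inE.
    move=> i _; rewrite [RHS]big_mkcond; apply: eq_bigr => j _ /=; rewrite /H.
    case: (i != j); rewrite ?muln0 // mul1n.
    case sw: (swaps_pair F i j t); rewrite ?mul0n // !mul1n.
    by case/orP: sw => /eqP[-> ->].
  rewrite [RHS]exchange_big /=; apply: eq_bigr => i _.
  rewrite [RHS]exchange_big /=; apply: eq_bigr => j _.
  rewrite -big_distrl /= -/(count_times (swaps_pair F i j) 0 N) /H.
  case: (eqVneq i j) => ij; first by rewrite muln0.
  by have := swaps_pair_once F 0 ij; rewrite add0n => ->; rewrite mul1n.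
rewrite (sum_sym_ord Hs H0) in E.
apply/eqP; rewrite -(eqn_pmul2l (isT : 0 < 2)%N) -E; apply/eqP; congr (_ * _)%N.
by apply: eq_bigr => i _; apply: eq_bigr => j ij; rewrite /H -(inj_eq val_inj) /= (ltn_eqF ij) mul1n.
Qed.

Section Sides.
Local Open Scope ring_scope.
Variables (R : realType) (n : nat) (p : 'I_n -> R * R).
Hypotheses (n1 : (1 < n)%N) (gp : general_position p).
Variable F : sweep 'I_n 'C(n, 2).
Hypothesis befF : forall t x y, bef F t x y = pbef p t x y.
Implicit Types (a b c d x y z : 'I_n) (t : nat).
Local Notation N := 'C(n, 2).
Local Notation orient a b c := (orient (p a) (p b) (p c)).

Lemma flipped_first t e : (t < N)%N -> e \in left_pairs p -> flipped p t e = (rank p e < t)%N.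
Proof.
move=> tN /(rank_max gp) eN; rewrite /flipped; case: (ltnP (rank p e) t) => h.
  have -> : (t + (N.-1 - rank p e) = (t - (rank p e).+1) + N)%N by clear -h tN eN; lia.
  by rewrite divnDr ?dvdnn // divnn (N_gt0 n1) divn_small //; clear -h tN eN; lia.
by rewrite divn_small //; clear -h tN eN; lia.
Qed.

(** At the time when a and b are exchanged, the slopes that come first decide which
    points precede them, and these are the points on one side of their line. *)
Lemma pbef_orient a b z : leftof p a b -> z != a -> z != b ->
  pbef p (rank p (a, b)) z a = (orient a b z < 0).
Proof.
move=> ab za zb; have abL : (a, b) \in left_pairs p by rewrite inE.
have nab : a != b by apply/eqP => E; rewrite E leftof_irr in ab.
have O0 : orient a b z != 0 by apply: gp.2; rewrite // eq_sym.
have rN := rank_max gp abL.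
rewrite /pbef; case/orP: (leftof_total gp za) => h; rewrite h ?(leftof_asym h) /=.
  have hL : (z, a) \in left_pairs p by rewrite inE.
  have T : turn (dir p (z, a)) (dir p (a, b)) = orient a b z.
    by rewrite /turn /dir /Defs.orient /=; ring.
  rewrite flipped_first // (rank_key hL abL) key_turn ?T //.
  by rewrite -leNgt le_eqVlt (negbTE O0).
have hL : (a, z) \in left_pairs p by rewrite inE.
have T : turn (dir p (a, z)) (dir p (a, b)) = - orient a b z.
  by rewrite /turn /dir /Defs.orient /=; ring.
by rewrite flipped_first // (rank_key hL abL) key_turn ?T ?oppr_eq0 // oppr_gt0.
Qed.

Lemma bef_side t a b z : (t < N)%N -> swaps_pair F a b t -> z != a -> z != b ->
  bef F t z a = if leftof p a b then orient a b z < 0 else 0 < orient a b z.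
Proof.
move=> tN; have left u v w : swaps_pair F u v t -> leftof p u v -> w != u -> w != v ->
    bef F t w u = (orient u v w < 0).
  move=> sw uv wu wv; have uvL : (u, v) \in left_pairs p by rewrite inE.
  have nuv : u != v by apply/eqP => E; rewrite E leftof_irr in uv.
  move: sw; rewrite swaps_pair_bef // !befF /pbef uv (flippedS gp) // modn_small //.
  case: (eqVneq t (rank p (u, v))) => [-> _|_]; last by rewrite addbF eqxx.
  by rewrite -pbef_orient // /pbef.
move=> sw za zb; case ab: (leftof p a b); first exact: left.
have nab : a != b by case/orP: sw => /eqP[-> ->]; rewrite 1?[rsw _ _ == _]eq_sym lsw_neq.
have ba : leftof p b a by move: (leftof_total gp nab); rewrite ab.
rewrite (pair_adj sw za zb) (left b a) //; first by rewrite orient_swap oppr_lt0.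
by rewrite swaps_pairC.
Qed.

Lemma separated_orient a b c d : uniq [:: a; b; c; d] ->
  separated F a b c d = ((orient a b c < 0) != (orient a b d < 0)).
Proof.
move=> u; have := u; rewrite /= !inE !negb_or -!andbA => /and5P[ab ac ad bc /andP[bd /andP[cd _]]].
have [t tN sw] := pair_time F ab.
rewrite (separatedE tN sw u) (bef_side (z := c) tN sw) 1?[c == _]eq_sym //.
rewrite (bef_side (z := d) tN sw) 1?[d == _]eq_sym //.
case: (leftof p a b) => //.
have h1 : orient a b c != 0 by apply: gp.2.
have h2 : orient a b d != 0 by apply: gp.2.
by case: (ltgtP (orient a b c) 0) h1 => // ? _; case: (ltgtP (orient a b d) 0) h2.
Qed.

Lemma cr_points_ncrossings : cr_points p = ncrossings F.
Proof.
apply: eq_card => -[[i j] [k l]]; rewrite !inE /=; case ij: (i < j)%N => //=.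
case kl: (k < l)%N => //=; case ik: (i < k)%N => //=.
have nij : i != j by rewrite -(inj_eq val_inj) ltn_eqF.
have nkl : k != l by rewrite -(inj_eq val_inj) ltn_eqF.
have nik : i != k by rewrite -(inj_eq val_inj) ltn_eqF.
have nil : i != l by rewrite -(inj_eq val_inj) ltn_eqF // (ltn_trans ik).
have nouniq : ~~ uniq [:: i; j; k; l] -> crossing F i j k l = false.
  by move=> nu; apply: contraNF nu => /andP[/separated_uniq].
case: (eqVneq j k) => [E|njk].
  rewrite nouniq; last by rewrite /= !inE E eqxx !andbF.
  apply/asboolP; rewrite E; apply: (proj1 (segments_share _)).
  by apply: gp.2 => //; rewrite E in nij.
case: (eqVneq j l) => [E|njl].
  rewrite nouniq; last by rewrite /= !inE E eqxx orbT !andbF.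
  apply/asboolP; rewrite E; apply: (proj2 (segments_share _)).
  by apply: gp.2 => //; rewrite eq_sym.
have u : uniq [:: i; j; k; l] by rewrite /= !inE !negb_or nij nik nil njk njl nkl.
have u' : uniq [:: k; l; i; j].
  by rewrite /= !inE !negb_or nkl nij !(eq_sym k) !(eq_sym l) nik nil njk njl.
rewrite /crossing !separated_orient //.
have H := segments_crossP (gp.2 _ _ _ nij nik njk) (gp.2 _ _ _ nij nil njl) (_ : orient k l i != 0)
  (_ : orient k l j != 0).
have {}H := H (gp.2 _ _ _ nkl (_ : k != i) (_ : l != i)) (gp.2 _ _ _ nkl (_ : k != j) (_ : l != j)).
rewrite !(eq_sym k) !(eq_sym l) in H; have {}H := H nik nil njk njl.
by apply/asboolP/andP; rewrite H.
Qed.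

Definition nneg a b : nat := #|[set z | orient a b z < 0]|.
Definition npos a b : nat := #|[set z | 0 < orient a b z]|.

Lemma nneg_swap a b : nneg b a = npos a b.
Proof. by apply: eq_card => z; rewrite !inE orient_swap oppr_lt0. Qed.

Lemma npos_swap a b : npos b a = nneg a b.
Proof. by rewrite -nneg_swap. Qed.

Lemma nneg_npos a b : a != b -> (nneg a b + npos a b = n - 2)%N.
Proof.
move=> ab; rewrite /nneg /npos -cardsUI.
rewrite [X in (_ + X)%N](_ : _ = 0%N) ?addn0; last first.
  by apply/eqP; rewrite cards_eq0; apply/eqP/setP=> z; rewrite !inE; case: ltgtP.
have := cardsC [set a; b]; rewrite cards2 ab card_ord => E.
apply: (@addnI 2); rewrite subnKC // -[RHS]E; congr (_ + _)%N.
apply: eq_card => z; rewrite !inE negb_or.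
case: (eqVneq z a) => [->|za]; first by rewrite orient_left ltxx.
case: (eqVneq z b) => [->|zb]; first by rewrite orient_right ltxx.
have := gp.2 a b z ab; rewrite !(eq_sym _ z) => /(_ za zb); by case: ltgtP.
Qed.

Lemma nleft_side t : (t < N)%N -> nleft F setT t =
  if leftof p (lsw F t) (rsw F t) then nneg (lsw F t) (rsw F t) else npos (lsw F t) (rsw F t).
Proof.
move=> tN; have sw : swaps_pair F (lsw F t) (rsw F t) t by rewrite /swaps_pair eqxx.
have lr := lsw_neq F t; rewrite nleftE.
have E z : bef F t z (lsw F t) = if leftof p (lsw F t) (rsw F t)
    then orient (lsw F t) (rsw F t) z < 0 else 0 < orient (lsw F t) (rsw F t) z.
  case: (eqVneq z (lsw F t)) => [->|zl].
    by rewrite bef_irr orient_left ltxx if_same.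
  case: (eqVneq z (rsw F t)) => [->|zr]; last exact: bef_side.
  by rewrite bef_asym ?bef_sw // orient_right ltxx if_same.
by move: E; rewrite /nneg /npos; case: leftof => /= E; apply: eq_card => z; rewrite !inE; exact: E.
Qed.

Lemma halvingC a b : halving p b a = halving p a b.
Proof. by rewrite /halving -/(npos b a) -/(nneg b a) (npos_swap a b) (nneg_swap a b) orbC. Qed.

Lemma h_points_nhalving : h_points p = nhalving F.
Proof.
rewrite /nhalving /count_times (eq_big_nat _ _ (F2 := fun t => halving p (lsw F t) (rsw F t) : nat)).
  rewrite (sum_swapped_pairs F (G := fun i j => halving p i j : nat)) => [|i j]; last by rewrite halvingC.
  rewrite pair_big_dep /= /h_points -sum1dep_card big_mkcondr /=.
  by apply: eq_bigr => e _; case: halving.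
move=> t /andP[_ tN]; congr nat_of_bool; rewrite nleft_side //.
have lr := lsw_neq F t; have := nneg_npos lr.
rewrite /halving -/(npos _ _) -/(nneg _ _).
move: (nneg _ _) (npos _ _) n1 => u v n1' uv; case: ifP => _; clear -n1' uv; lia.
Qed.

Lemma cr_points_sum :
  (cr_points p + \sum_(i : 'I_n) \sum_(j : 'I_n | (i < j)%N) nneg i j * npos i j = 3 * 'C(n, 4))%N.
Proof.
rewrite cr_points_ncrossings -(ncrossings_sum F); congr (_ + _)%N.
rewrite -(sum_swapped_pairs F (G := fun i j => nneg i j * npos i j)%N); last first.
  by move=> i j; rewrite (nneg_swap i j) (npos_swap i j) mulnC.
apply: eq_big_nat => t /andP[_ tN]; rewrite nleft_side //.
have := nneg_npos (lsw_neq F t); move: (nneg _ _) (npos _ _) => u v <-.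
by case: ifP => _; rewrite ?addKn // addnK mulnC.
Qed.

End Sides.

(** * Extremal values from explicit configurations *)

Fixpoint pair_sum (A : Type) (f : A -> A -> nat) (s : seq A) : nat :=
  if s is a :: s' then sumn [seq f a b | b <- s'] + pair_sum f s' else 0.

Lemma pair_sumE (A : Type) (x0 : A) (f : A -> A -> nat) (s : seq A) (n : nat) : size s = n ->
  pair_sum f s = \sum_(i < n) \sum_(j < n | i < j) f (nth x0 s i) (nth x0 s j).
Proof.
move=> <-; transitivity (\sum_(0 <= i < size s) \sum_(i.+1 <= j < size s)
    f (nth x0 s i) (nth x0 s j)); last first.
  rewrite big_mkord; apply: eq_bigr => i _.
  by rewrite big_geq_mkord; apply: eq_bigl => j.
elim: s => [|a s IH] /=; first by rewrite big_geq.
rewrite big_nat_recl //= big_add1 /= IH; congr (_ + _).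
  by rewrite sumnE big_map (big_nth x0).
by apply: eq_bigr => i _; rewrite [RHS]big_add1.
Qed.

(** Nonnegative integer coordinates in binary, so that orientations are computed
    quickly. *)
Definition planar_point : Type := BinNums.N * BinNums.N.
Local Notation o := (BinNums.N0, BinNums.N0).

(** The positive terms of the orientation determinant, the others being collected
    in [cw_part], so that its sign is the outcome of a comparison. *)
Definition ccw_part (a b c : planar_point) : BinNums.N :=
  BinNat.N.add (BinNat.N.add (BinNat.N.mul a.1 b.2) (BinNat.N.mul b.1 c.2)) (BinNat.N.mul c.1 a.2).
Definition cw_part (a b c : planar_point) : BinNums.N :=
  BinNat.N.add (BinNat.N.add (BinNat.N.mul a.2 b.1) (BinNat.N.mul b.2 c.1)) (BinNat.N.mul c.2 a.1).

Definition count_right (s : seq planar_point) (a b : planar_point) : nat :=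
  count (fun c => BinNat.N.ltb (ccw_part a b c) (cw_part a b c)) s.
Definition count_left (s : seq planar_point) (a b : planar_point) : nat :=
  count (fun c => BinNat.N.ltb (cw_part a b c) (ccw_part a b c)) s.

(** The first condition says that no point lies on the line through two others.
    Crossings are not counted one by one but through [cr_points_sum]. *)
Definition realizes (s : seq planar_point) (h c : nat) : bool :=
  let n := size s in
  [&& pair_sum (fun a b => count_right s a b + count_left s a b != n - 2 : nat) s == 0,
      pair_sum (fun a b => (count_left s a b == n./2.-1) || (count_right s a b == n./2.-1) : nat) s == h
    & c + pair_sum (fun a b => count_right s a b * count_left s a b) s == 3 * 'C(n, 4)].

Section Realization.
Local Open Scope ring_scope.
Variables (R : realType) (s : seq planar_point) (n : nat).
Hypotheses (sn : size s = n) (n3 : (2 < n)%N).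

Definition embed (i : 'I_n) : R * R :=
  ((nat_of_bin (nth o s i).1)%:R, (nat_of_bin (nth o s i).2)%:R).

Lemma orient_embed i j k : orient (embed i) (embed j) (embed k) =
  (nat_of_bin (ccw_part (nth o s i) (nth o s j) (nth o s k)))%:R -
  (nat_of_bin (cw_part (nth o s i) (nth o s j) (nth o s k)))%:R.
Proof.
have addE (x y : BinNums.N) : nat_of_bin (BinNat.N.add x y) = (nat_of_bin x + nat_of_bin y)%N.
  by lia.
have mulE (x y : BinNums.N) : nat_of_bin (BinNat.N.mul x y) = (nat_of_bin x * nat_of_bin y)%N.
  by lia.
rewrite /ccw_part /cw_part !addE !mulE !natrD !natrM /orient /=; ring.
Qed.

Lemma ltb_nat (x y : BinNums.N) : BinNat.N.ltb x y = (nat_of_bin x < nat_of_bin y)%N.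
Proof. lia. Qed.

Lemma card_nth (P : pred planar_point) : #|[set k : 'I_n | P (nth o s k)]| = count P s.
Proof.
by rewrite -sum1dep_card -sum1_count (big_nth o) big_mkord sn.
Qed.

Lemma nneg_embed i j : nneg embed i j = count_right s (nth o s i) (nth o s j).
Proof.
rewrite /count_right -card_nth; apply: eq_card => k; rewrite !inE orient_embed subr_lt0 ltr_nat.
by rewrite ltb_nat.
Qed.

Lemma npos_embed i j : npos embed i j = count_left s (nth o s i) (nth o s j).
Proof.
rewrite /count_left -card_nth; apply: eq_card => k; rewrite !inE orient_embed subr_gt0 ltr_nat.
by rewrite ltb_nat.
Qed.

(** A third point on the line through two points would lie on neither side of it;
    two equal points have no points on either side at all. *)
Lemma general_position_card (p : 'I_n -> R * R) :
  (forall i j : 'I_n, (i < j)%N -> (nneg p i j + npos p i j)%N = (n - 2)%N) -> general_position p.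
Proof.
move=> H; have {}H i j : i != j -> (nneg p i j + npos p i j)%N = (n - 2)%N.
  rewrite -(inj_eq val_inj) neq_ltn => /orP[/H//|/H <-].
  by rewrite (nneg_swap p j i) (npos_swap p j i) addnC.
split=> [i j pij|i j k ij ik jk].
  apply/eqP; apply: contraT => /H; rewrite /nneg /npos.
  have z k : orient (p i) (p j) (p k) = 0 by rewrite pij /orient !subrr !mul0r subrr.
  rewrite !(eq_card0 (A := [set _ | _])); first by move: n3; clear; lia.
    by move=> k; rewrite !inE z ltxx.
  by move=> k; rewrite !inE z ltxx.
apply/negP => /eqP Ok; have := H i j ij.
rewrite /nneg /npos -cardsUI [X in (_ + X)%N](_ : _ = 0%N) ?addn0; last first.
  by apply/eqP; rewrite cards_eq0; apply/eqP/setP=> z; rewrite !inE; case: ltgtP.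
apply/eqP; rewrite neq_ltn; apply/orP; left.
have c3 : #|~: [set i; j; k]| = (n - 3)%N.
  have := cardsC [set i; j; k]; rewrite -setUA cardsU1 cards2 !inE negb_or ij ik jk card_ord.
  by move: n3; clear; lia.
have lt3 : (#|~: [set i; j; k]| < n - 2)%N by rewrite c3; move: n3; clear; lia.
apply: leq_ltn_trans lt3; apply: subset_leq_card; apply/subsetP=> z; rewrite !inE.
apply: contraTN => /orP[/orP[]|] /eqP->.
- by rewrite orient_left ltxx.
- by rewrite orient_right ltxx.
by rewrite Ok ltxx.
Qed.

Lemma realizesP h c : realizes s h c ->
  [/\ general_position embed, h_points embed = h & cr_points embed = c].
Proof.
rewrite /realizes sn !(pair_sumE o _ sn) => /and3P[/eqP bad /eqP hh /eqP cc].
have gp : general_position embed.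
  apply: general_position_card => i j ij; rewrite nneg_embed npos_embed.
  move/eqP: bad; rewrite sum_nat_eq0 => /forallP/(_ i) /=; rewrite sum_nat_eq0.
  by move/forallP/(_ j); rewrite ij /= eqb0 negbK => /eqP.
have n1 : (1 < n)%N by exact: ltnW.
split=> //.
  rewrite -hh /h_points -sum1dep_card big_mkcondr -(pair_big_dep xpredT (fun i j : 'I_n => (i < j)%N)
    (fun i j => if halving embed i j then 1%N else 0%N)) /=.
  apply: eq_bigr => i _; apply: eq_bigr => j _.
  by rewrite /halving -/(npos embed i j) -/(nneg embed i j) npos_embed nneg_embed; case: ifP.
have [F befF] := points_sweep n1 gp.
have := cr_points_sum n1 gp befF; rewrite -cc.
rewrite (eq_bigr (fun i : 'I_n => \sum_(j < n | (i < j)%N)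
   (count_right s (nth o s i) (nth o s j) * count_left s (nth o s i) (nth o s j))%N)).
  by move/addIn.
by move=> i _; apply: eq_bigr => j _; rewrite nneg_embed npos_embed.
Qed.

End Realization.

Lemma max_of_eq (S : nat -> Prop) m : S m -> (forall k, S k -> k <= m) -> max_of S = m.
Proof.
move=> Sm mS; have [S' m'] : is_max S (max_of S) by apply: xgetPex; exists m.
by apply/eqP; rewrite eqn_leq mS // m'.
Qed.

Lemma min_of_eq (S : nat -> Prop) m : S m -> (forall k, S k -> m <= k) -> min_of S = m.
Proof.
move=> Sm mS; have [S' m'] : is_min S (min_of S) by apply: xgetPex; exists m.
by apply/eqP; rewrite eqn_leq mS // m'.
Qed.

(** The point set s, and the allowable sequence of its sweep, attain bounds that
    hold for all sweeps. *)
Lemma extremal_values (R : realType) (s : seq planar_point) n h c :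
  size s = n -> 3 < n -> realizes s h c -> halving_bound n = h -> crossing_bound n = c ->
  [/\ halving_max R n = pseudo_halving_max n, rectilinear_cr R n = pseudolinear_cr n,
      halving_max R n = h & rectilinear_cr R n = c].
Proof.
move=> sn n3 real hb cb; have n1 : 1 < n by lia.
have [gp hE cE] := @realizesP R s n sn (ltnW n3) h c real.
have [F befF] := points_sweep n1 gp.
have [Pi PiA PiF] := sweep_allowable F n1.
have H1 : halving_max R n = h.
  apply: max_of_eq; first by exists (@embed R s n).
  move=> _ [p [gp' <-]]; have [F' bF'] := points_sweep n1 gp'.
  by rewrite (h_points_nhalving n1 gp' bF') -hb; apply: nhalving_bound.
have C1 : rectilinear_cr R n = c.
  apply: min_of_eq; first by exists (@embed R s n).
  move=> _ [p [gp' <-]]; have [F' bF'] := points_sweep n1 gp'.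
  by rewrite (cr_points_ncrossings n1 gp' bF') -cb; apply: ncrossings_bound.
have H2 : pseudo_halving_max n = h.
  apply: max_of_eq.
    exists Pi; split=> //; rewrite (represents_h PiF n1).
    by rewrite -(h_points_nhalving n1 gp befF).
  move=> _ [Pi' [PiA' <-]]; have [F' bF'] := allowable_sweep PiA'.
  by rewrite (represents_h bF' n1) -hb; apply: nhalving_bound.
have C2 : pseudolinear_cr n = c.
  apply: min_of_eq.
    exists Pi; split=> //; rewrite (represents_cr PiF).
    by rewrite -(cr_points_ncrossings n1 gp befF).
  move=> _ [Pi' [PiA' <-]]; have [F' bF'] := allowable_sweep PiA'.
  by rewrite (represents_cr bF') -cb; apply: ncrossings_bound.
by rewrite H1 H2 C1 C2.
Qed.

(** * Point sets attaining the bounds *)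

Definition on_grid (s : seq (nat * nat)) : seq planar_point :=
  [seq (bin_of_nat q.1, bin_of_nat q.2) | q <- s].

Definition points_14 : seq (nat * nat) := [::
  (0, 79); (20, 14); (22, 27); (58, 43); (43, 44); (18, 54); (16, 60); (4, 74);
  (31, 32); (15, 0); (50, 42); (53, 41); (17, 5); (39, 46)].

Definition points_16 : seq (nat * nat) := [::
  (63, 79); (71, 64); (140, 232); (42, 51); (86, 58); (100, 123); (35, 48);
  (0, 15); (83, 39); (97, 7); (99, 0); (85, 64); (110, 156); (107, 151);
  (116, 173); (22, 35)].

Definition points_18 : seq (nat * nat) := [::
  (233, 146); (459, 223); (343, 148); (148, 144); (349, 84); (0, 173); (45, 167);
  (371, 42); (359, 184); (71, 164); (418, 0); (297, 100); (445, 214); (404, 15);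
  (339, 177); (192, 134); (365, 60); (475, 233)].

Definition points_20 : seq (nat * nat) := [::
  (291, 312); (0, 0); (24, 72); (137, 288); (65, 361); (80, 187); (415, 322);
  (45, 138); (200, 329); (171, 303); (50, 409); (81, 267); (45, 417); (62, 376);
  (34, 97); (475, 327); (330, 312); (82, 280); (40, 429); (88, 351)].

Definition points_22 : seq (nat * nat) := [::
  (280, 225); (656, 21); (397, 324); (525, 158); (440, 175); (194, 147); (64, 97);
  (509, 180); (381, 652); (304, 256); (678, 0); (367, 398); (110, 115); (379, 548);
  (384, 358); (0, 71); (546, 134); (377, 418); (137, 134); (613, 54); (376, 424);
  (244, 165)].

Definition points_23 : seq (nat * nat) := [::
  (262, 639); (269, 241); (175, 22); (439, 516); (162, 671); (271, 404);
  (872, 617); (280, 629); (309, 327); (735, 595); (4, 851); (166, 0); (58, 806);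
  (289, 285); (525, 564); (16, 840); (267, 423); (502, 563); (0, 855); (969, 632);
  (76, 775); (191, 64); (433, 509)].

Definition points_24 : seq (nat * nat) := [::
  (285, 128); (199, 194); (265, 151); (319, 123); (344, 112); (229, 141);
  (332, 116); (376, 100); (114, 364); (120, 243); (111, 333); (97, 402); (89, 435);
  (139, 297); (94, 420); (78, 474); (55, 83); (134, 137); (78, 91); (38, 49);
  (20, 27); (86, 136); (28, 39); (0, 0)].

Definition points_25 : seq (nat * nat) := [::
  (220, 147); (512, 113); (292, 313); (615, 71); (317, 230); (177, 87); (382, 129);
  (274, 414); (237, 161); (449, 144); (276, 402); (0, 0); (678, 50); (64, 39);
  (477, 127); (280, 281); (44, 26); (400, 132); (270, 261); (33, 19); (267, 497);
  (105, 56); (125, 64); (651, 58); (321, 223)].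

Definition points_26 : seq (nat * nat) := [::
  (413, 493); (447, 661); (433, 615); (396, 319); (436, 633); (453, 678);
  (285, 380); (408, 569); (187, 438); (27, 480); (64, 470); (402, 404); (38, 476);
  (0, 488); (467, 280); (138, 439); (501, 203); (635, 28); (606, 66); (311, 419);
  (627, 39); (656, 0); (362, 473); (553, 150); (280, 373); (407, 521)].

Definition points_27 : seq (nat * nat) := [::
  (1297, 554); (911, 1353); (694, 480); (922, 1521); (877, 1869); (860, 661);
  (1510, 569); (1060, 1020); (164, 109); (1256, 561); (920, 1146); (392, 264);
  (1968, 333); (873, 1921); (849, 553); (1826, 381); (915, 1248); (747, 494);
  (1936, 346); (1085, 987); (788, 515); (1977, 329); (0, 0); (1765, 429);
  (1673, 477); (888, 1771); (863, 680)].

Theorem mainTheorem5 (R : realType) (n hn crn : nat)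
  (row : (n, hn, crn) \in
     [:: (14, 22, 324); (16, 27, 603); (18, 33, 1029); (20, 38, 1657);
         (22, 44, 2528); (23, 75, 3077); (24, 51, 3699); (25, 85, 4430);
         (26, 57, 5250); (27, 96, 6180)]%N) :
  [/\ halving_max R n = pseudo_halving_max n,
      rectilinear_cr R n = pseudolinear_cr n,
      halving_max R n = hn
    & rectilinear_cr R n = crn].
Proof.
have row_of s h c : realizes s h c -> 3 < size s ->
    (halving_bound (size s) == h) && (crossing_bound (size s) == c) ->
    (n, hn, crn) = (size s, h, c) ->
    [/\ halving_max R n = pseudo_halving_max n, rectilinear_cr R n = pseudolinear_cr n,
        halving_max R n = hn & rectilinear_cr R n = crn].
  by move=> real s3 /andP[/eqP hb /eqP cb] [-> -> ->]; exact: extremal_values real hb cb.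
move: row; rewrite !inE.
case/predU1P; first by apply: (row_of (on_grid points_14)); vm_compute.
case/predU1P; first by apply: (row_of (on_grid points_16)); vm_compute.
case/predU1P; first by apply: (row_of (on_grid points_18)); vm_compute.
case/predU1P; first by apply: (row_of (on_grid points_20)); vm_compute.
case/predU1P; first by apply: (row_of (on_grid points_22)); vm_compute.
case/predU1P; first by apply: (row_of (on_grid points_23)); vm_compute.
case/predU1P; first by apply: (row_of (on_grid points_24)); vm_compute.
case/predU1P; first by apply: (row_of (on_grid points_25)); vm_compute.
case/predU1P; first by apply: (row_of (on_grid points_26)); vm_compute.
by move/eqP; apply: (row_of (on_grid points_27)); vm_compute.
Qed.
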